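(* Let $U$ be a left bialgebroid over $A$ and let $N$ be a braided commutative Yetter-Drinfel'd algebra over $U$. Then $C^\bullet_{\mathrm{co}}(U,N)=({}_\triangleright U_\triangleleft)^{\otimes_A\bullet}\otimes_AN$, with the operations $\circ_i$, the multiplication $\mu$, the identity $\mathbb 1$ and the element $e$ specified in the context, is an operad with multiplication. Hence the cohomology groups $H^\bullet_{\mathrm{co}}(U,N):=H(C^\bullet_{\mathrm{co}}(U,N),\beta)$ carry the structure of a Gerstenhaber algebra (with the cup product and bracket induced by this operad with multiplication).
   Context: **Bialgebroids.** $k$ is a commutative ring, unadorned tensor products are over $k$, algebras are unital associative. Let $A,U$ be $k$-algebras with a $k$-algebra map $\eta:A\otimes A^{\mathrm{op}}\to U$; put $s(a)=\eta(a\otimes1)$, $t(a)=\eta(1\otimes a)$. A left $U$-module $N$ is an $A$-bimodule via $a\triangleright n\triangleleft b:=s(a)t(b)n$; this applies to $U$. $U\otimes_A U:=U_\triangleleft\otimes_A{}_\triangleright U$ (so $t(a)u\otimes v=u\otimes s(a)v$). $U$ is a left bialgebroid over $A$ if it carries $A$-bimodule maps (for $\triangleright,\triangleleft$) $\Delta:U\to U\otimes_AU$, $u\mapsto u_{(1)}\otimes_Au_{(2)}$, and $\varepsilon:U\to A$ making it a coassociative counital coalgebra in $A$-bimodules, such that $\Delta$ takes values in $U\times_AU=\{\sum u_i\otimes_Av_i:\ \sum u_it(a)\otimes_A v_i=\sum u_i\otimes_A v_is(a)\ \forall a\in A\}$ and is a unital algebra map into it, $\varepsilon(1)=1$, and $\varepsilon(uv)=\varepsilon(us(\varepsilon(v)))=\varepsilon(ut(\varepsilon(v)))$.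 **Yetter-Drinfel'd algebras.** A left $U$-comodule is a left $A$-module $N$ with a coassociative counital left $A$-linear map $\Delta_N:N\to U_\triangleleft\otimes_AN$, $n\mapsto n_{(-1)}\otimes_An_{(0)}$; it has the induced right $A$-action $na:=\varepsilon(n_{(-1)}t(a))n_{(0)}$. Iterated coactions are written $n_{(-p)}\otimes_A\cdots\otimes_An_{(-1)}\otimes_An_{(0)}$. A Yetter-Drinfel'd module is a left $U$-module and left $U$-comodule $N$ whose two $A$-bimodule structures coincide and with $(u_{(1)}n)_{(-1)}u_{(2)}\otimes_A(u_{(1)}n)_{(0)}=u_{(1)}n_{(-1)}\otimes_Au_{(2)}n_{(0)}$. A Yetter-Drinfel'd algebra is such an $N$ that is also an $A$-ring (monoid in $A$-bimodules, product $\cdot_N$, unit $1_N$) with $u(n\cdot_Nn')=(u_{(1)}n)\cdot_N(u_{(2)}n')$, $u1_N=\varepsilon(u)\triangleright1_N=1_N\triangleleft\varepsilon(u)$, $\Delta_N(1_N)=1_U\otimes_A1_N$ and $\Delta_N(n\cdot_Nn')=n_{(-1)}n'_{(-1)}\otimes_An_{(0)}\cdot_Nn'_{(0)}$. It is braided commutative if $n\cdot_Nn'=(n_{(-1)}n')\cdot_Nn_{(0)}$ for all $n,n'\in N$. **Operads.** An operad is a sequence of $k$-modules $O(n)$, $n\ge0$, with $\mathbb 1\in O(1)$ and $k$-bilinear $\circ_i:O(p)\otimes O(q)\to O(p+q-1)$ such that, for $\varphi\in O(p),\psi\in O(q),\chi\in O(r)$: $\varphi\circ_i\psi=0$ if $p<i$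 or $p=0$; $(\varphi\circ_i\psi)\circ_j\chi$ equals $(\varphi\circ_j\chi)\circ_{i+r-1}\psi$ if $j<i$, $\varphi\circ_i(\psi\circ_{j-i+1}\chi)$ if $i\le j<q+i$, and $(\varphi\circ_{j-q+1}\chi)\circ_i\psi$ if $j\ge q+i$; and $\varphi\circ_i\mathbb 1=\varphi$ for $i\le p$, $\mathbb 1\circ_1\varphi=\varphi$. It is an operad with multiplication if there are $\mu\in O(2)$, $e\in O(0)$ with $\mu\circ_1\mu=\mu\circ_2\mu$ and $\mu\circ_1e=\mu\circ_2e=\mathbb 1$. With $|n|:=n-1$ put $\varphi\bar\circ\psi=(-1)^{|p||q|}\sum_{i=1}^p(-1)^{|q||i|}\varphi\circ_i\psi$, $\{\varphi,\psi\}=\varphi\bar\circ\psi-(-1)^{|p||q|}\psi\bar\circ\varphi$, $\varphi\smile\psi=(\mu\circ_1\varphi)\circ_{p+1}\psi$; the associated differential is $\{\mu,\cdot\}$, and the cup product and bracket descend to its cohomology. **Gerstenhaber algebra.** A graded commutative $k$-algebra $V=\bigoplus_{p\ge0}V^p$ ($\alpha\smile\beta=(-1)^{pq}\beta\smile\alpha$) with a graded Lie bracket $V^{p+1}\otimes V^{q+1}\to V^{p+q+1}$ on the desuspension $V[1]=\bigoplus_pV^{p+1}$ satisfying $\{\gamma,\alpha\smile\beta\}=\{\gamma,\alpha\}\smile\beta+(-1)^{pq}\alpha\smile\{\gamma,\beta\}$ for $\gamma\in V^{p+1},\alpha\in V^q$. **The structure on $C^\bullet_{\mathrm{co}}(U,N)$.**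 $C^p_{\mathrm{co}}(U,N)=U^{\otimes_Ap}\otimes_AN$, elementary tensors written $(u^1,\dots,u^p,n)$. For $i=1,\dots,p$, $$(u^1,\dots,u^p,n)\circ_i(v^1,\dots,v^q,n'):=\big(u^1,\dots,u^{i-1},u^i_{(1)}v^1,\dots,u^i_{(q)}v^q,(u^i_{(q+1)}n')_{(-p+i)}u^{i+1},\dots,(u^i_{(q+1)}n')_{(-1)}u^p,(u^i_{(q+1)}n')_{(0)}\cdot_Nn\big),$$ for $q=0$: $(u^1,\dots,u^p,n)\circ_in'=(u^1,\dots,u^{i-1},(u^in')_{(-p+i)}u^{i+1},\dots,(u^in')_{(-1)}u^p,(u^in')_{(0)}\cdot_Nn)$; and $n\circ_i(\cdot)=0$ for $n\in C^0_{\mathrm{co}}(U,N)=N$. Further $\mu=(1_U,1_U,1_N)$, $\mathbb 1=(1_U,1_N)$, $e=1_N$. The differential is $\beta=\sum_{i=0}^{n+1}(-1)^i\delta_i$ in degree $n$, with $\delta_0(u^1,\dots,u^n,m)=(1,u^1,\dots,u^n,m)$, $\delta_i(u^1,\dots,u^n,m)=(u^1,\dots,\Delta(u^i),\dots,u^n,m)$ for $1\le i\le n$, $\delta_{n+1}(u^1,\dots,u^n,m)=(u^1,\dots,u^n,m_{(-1)},m_{(0)})$; it equals $\{\mu,\cdot\}$. *)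

(* Defs.v *)
From HB Require Import structures.
From mathcomp Require Import all_boot all_order all_algebra.
From mathcomp Require Import ring_quotient boolp.

Set Implicit Arguments.
Unset Strict Implicit.
Unset Printing Implicit Defensive.

Import GRing.Theory.
Local Open Scope ring_scope.
Local Open Scope quotient_scope.

(* Unital associative k-algebras.  MathComp's algType excludes the zero      *)
(* algebra; this is the same notion without the axiom 1 != 0.                *)
Record pzAlgType (k : comPzRingType) := PzAlg {
  pzalg_lmod : lmodType k;
  pzalg_mul : pzalg_lmod -> pzalg_lmod -> pzalg_lmod;
  pzalg_one : pzalg_lmod;
  pzalg_mulA : associative pzalg_mul;
  pzalg_mul1l : left_id pzalg_one pzalg_mul;
  pzalg_mul1r : right_id pzalg_one pzalg_mul;
  pzalg_mulDl : left_distributive pzalg_mul +%R;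
  pzalg_mulDr : right_distributive pzalg_mul +%R;
  pzalg_scalerAl : forall (c : k) x y,
    c *: pzalg_mul x y = pzalg_mul (c *: x) y;
  pzalg_scalerAr : forall (c : k) x y,
    c *: pzalg_mul x y = pzalg_mul x (c *: y)
}.

Section PzAlgInstances.
Variables (k : comPzRingType) (A : pzAlgType k).

Definition pzalg_sort : Type := pzalg_lmod A.

HB.instance Definition _ := GRing.Lmodule.copy pzalg_sort (pzalg_lmod A).
HB.instance Definition _ := GRing.Zmodule_isPzRing.Build pzalg_sort
  (@pzalg_mulA k A) (@pzalg_mul1l k A) (@pzalg_mul1r k A)
  (@pzalg_mulDl k A) (@pzalg_mulDr k A).

Definition pzalg_lmodType : lmodType k := pzalg_sort.

Lemma pz_scalerAl (c : k) (x y : pzalg_sort) : c *: (x * y) = (c *: x) * y.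
Proof. exact: pzalg_scalerAl. Qed.

Lemma pz_scalerAr (c : k) (x y : pzalg_sort) : c *: (x * y) = x * (c *: y).
Proof. exact: pzalg_scalerAr. Qed.

End PzAlgInstances.

Coercion pzalg_sort : pzAlgType >-> Sortclass.
Coercion pzalg_lmodType : pzAlgType >-> GRing.Lmodule.type.

(* A k-module with an action of A.  The same k-module carries several        *)
(* actions below, so they are explicit functions, not canonical instances.   *)
Record actmod (k : comPzRingType) (A : Type) := ActMod {
  carrier :> lmodType k;
  act : A -> carrier -> carrier
}.
Arguments ActMod {k A}.
Arguments act {k A a}.

Record is_left_module (k : comPzRingType) (A : pzAlgType k) (M : actmod k A) :
    Prop := IsLeftModule {
  act_linear_r : forall a : A, linear (act a : M -> M);
  act_linear_l : forall m : M, linear (fun a : A => act a m);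
  act1 : forall m : M, act 1 m = m;
  actM : forall (a b : A) (m : M), act (a * b) m = act a (act b m)
}.

Definition pzalg_of (k : comPzRingType) (A : algType k) : pzAlgType k :=
  @PzAlg k A *%R 1 (@mulrA A) (@mul1r A) (@mulr1 A) (@mulrDl A) (@mulrDr A)
    (@scalerAl k A) (@scalerAr k A).

Section Tensor.
Variables (k : comPzRingType) (A : Type) (M N : lmodType k).
Variables (ra : M -> A -> M) (la : A -> N -> N).

(* A list [:: (m_1, n_1); ...; (m_r, n_r)] stands for the formal sum of the  *)
(* m_i (x) n_i.  tens_eq is the congruence generated by the defining         *)
(* relations of the tensor product; a negative is absorbed in the left       *)
(* factor.  The scalar c in tens_eq_bal makes the relations stable under k   *)
(* without any assumption on ra and la.                                      *)
Inductive tens_eq : seq (M * N) -> seq (M * N) -> Prop :=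
| tens_eq_refl l : tens_eq l l
| tens_eq_sym l1 l2 : tens_eq l1 l2 -> tens_eq l2 l1
| tens_eq_trans l1 l2 l3 : tens_eq l1 l2 -> tens_eq l2 l3 -> tens_eq l1 l3
| tens_eq_cat l1 l2 l1' l2' :
    tens_eq l1 l1' -> tens_eq l2 l2' -> tens_eq (l1 ++ l2) (l1' ++ l2')
| tens_eq_catC l1 l2 : tens_eq (l1 ++ l2) (l2 ++ l1)
| tens_eq_0 n : tens_eq [:: (0, n)] [::]
| tens_eq_Dl m m' n : tens_eq [:: (m + m', n)] [:: (m, n); (m', n)]
| tens_eq_Dr m n n' : tens_eq [:: (m, n + n')] [:: (m, n); (m, n')]
| tens_eq_Z c m n : tens_eq [:: (c *: m, n)] [:: (m, c *: n)]
| tens_eq_bal c m a n : tens_eq [:: (c *: ra m a, n)] [:: (c *: m, la a n)].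

Definition tens_eqb (l1 l2 : seq (M * N)) : bool := `[< tens_eq l1 l2 >].

Lemma tens_eqb_equiv : equiv_class_of tens_eqb.
Proof.
split=> [l | l1 l2 | l2 l1 l3].
- exact/asboolP/tens_eq_refl.
- by apply/asboolP/asboolP => /tens_eq_sym.
- by move=> /asboolP e1 /asboolP e2; apply/asboolP; apply: tens_eq_trans e1 e2.
Qed.

Canonical tens_eqb_equivRel := EquivRelPack tens_eqb_equiv.

Definition tensor := {eq_quot tens_eqb}.

HB.instance Definition _ := Choice.on tensor.
HB.instance Definition _ := EqQuotient.on tensor.

Definition pure (m : M) (n : N) : tensor := \pi_tensor [:: (m, n)].

Definition tens_scale_seq (c : k) (l : seq (M * N)) : seq (M * N) :=
  [seq (c *: z.1, z.2) | z <- l].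

Definition tens_add (x y : tensor) : tensor := \pi_tensor (repr x ++ repr y).
Definition tens_scale (c : k) (x : tensor) : tensor :=
  \pi_tensor (tens_scale_seq c (repr x)).
Definition tens_opp : tensor -> tensor := tens_scale (-1).

Lemma tens_piP l1 l2 : tens_eq l1 l2 <-> \pi_tensor l1 = \pi_tensor l2.
Proof.
split=> [e|/eqP]; first by apply/eqP; rewrite piE; apply/asboolP.
by rewrite piE => /asboolP.
Qed.

Lemma tens_add_pi l1 l2 : tens_add (\pi l1) (\pi l2) = \pi_tensor (l1 ++ l2).
Proof.
by apply/tens_piP/tens_eq_cat; apply/tens_piP; rewrite reprK.
Qed.

Lemma tens_scale_seqP c l1 l2 :
  tens_eq l1 l2 -> tens_eq (tens_scale_seq c l1) (tens_scale_seq c l2).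
Proof.
elim=> {l1 l2} /=.
- by move=> l; apply: tens_eq_refl.
- by move=> ? ? _ ?; apply: tens_eq_sym.
- by move=> ? ? ? _ e1 _ e2; apply: tens_eq_trans e1 e2.
- by move=> ? ? ? ? _ e1 _ e2; rewrite /tens_scale_seq !map_cat;
    apply: tens_eq_cat.
- by move=> ? ?; rewrite /tens_scale_seq !map_cat; apply: tens_eq_catC.
- by move=> n; rewrite scaler0; apply: tens_eq_0.
- by move=> *; rewrite scalerDr; apply: tens_eq_Dl.
- by move=> *; apply: tens_eq_Dr.
- by move=> d *; rewrite scalerA mulrC -scalerA; apply: tens_eq_Z.
- by move=> d *; rewrite !scalerA; apply: tens_eq_bal.
Qed.

Lemma tens_scale_pi c l : tens_scale c (\pi l) = \pi_tensor (tens_scale_seq c l).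
Proof.
by apply/tens_piP/tens_scale_seqP/tens_piP; rewrite reprK.
Qed.

Lemma tens_addA : associative tens_add.
Proof.
elim/quotW=> x; elim/quotW=> y; elim/quotW=> z.
by rewrite !tens_add_pi catA.
Qed.

Lemma tens_addC : commutative tens_add.
Proof.
elim/quotW=> x; elim/quotW=> y; rewrite !tens_add_pi.
exact/tens_piP/tens_eq_catC.
Qed.

Lemma tens_add0 : left_id (\pi_tensor [::]) tens_add.
Proof. by elim/quotW=> x; rewrite tens_add_pi. Qed.

Lemma tens_scale0 x : tens_scale 0 x = \pi_tensor [::].
Proof.
elim/quotW: x => x; rewrite tens_scale_pi; apply/tens_piP.
elim: x => [|z l IH] /=; first exact: tens_eq_refl.
rewrite scale0r -cat1s -[X in tens_eq _ X]cat0s.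
exact: tens_eq_cat (tens_eq_0 _) IH.
Qed.

Lemma tens_scaleDl x a b :
  tens_scale (a + b) x = tens_add (tens_scale a x) (tens_scale b x).
Proof.
elim/quotW: x => x; rewrite !tens_scale_pi tens_add_pi; apply/tens_piP.
elim: x => [|z l IH] /=; first exact: tens_eq_refl.
rewrite scalerDl -cat1s.
apply: tens_eq_trans (tens_eq_cat (tens_eq_Dl _ _ _) IH) _.
rewrite -[_ :: _ ++ _]cat1s -[[:: _; _]]cat1s -catA.
apply: tens_eq_cat; first exact: tens_eq_refl.
rewrite -[X in tens_eq _ (_ ++ X)]cat1s !catA.
by apply: tens_eq_cat; [apply: tens_eq_catC | apply: tens_eq_refl].
Qed.

Lemma tens_addN : left_inverse (\pi_tensor [::]) tens_opp tens_add.
Proof.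
move=> x; rewrite -[X in tens_add _ X](_ : tens_scale 1 x = x).
  by rewrite -tens_scaleDl addNr tens_scale0.
elim/quotW: x => x; rewrite tens_scale_pi; congr (\pi _).
by rewrite -[RHS]map_id; apply: eq_map => -[m n]; rewrite scale1r.
Qed.

HB.instance Definition _ :=
  GRing.isZmodule.Build tensor tens_addA tens_addC tens_add0 tens_addN.

Lemma tens_scaleA a b x : tens_scale a (tens_scale b x) = tens_scale (a * b) x.
Proof.
elim/quotW: x => x; rewrite !tens_scale_pi; congr (\pi _).
by rewrite /tens_scale_seq -map_comp; apply: eq_map => -[m n] /=; rewrite scalerA.
Qed.

Lemma tens_scale1 : left_id 1 tens_scale.
Proof.
elim/quotW=> x; rewrite tens_scale_pi; congr (\pi _).
by rewrite -[RHS]map_id; apply: eq_map => -[m n]; rewrite scale1r.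
Qed.

Lemma tens_scaleDr : right_distributive tens_scale +%R.
Proof.
move=> c; elim/quotW=> x; elim/quotW=> y.
rewrite !/(_ + _) /= tens_add_pi !tens_scale_pi tens_add_pi.
by rewrite /tens_scale_seq map_cat.
Qed.

HB.instance Definition _ := GRing.Zmodule_isLmodule.Build k tensor
  tens_scaleA tens_scale1 tens_scaleDr tens_scaleDl.

Lemma pureDl m m' n : pure (m + m') n = pure m n + pure m' n.
Proof. by rewrite [RHS]tens_add_pi; apply/tens_piP/tens_eq_Dl. Qed.

Lemma pureDr m n n' : pure m (n + n') = pure m n + pure m n'.
Proof. by rewrite [RHS]tens_add_pi; apply/tens_piP/tens_eq_Dr. Qed.

Lemma pureZl c m n : pure (c *: m) n = c *: pure m n.
Proof. by rewrite [RHS]tens_scale_pi. Qed.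

Lemma pureZr c m n : pure m (c *: n) = c *: pure m n.
Proof. by rewrite -pureZl; apply/esym/tens_piP/tens_eq_Z. Qed.

Lemma pure_bal m a n : pure (ra m a) n = pure m (la a n).
Proof.
apply/tens_piP; rewrite -[X in [:: (X, _)]]scale1r -[m in X in tens_eq _ X]scale1r.
exact: tens_eq_bal.
Qed.

Lemma tens_pi_sum l : \pi_tensor l = \sum_(z <- l) pure z.1 z.2.
Proof.
elim: l => [|[m n] l IH]; first by rewrite big_nil.
by rewrite big_cons -IH [RHS]tens_add_pi.
Qed.

Lemma tens_sum (x : tensor) : x = \sum_(z <- repr x) pure z.1 z.2.
Proof. by rewrite -tens_pi_sum reprK. Qed.

(* Sweedler notation: write x = sum_i m_i (x) n_i and form sum_i f m_i n_i,  *)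
(* with the representatives picked by repr.  Whenever f is balanced the      *)
(* result does not depend on them, see tlift_pure and tlift_linear.          *)
Definition tlift (V : nmodType) (x : tensor) (f : M -> N -> V) : V :=
  \sum_(z <- repr x) f z.1 z.2.

Record balanced (V : lmodType k) (f : M -> N -> V) : Prop := Balanced {
  balanced_l : forall n, linear (f^~ n);
  balanced_r : forall m, linear (f m);
  balancedA : forall m a n, f (ra m a) n = f m (la a n)
}.

Lemma tlift_pi (V : lmodType k) (f : M -> N -> V) l :
  balanced f -> tlift (\pi_tensor l) f = \sum_(z <- l) f z.1 z.2.
Proof.
case=> fl fr fA.
have fDl m m' n : f (m + m') n = f m n + f m' n.
  by rewrite -[m in LHS]scale1r [LHS]fl scale1r.
have fDr m n n' : f m (n + n') = f m n + f m n'.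
  by rewrite -[n in LHS]scale1r [LHS]fr scale1r.
have f0l n : f 0 n = 0 by apply: (addrI (f 0 n)); rewrite -fDl !addr0.
have f0r m : f m 0 = 0 by apply: (addrI (f m 0)); rewrite -fDr !addr0.
have fZl c m n : f (c *: m) n = c *: f m n.
  by rewrite -[c *: m]addr0 [LHS]fl f0l addr0.
have fZr c m n : f m (c *: n) = c *: f m n.
  by rewrite -[c *: n]addr0 [LHS]fr f0r addr0.
suff fP l1 l2 : tens_eq l1 l2 ->
    \sum_(z <- l1) f z.1 z.2 = \sum_(z <- l2) f z.1 z.2.
  by apply: fP; apply/tens_piP; rewrite [LHS]reprK.
elim=> {l1 l2} //.
- by move=> ? ? ? _ -> _ ->.
- by move=> ? ? ? ? _ e1 _ e2; rewrite !big_cat /= e1 e2.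
- by move=> ? ?; rewrite !big_cat /= addrC.
- by move=> n; rewrite big_seq1 big_nil f0l.
- by move=> *; rewrite big_seq1 !big_cons big_nil addr0 fDl.
- by move=> *; rewrite big_seq1 !big_cons big_nil addr0 fDr.
- by move=> *; rewrite !big_seq1 fZl fZr.
- by move=> *; rewrite !big_seq1 !fZl fA.
Qed.

Lemma tlift_pure (V : lmodType k) (f : M -> N -> V) m n :
  balanced f -> tlift (pure m n) f = f m n.
Proof. by move=> fb; rewrite /pure tlift_pi // big_seq1. Qed.

Lemma tlift_linear (V : lmodType k) (f : M -> N -> V) :
  balanced f -> linear (fun x => tlift x f).
Proof.
move=> fb c; elim/quotW=> x; elim/quotW=> y.
rewrite [_ *: _]tens_scale_pi [_ + _]tens_add_pi !tlift_pi // big_cat /=.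
congr (_ + _); rewrite big_map scaler_sumr; apply: eq_bigr => -[m n] _ /=.
case: fb => fl _ _.
have f0 : f 0 n = 0.
  by apply: (addrI (f 0 n)); rewrite -[X in X + _]scale1r -[LHS]fl scaler0 !addr0.
by rewrite -[c *: m]addr0 [LHS]fl f0 addr0.
Qed.

End Tensor.

Arguments pure {k A M N ra la} m n : simpl never.
Arguments tlift {k A M N ra la V} x f : simpl never.
Arguments tensor : simpl never.

Reserved Notation "\sw_ ( u , v <- x ) F"
  (at level 41, F at level 41, u, v at level 50,
   format "'[' \sw_ ( u ,  v  <-  x ) '/  '  F ']'").
Notation "\sw_ ( u , v <- x ) F" := (tlift x (fun u v => F)) : ring_scope.

Definition tensk (k : comPzRingType) (M N : lmodType k) : lmodType k :=
  tensor (fun (m : M) (c : k) => c *: m) (fun (c : k) (n : N) => c *: n).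

(* The k-algebra map eta : A (x) A^op -> U; the product of A (x) A^op is     *)
(* (a (x) b) (a' (x) b') = a a' (x) b' b, and it suffices to test            *)
(* multiplicativity on elementary tensors.                                   *)
Record ae_ring (k : comPzRingType) (A U : pzAlgType k) := AeRing {
  eta : {linear tensk A A -> U};
  eta1 : eta (pure (1 : A) (1 : A)) = 1;
  etaM : forall a b a' b' : A,
    eta (pure a b) * eta (pure a' b') = eta (pure (a * a') (b' * b))
}.

Section AeRing.
Variables (k : comPzRingType) (A U : pzAlgType k) (E : ae_ring A U).

Definition src (a : A) : U := eta E (pure a (1 : A)).
Definition tgt (a : A) : U := eta E (pure (1 : A) a).

Lemma src_tgtC a b : src a * tgt b = tgt b * src a.
Proof. by rewrite /src /tgt !etaM !(mul1r, mulr1). Qed.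

Definition UA : actmod k A := ActMod U (fun a u => src a * u).

(* The left A-module U_< (x)_A N, with a (u (x) n) = s(a) u (x) n. *)
Definition Utens (N : actmod k A) : actmod k A :=
  ActMod (tensor (fun (u : U) (a : A) => tgt a * u) (@act k A N))
    (fun a x => \sw_(u, n <- x) pure (src a * u) n).

Definition ox (N : actmod k A) (u : U) (n : N) : Utens N := pure u n.

Lemma act_ox (N : actmod k A) a u (n : N) : act a (ox u n) = ox (src a * u) n.
Proof.
apply: (@tlift_pure _ _ _ _ _ _ _ (fun u n => pure (src a * u) n)); split.
- by move=> m c x y; rewrite mulrDr -pz_scalerAr pureDl pureZl.
- by move=> v c x y; rewrite pureDr pureZr.
- by move=> v b m; rewrite -pure_bal !mulrA src_tgtC.
Qed.

End AeRing.

Arguments ox {k A U E N} u n.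
Notation "u \ox n" := (ox u n) (at level 40, left associativity) : ring_scope.
Notation "u \oxU v" := (ox (N := UA _) u v)
  (at level 40, left associativity) : ring_scope.

Record left_bialgebroid (k : comPzRingType) (A U : pzAlgType k) :=
    LeftBialgebroid {
  bia_ring :> ae_ring A U;
  cop : {linear U -> Utens bia_ring (UA bia_ring)};
  eps : {linear U -> A};
  (* bimodule maps, for a |> u <| b = s(a) t(b) u *)
  cop_bimod : forall (a b : A) (u : U),
    cop (src bia_ring a * tgt bia_ring b * u)
    = \sw_(u1, u2 <- cop u) (src bia_ring a * u1) \oxU (tgt bia_ring b * u2);
  eps_bimod : forall (a b : A) (u : U),
    eps (src bia_ring a * tgt bia_ring b * u) = a * eps u * b;
  (* coassociativity, in U (x)_A (U (x)_A U) *)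
  cop_coassoc : forall u : U,
    \sw_(u1, u2 <- cop u) \sw_(u11, u12 <- cop u1) u11 \ox (u12 \oxU u2)
    = \sw_(u1, u2 <- cop u) u1 \ox cop u2
    :> Utens bia_ring (Utens bia_ring (UA bia_ring));
  cop_counitl : forall u : U,
    \sw_(u1, u2 <- cop u) (src bia_ring (eps u1) * u2) = u;
  cop_counitr : forall u : U,
    \sw_(u1, u2 <- cop u) (tgt bia_ring (eps u2) * u1) = u;
  cop_takeuchi : forall (u : U) (a : A),
    \sw_(u1, u2 <- cop u) (u1 * tgt bia_ring a) \oxU u2
    = \sw_(u1, u2 <- cop u) u1 \oxU (u2 * src bia_ring a)
    :> Utens bia_ring (UA bia_ring);
  cop1 : cop 1 = 1 \oxU 1;
  copM : forall u v : U,
    cop (u * v)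
    = \sw_(u1, u2 <- cop u) \sw_(v1, v2 <- cop v) (u1 * v1) \oxU (u2 * v2);
  eps1 : eps 1 = 1;
  epsM_src : forall u v : U, eps (u * v) = eps (u * src bia_ring (eps v));
  epsM_tgt : forall u v : U, eps (u * v) = eps (u * tgt bia_ring (eps v))
}.

Record left_comodule (k : comPzRingType) (A U : pzAlgType k)
    (B : left_bialgebroid A U) (N : actmod k A) := LeftComodule {
  comod_mod : is_left_module N;
  coact : {linear N -> Utens B N};
  coact_act : forall (a : A) (n : N), coact (act a n) = act a (coact n);
  coact_coassoc : forall n : N,
    \sw_(u, m <- coact n) \sw_(u1, u2 <- cop B u) u1 \ox (u2 \ox m)
    = \sw_(u, m <- coact n) u \ox coact m
    :> Utens B (Utens B N);
  coact_counit : forall n : N, \sw_(u, m <- coact n) act (eps B u) m = n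
}.

(* The induced right A-action n a = eps(n_(-1) t(a)) n_(0). *)
Definition comod_ract (k : comPzRingType) (A U : pzAlgType k)
    (B : left_bialgebroid A U) (N : actmod k A) (D : left_comodule B N)
    (n : N) (a : A) : N :=
  \sw_(u, m <- coact D n) act (eps B (u * tgt B a)) m.

Record yd_module (k : comPzRingType) (A U : pzAlgType k)
    (B : left_bialgebroid A U) (N : lmodType k) := YDModule {
  uact : U -> N -> N;
  uact_mod : is_left_module (ActMod N uact);
  aact : A -> N -> N;
  yd_comod : left_comodule B (ActMod N aact);
  yd_left : forall a n, aact a n = uact (src B a) n;
  yd_right : forall a n, comod_ract yd_comod n a = uact (tgt B a) n;
  yd_compat : forall u n,
    \sw_(u1, u2 <- cop B u) \sw_(w, m <- coact yd_comod (uact u1 n))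
       (w * u2) \ox m
    = \sw_(w, m <- coact yd_comod n) \sw_(u1, u2 <- cop B u)
       (u1 * w) \ox (uact u2 m : ActMod N aact)
    :> Utens B (ActMod N aact)
}.

Definition yd_amod (k : comPzRingType) (A U : pzAlgType k)
    (B : left_bialgebroid A U) (N : lmodType k) (Y : yd_module B N) :
  actmod k A := ActMod N (aact Y).

(* The product of N is the one of the k-algebra N.  The first four axioms    *)
(* say that it is a map of A-bimodules N (x)_A N -> N and that a |-> a 1_N   *)
(* is a map of A-bimodules A -> N, i.e. that N is an A-ring.                 *)
Record yd_algebra (k : comPzRingType) (A U : pzAlgType k)
    (B : left_bialgebroid A U) (N : pzAlgType k) := YDAlgebra {
  yda_mod :> yd_module B N;
  yda_mul_l : forall a (n n' : N),
    uact yda_mod (src B a) (n * n') = uact yda_mod (src B a) n * n';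
  yda_mul_r : forall a (n n' : N),
    uact yda_mod (tgt B a) (n * n') = n * uact yda_mod (tgt B a) n';
  yda_mul_bal : forall a (n n' : N),
    uact yda_mod (tgt B a) n * n' = n * uact yda_mod (src B a) n';
  yda_unit_bimod : forall a,
    uact yda_mod (src B a) 1 = uact yda_mod (tgt B a) 1;
  yda_uactM : forall u (n n' : N),
    uact yda_mod u (n * n')
    = \sw_(u1, u2 <- cop B u) (uact yda_mod u1 n * uact yda_mod u2 n');
  yda_uact1_src : forall u,
    uact yda_mod u 1 = uact yda_mod (src B (eps B u)) 1;
  yda_uact1_tgt : forall u,
    uact yda_mod u 1 = uact yda_mod (tgt B (eps B u)) 1;
  yda_coact1 : coact (yd_comod yda_mod) 1 = 1 \ox ((1 : N) : yd_amod yda_mod);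
  yda_coactM : forall n n' : N,
    coact (yd_comod yda_mod) (n * n')
    = \sw_(u, m <- coact (yd_comod yda_mod) n)
      \sw_(u', m' <- coact (yd_comod yda_mod) n')
        (u * u') \ox ((m : N) * m' : yd_amod yda_mod)
}.

Definition braided_commutative (k : comPzRingType) (A U : pzAlgType k)
    (B : left_bialgebroid A U) (N : pzAlgType k) (Y : yd_algebra B N) : Prop :=
  forall n n' : N,
    n * n' = \sw_(u, m <- coact (yd_comod Y) n) (uact Y u n' * m).

Section IteratedTensor.
Variables (k : comPzRingType) (A U : pzAlgType k) (E : ae_ring A U).
Variable N : actmod k A.

(* U^{(x)_A p} (x)_A N *)
Fixpoint tpow (p : nat) : actmod k A :=
  if p is p'.+1 then Utens E (tpow p') else N.

(* The elementary tensor (u^1, ..., u^p, n), for us = [:: u^1; ...; u^p];    *)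
(* only used with size us = p.                                               *)
Fixpoint etens (p : nat) (us : seq U) (n : N) : tpow p :=
  match p return tpow p with
  | 0 => n
  | p'.+1 => head 0 us \ox etens p' (behead us) n
  end.

Fixpoint mlift (V : nmodType) (p : nat) : tpow p -> (seq U -> N -> V) -> V :=
  match p return tpow p -> (seq U -> N -> V) -> V with
  | 0 => fun n f => f [::] n
  | p'.+1 => fun x f =>
      \sw_(u, y <- x) mlift y (fun us n => f (u :: us) n)
  end.

(* n |-> n_(-p) (x) ... (x) n_(-1) (x) n_(0) for a coaction d on N *)
Fixpoint iter_coact (d : N -> Utens E N) (p : nat) (n : N) : tpow p :=
  match p return tpow p with
  | 0 => n
  | p'.+1 => \sw_(u, m <- d n) u \ox iter_coact d p' m
  end.

Lemma tpow_sum p (x : tpow p) :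
  exists l : seq (p.-tuple U * N), x = \sum_(z <- l) etens p z.1 z.2.
Proof.
elim: p x => [|p IH] x.
  by exists [:: ([tuple], x)]; rewrite big_seq1.
rewrite [x]tens_sum; elim: (repr x) => [|[u y] r [l hl]].
  by exists [::]; rewrite !big_nil.
have [ly ->] := IH y.
exists ([seq (cons_tuple (u : U) z.1, z.2) | z <- ly] ++ l).
rewrite big_cons big_cat /= -hl; congr (_ + _); rewrite big_map /=.
elim: ly => [|z ly IHl]; last by rewrite !big_cons pureDr IHl.
rewrite !big_nil; apply: (addrI (pure u 0 : Utens E (tpow p))).
by rewrite -pureDr !addr0.
Qed.

End IteratedTensor.

Arguments mlift {k A U E N V p} x f.

Reserved Notation "\swn_ ( us , n <- x ) F"
  (at level 41, F at level 41, us, n at level 50,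
   format "'[' \swn_ ( us ,  n  <-  x ) '/  '  F ']'").
Notation "\swn_ ( us , n <- x ) F" := (mlift x (fun us n => F)) : ring_scope.

Section Graded.
Variables (k : comPzRingType) (V : nat -> lmodType k).

(* The degree l component of x in V^n, seen in the direct sum of all V^m. *)
Definition indeg (l n : nat) (x : V n) : V l :=
  match @eqP _ n l with
  | ReflectT e => ecast m (V m) e x
  | ReflectF _ => 0
  end.

(* Equality in the direct sum: the degrees n and m need not be convertible,  *)
(* and zeros of all degrees are identified.                                  *)
Definition heq (n m : nat) (x : V n) (y : V m) : Prop :=
  forall l, indeg l x = indeg l y.

End Graded.

Arguments indeg {k V} l {n} x.
Arguments heq {k V n m} x y.
Notation "x =h y" := (heq x y) (at level 70, no associativity) : ring_scope.

Definition sgi (k : comPzRingType) (z : int) : k := (-1) ^+ `|z|%N.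
Arguments sgi {k} z.

(* the integer |n| = n - 1, equal to -1 for n = 0 *)
Definition shdeg (n : nat) : int := n%:Z - 1.

(* circ p q i phi psi is phi o_i psi; the index i starts at 1.  In degree    *)
(* p = q = 0, where p + q - 1 is truncated, phi o_i psi = 0 by circ_out.     *)
Definition circ_ops (k : comPzRingType) (O : nat -> lmodType k) : Type :=
  forall p q : nat, nat -> O p -> O q -> O (p + q - 1)%N.

Record is_operad (k : comPzRingType) (O : nat -> lmodType k)
    (circ : circ_ops O) (one : O 1%N) : Prop := IsOperad {
  circ_linear_l : forall p q i (psi : O q), (0 < i)%N ->
    linear (fun phi : O p => circ p q i phi psi);
  circ_linear_r : forall p q i (phi : O p), (0 < i)%N ->
    linear (circ p q i phi);
  circ_out : forall p q i (phi : O p) (psi : O q), (0 < i)%N ->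
    ((p < i) || (p == 0))%N -> circ p q i phi psi = 0;
  circ_before : forall p q r i j (phi : O p) (psi : O q) (chi : O r),
    (0 < i)%N -> (0 < j)%N -> (j < i)%N ->
    circ _ _ j (circ _ _ i phi psi) chi
    =h circ _ _ (i + r - 1)%N (circ _ _ j phi chi) psi;
  circ_inside : forall p q r i j (phi : O p) (psi : O q) (chi : O r),
    (0 < i)%N -> (0 < j)%N -> (i <= j < q + i)%N ->
    circ _ _ j (circ _ _ i phi psi) chi
    =h circ _ _ i phi (circ _ _ (j - i + 1)%N psi chi);
  circ_after : forall p q r i j (phi : O p) (psi : O q) (chi : O r),
    (0 < i)%N -> (0 < j)%N -> (q + i <= j)%N ->
    circ _ _ j (circ _ _ i phi psi) chi
    =h circ _ _ i (circ _ _ (j - q + 1)%N phi chi) psi;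
  circ_one_r : forall p i (phi : O p), (0 < i <= p)%N ->
    circ _ _ i phi one =h phi;
  circ_one_l : forall p (phi : O p), circ _ _ 1%N one phi =h phi
}.

Record is_operad_mult (k : comPzRingType) (O : nat -> lmodType k)
    (circ : circ_ops O) (one : O 1%N) (mu : O 2%N) (e : O 0%N) : Prop :=
    IsOperadMult {
  opm_operad : is_operad circ one;
  opm_assoc : circ _ _ 1%N mu mu = circ _ _ 2%N mu mu;
  opm_unit1 : circ _ _ 1%N mu e =h one;
  opm_unit2 : circ _ _ 2%N mu e =h one
}.

Section OperadCalculus.
Variables (k : comPzRingType) (O : nat -> lmodType k) (circ : circ_ops O).
Variable mu : O 2%N.

Definition op_bar (p q : nat) (phi : O p) (psi : O q) : O (p + q - 1)%N :=
  sgi (shdeg p * shdeg q) *: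
    \sum_(1 <= i < p.+1) sgi (shdeg q * shdeg i) *: circ i phi psi.

Definition op_bracket (p q : nat) (phi : O p) (psi : O q) : O (p + q - 1)%N :=
  op_bar phi psi
  - sgi (shdeg p * shdeg q) *: indeg (p + q - 1)%N (op_bar psi phi).

Definition op_cup (p q : nat) (phi : O p) (psi : O q) : O (p + q)%N :=
  indeg (p + q)%N (circ p.+1 (circ 1%N mu phi) psi).

End OperadCalculus.

Section Cohomology.
Variables (k : comPzRingType) (C : nat -> lmodType k).
Variable d : forall n, {linear C n -> C n.+1}.
Arguments d {n}.

(* in degree 0 the only coboundary is 0 *)
Definition coboundary_of (n : nat) : C n -> Prop :=
  match n return C n -> Prop with
  | 0 => fun x => x = 0
  | n'.+1 => fun x => exists y : C n', x = d y
  end.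

Lemma coboundary_of_closed n :
  [/\ coboundary_of (0 : C n),
      forall x y : C n,
        coboundary_of x -> coboundary_of y -> coboundary_of (x + y)
    & forall c (x : C n), coboundary_of x -> coboundary_of (c *: x)].
Proof.
case: n => [|n]; split => //=.
- by move=> x y -> ->; rewrite addr0.
- by move=> c x ->; rewrite scaler0.
- by exists 0; rewrite linear0.
- by move=> x y [u ->] [v ->]; exists (u + v); rewrite linearD.
- by move=> c x [u ->]; exists (c *: u); rewrite linearZZ.
Qed.

Section Degree.
Variable n : nat.

Definition is_cocycle : {pred C n} := [pred x | d x == 0].

Lemma is_cocycle_subsemimod : subsemimod_closed is_cocycle.
Proof.
split; last by move=> c x; rewrite !inE linearZZ => /eqP ->; rewrite scaler0.
split=> [|x y]; rewrite !inE; first by rewrite linear0.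
by rewrite linearD => /eqP -> /eqP ->; rewrite addr0.
Qed.

HB.instance Definition _ :=
  GRing.isSubmodClosed.Build k (C n) is_cocycle is_cocycle_subsemimod.

Record cocycle := Cocycle {
  cocycle_val :> C n;
  cocycleP : cocycle_val \in is_cocycle
}.

HB.instance Definition _ := [isSub for cocycle_val].
HB.instance Definition _ := [Choice of cocycle by <:].
HB.instance Definition _ := [SubChoice_isSubLmodule of cocycle by <:].

Definition is_coboundary : {pred cocycle} :=
  [pred z | `[< coboundary_of (val z) >]].

Lemma is_coboundary_subsemimod : subsemimod_closed is_coboundary.
Proof.
have [b0 bD bZ] := coboundary_of_closed n; split; [split|].
- by rewrite inE; apply/asboolP; rewrite raddf0.
- move=> x y; rewrite !inE => /asboolP hx /asboolP hy; apply/asboolP.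
  by rewrite raddfD; apply: bD.
- move=> c x; rewrite !inE => /asboolP hx; apply/asboolP.
  by rewrite linearZZ; apply: bZ.
Qed.

HB.instance Definition _ :=
  GRing.isSubmodClosed.Build k cocycle is_coboundary is_coboundary_subsemimod.

Definition cohomology := Quotient.quot is_coboundary.

HB.instance Definition _ := GRing.Zmodule.on cohomology.

Definition coh_class (z : cocycle) : cohomology := \pi_cohomology z.

Definition coh_scale (c : k) (h : cohomology) : cohomology :=
  coh_class (c *: repr h).

Lemma coh_scale_class c z : coh_scale c (coh_class z) = coh_class (c *: z).
Proof.
apply/eqP; rewrite -Quotient.idealrBE -scalerBr rpredZ //.
by rewrite Quotient.idealrBE [X in X == _]reprK.
Qed.

Lemma coh_classD : {morph coh_class : x y / x + y}.
Proof. by move=> x y; apply: (raddfD \pi_(Quotient.quot is_coboundary)). Qed.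

Lemma coh_classW (P : cohomology -> Prop) :
  (forall z, P (coh_class z)) -> forall h, P h.
Proof. by move=> Pz; elim/quotW=> z; apply: Pz. Qed.

Lemma coh_scaleA a b h : coh_scale a (coh_scale b h) = coh_scale (a * b) h.
Proof. by elim/coh_classW: h => z; rewrite !coh_scale_class scalerA. Qed.

Lemma coh_scale1 : left_id 1 coh_scale.
Proof. by elim/coh_classW=> z; rewrite coh_scale_class scale1r. Qed.

Lemma coh_scaleDr : right_distributive coh_scale +%R.
Proof.
move=> c; elim/coh_classW=> x; elim/coh_classW=> y.
by rewrite -coh_classD !coh_scale_class scalerDr coh_classD.
Qed.

Lemma coh_scaleDl h : {morph coh_scale^~ h : a b / a + b}.
Proof.
by move=> a b; elim/coh_classW: h => z; rewrite !coh_scale_class scalerDl coh_classD.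
Qed.

HB.instance Definition _ := GRing.Zmodule_isLmodule.Build k cohomology
  coh_scaleA coh_scale1 coh_scaleDr coh_scaleDl.

End Degree.

Definition coh (n : nat) : lmodType k := cohomology n.

Definition represents (n : nat) (x : C n) (h : coh n) : Prop :=
  exists2 z : cocycle n, val z = x & coh_class z = h.

End Cohomology.

(* br p q is the bracket V^p (x) V^q -> V^{p+q-1}; in degrees p = q = 0 its  *)
(* target is V^{-1} = 0, which ger_bracket00 accounts for.                   *)
Record is_gerstenhaber (k : comPzRingType) (V : nat -> lmodType k)
    (cup : forall p q, V p -> V q -> V (p + q)%N) (one : V 0%N)
    (br : forall p q, V p -> V q -> V (p + q - 1)%N) : Prop :=
    IsGerstenhaber {
  ger_cup_linear_l : forall p q (b : V q), linear (fun a : V p => cup _ _ a b);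
  ger_cup_linear_r : forall p q (a : V p), linear (cup p q a);
  ger_cupA : forall p q r (a : V p) (b : V q) (c : V r),
    cup _ _ a (cup _ _ b c) =h cup _ _ (cup _ _ a b) c;
  ger_cup1l : forall p (a : V p), cup _ _ one a =h a;
  ger_cup1r : forall p (a : V p), cup _ _ a one =h a;
  ger_cupC : forall p q (a : V p) (b : V q),
    cup _ _ a b =h sgi (p%:Z * q%:Z) *: cup _ _ b a;
  ger_br_linear_l : forall p q (b : V q), linear (fun a : V p => br _ _ a b);
  ger_br_linear_r : forall p q (a : V p), linear (br p q a);
  ger_br00 : forall a b : V 0%N, br _ _ a b = 0;
  ger_br_anti : forall p q (a : V p) (b : V q),
    br _ _ a b =h - (sgi (shdeg p * shdeg q) *: br _ _ b a);
  ger_jacobi : forall p q r (a : V p) (b : V q) (c : V r) (l : nat),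
    indeg l (br _ _ a (br _ _ b c))
    = indeg l (br _ _ (br _ _ a b) c)
      + sgi (shdeg p * shdeg q) *: indeg l (br _ _ b (br _ _ a c));
  ger_leibniz : forall p q r (c : V p) (a : V q) (b : V r) (l : nat),
    indeg l (br _ _ c (cup _ _ a b))
    = indeg l (cup _ _ (br _ _ c a) b)
      + sgi (shdeg p * q%:Z) *: indeg l (cup _ _ a (br _ _ c b))
}.

Section Cco.
Variables (k : comPzRingType) (A U : pzAlgType k) (B : left_bialgebroid A U).
Variables (N : pzAlgType k) (Y : yd_algebra B N).

Definition Cco (p : nat) : lmodType k := tpow B (yd_amod Y) p.

Definition elem (p : nat) (us : seq U) (n : N) : Cco p :=
  etens B (N := yd_amod Y) p us n.

Definition mulseq (us vs : seq U) : seq U := [seq z.1 * z.2 | z <- zip us vs].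

(* u_(1) (x) ... (x) u_(q) (x) u_(q+1) *)
Definition iter_cop (q : nat) (u : U) : tpow B (UA B) q :=
  iter_coact (N := UA B) (cop B) q u.

(* n_(-r) (x) ... (x) n_(-1) (x) n_(0) *)
Definition iter_co (r : nat) (n : N) : tpow B (yd_amod Y) r :=
  iter_coact (N := yd_amod Y) (coact (yd_comod Y)) r n.

(* ws = [:: u^i_(1); ...; u^i_(q)], w = u^i_(q+1),                           *)
(* xs = [:: (w n')_(-p+i); ...; (w n')_(-1)] and m = (w n')_(0).             *)
(* By tpow_sum, this formula determines bilinear operations for 0 < i <= p.  *)
Definition circ_formula (circ : circ_ops Cco) : Prop :=
  forall (p q i : nat) (us : p.-tuple U) (n : N) (vs : q.-tuple U) (n' : N),
  (0 < i <= p)%N ->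
  circ p q i (elem p us n) (elem q vs n')
  = \swn_(ws, w <- iter_cop q (nth 0 us i.-1))
    \swn_(xs, m <- iter_co (p - i) (uact Y w n'))
      elem (p + q - 1)
        (take i.-1 us ++ mulseq ws vs ++ mulseq xs (drop i us)) ((m : N) * n).

Definition Cco_mu : Cco 2 := elem 2 [:: 1; 1] 1.
Definition Cco_one : Cco 1 := elem 1 [:: 1] 1.
Definition Cco_e : Cco 0 := elem 0 [::] 1.

(* delta_i on (u^1, ..., u^n, m), for 0 <= i <= n + 1 *)
Definition coface (n i : nat) (us : n.-tuple U) (m : N) : Cco n.+1 :=
  if i == 0 then elem n.+1 (1 :: us) m
  else if (i <= n)%N then
    \sw_(u1, u2 <- cop B (nth 0 us i.-1))
      elem n.+1 (take i.-1 us ++ [:: (u1 : U); (u2 : U)] ++ drop i us) m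
  else \sw_(w, m0 <- coact (yd_comod Y) m) elem n.+1 (rcons us (w : U)) m0.

Definition diff_formula (beta : forall n, {linear Cco n -> Cco n.+1}) : Prop :=
  forall (n : nat) (us : n.-tuple U) (m : N),
  beta n (elem n us m) = \sum_(0 <= i < n.+2) (-1) ^+ i *: coface i us m.

End Cco.

(* The operations cup and br on cohomology are induced by the cup product    *)
(* and the bracket of the operad; in particular those of cocycles are        *)
(* cocycles.  The unit is the class of e.                                    *)
Definition induced_by (k : comPzRingType) (O : nat -> lmodType k)
    (circ : circ_ops O) (mu : O 2%N) (e : O 0%N)
    (d : forall n, {linear O n -> O n.+1})
    (cup : forall p q, coh d p -> coh d q -> coh d (p + q)%N) (one : coh d 0)
    (br : forall p q, coh d p -> coh d q -> coh d (p + q - 1)%N) : Prop :=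
  [/\ forall p q (x : O p) (y : O q) (a : coh d p) (b : coh d q),
        represents x a -> represents y b ->
        represents (op_cup circ mu x y) (cup _ _ a b),
      represents e one
    & forall p q (x : O p) (y : O q) (a : coh d p) (b : coh d q),
        represents x a -> represents y b ->
        represents (op_bracket circ x y) (br _ _ a b)].

(* Main.v *)
(* Write T^p for U (x) ... (x) U (x) N, p factors U.  The bialgebroid acts    *)
(* diagonally on T^p, and T^p is a right N-module by multiplication in the    *)
(* last factor.  Since N is braided commutative, the product                  *)
(*   n y = (n_(-1) y) n_(0)      for n in N and y in T^q                      *)
(* satisfies n (n' y) = (n n') y and extends to an associative product        *)
(* T^p x T^q -> T^(p+q) by (u (x) x) y = u (x) (x y), for which T is a        *)
(* U-module algebra by the Yetter-Drinfel'd condition.  The compositions are  *)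
(*   phi o_i psi = [u^1] ... [u^(i-1)] (u^i psi) [u^(i+1)] ... [u^p] n,       *)
(* with [u] = (u, 1), for phi = (u^1, ..., u^p, n), so the operad axioms      *)
(* reduce to associativity and to the compatibility of o_i with the action    *)
(* and the product.                                                           *)
(*                                                                            *)
(* In any operad with multiplication the insertions, suitably signed, satisfy *)
(*   (x o y) o z = x o (y o z) + x{y, z} +- x{z, y}                           *)
(* and similar formulas for (x o y){a, b} and x{a, b} o y, where x{y, z} is   *)
(* the brace.  The first gives the Jacobi identity, hence the differential    *)
(* {mu, -} is a derivation of the bracket; expanding {mu, x o y} and          *)
(* {mu, x{a, b}} exhibits the failure of graded commutativity and of the      *)
(* Leibniz rule as coboundaries on cocycles.                                  *)

From HB Require Import structures.
Require Import Defs.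
From mathcomp Require Import all_boot all_order all_algebra.
From mathcomp Require Import boolp zify ring.

Set Implicit Arguments.
Unset Strict Implicit.
Unset Printing Implicit Defensive.

Import GRing.Theory.
Local Open Scope ring_scope.

(** * Linear maps and Sweedler sums *)

(** The proof has two halves. For the cochains, put [u] = (u, 1); then (u^1, ..., u^p, n) is the
    product [u^1] ... [u^p] n for an associative product on the tensor powers of U with values in N.
    Associativity comes down to (n y) z = n (y z) for n in N ([cup_nmul]). It rests on two facts
    about [nmul]: braided commutativity yields [nmul_rm] and, with multiplicativity of the coaction,
    [nmulM]; the Yetter-Drinfel'd condition yields [ua_nmul], hence [ua_cup], so that U acts on
    products through its coproduct. Since o_i replaces the factor [u^i] by u^i y, it passes through
    products ([ocirc_cup_l], [ocirc_cup_r]) and through the action ([ocirc_ua]). The composition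
    axioms follow ([ocirc_inside], [ocirc_before]), and evaluation on elementary tensors recovers
    the explicit formulas ([ocirc_circ_formula], [op_bracket_coface]).

    The other half, [gerstenhaber_cohomology], holds for every operad with multiplication. Sums over
    insertion positions are sorted by the relative position of the inserted operations
    ([prelie_prelie], [brace2_prelie], [prelie_brace2]). The Jacobi identity then holds for
    cochains, while [dmu_prelie] and [dmu_brace2] supply the homotopies for graded commutativity and
    the Leibniz rule.

    Degrees such as p + q - 1 often agree only up to a provable equality. The relation [=h] absorbs
    this, and [inj] turns it into an equality in one module, where the sign computations take
    place. *)

Section LinearPredicate.
Variables (k : comPzRingType) (M N P : lmodType k).
Implicit Types f g : M -> N.

Lemma linD f : linear f -> {morph f : x y / x + y}.
Proof. by move=> fl x y; rewrite -[x in LHS]scale1r [LHS]fl scale1r. Qed.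

Lemma lin0 f : linear f -> f 0 = 0.
Proof. by move=> /linD fD; apply: (addrI (f 0)); rewrite -fD !addr0. Qed.

Lemma linZ f c x : linear f -> f (c *: x) = c *: f x.
Proof. by move=> fl; rewrite -[c *: x]addr0 [LHS]fl lin0 // addr0. Qed.

Lemma lin_sum f I (r : seq I) (Q : pred I) F :
  linear f -> f (\sum_(i <- r | Q i) F i) = \sum_(i <- r | Q i) f (F i).
Proof.
by move=> fl; apply: (big_morph f (linD fl) (lin0 fl)).
Qed.

Lemma linN f x : linear f -> f (- x) = - f x.
Proof. by move=> fl; rewrite -scaleN1r linZ // scaleN1r. Qed.

Lemma lin_id : linear (id : M -> M).
Proof. by []. Qed.

Lemma lin_comp (g : N -> P) f : linear g -> linear f -> linear (fun x => g
  (f x)).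
Proof. by move=> gl fl c x y; rewrite /= [f _]fl [LHS]gl. Qed.

Lemma lin_cst0 : linear (fun _ : M => 0 : N).
Proof. by move=> c x y; rewrite scaler0 addr0. Qed.

Lemma lin_scale f c : linear f -> linear (fun x => c *: f x).
Proof.
by move=> fl d x y; rewrite /= [f _]fl scalerDr !scalerA mulrC.
Qed.

Lemma lin_sumF I (r : seq I) (Q : pred I) (F : I -> M -> N) :
  (forall i, Q i -> linear (F i)) -> linear
    (fun x => \sum_(i <- r | Q i) F i x).
Proof.
move=> Fl c x y /=; rewrite scaler_sumr -big_split /=.
by apply: eq_bigr => i /Fl ->.
Qed.

End LinearPredicate.

Section Sweedler.
Variables (k : comPzRingType) (A : Type) (M N : lmodType k).
Variables (ra : M -> A -> M) (la : A -> N -> N).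
Local Notation T := (tensor ra la).
Implicit Types (x : T).

Lemma eq_sw (V : nmodType) x (F G : M -> N -> V) :
  (forall u v, F u v = G u v) -> tlift x F = tlift x G.
Proof. by move=> FG; apply: eq_bigr => z _; apply: FG. Qed.

(** Both sides sum over the same representative of [x], so this is additivity over a finite sum. *)
Lemma lin_sw (V W : lmodType k) (f : V -> W) x (F : M -> N -> V) :
  linear f -> f (tlift x F) = tlift x (fun u v => f (F u v)).
Proof. by move=> fl; apply: lin_sum. Qed.

Lemma sw_linear (V W : lmodType k) x (F : W -> M -> N -> V) :
  (forall u v, linear (fun z => F z u v)) -> linear (fun z => tlift x (F z)).
Proof. by move=> Fl; apply: lin_sumF => z _; apply: Fl. Qed.

Lemma sw_linear_arg (V W : lmodType k) (f : W -> T) (F : M -> N -> V) :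
  balanced ra la F -> linear f -> linear (fun z => tlift (f z) F).
Proof. by move=> /tlift_linear Fl fl; apply: (lin_comp Fl fl). Qed.

Lemma sw_pure x : tlift x pure = x.
Proof. by rewrite [RHS]tens_sum. Qed.

Lemma tens_lin_ext (V : lmodType k) (f g : T -> V) :
  linear f -> linear g -> (forall u v, f (pure u v) = g (pure u v)) -> f =1 g.
Proof.
move=> fl gl fg x; rewrite -[x]sw_pure !lin_sw //.
exact: eq_sw.
Qed.

Lemma tens_ind (P : T -> Prop) :
  (forall u v, P (pure u v)) -> (forall x y, P x -> P y -> P (x + y)) ->
  forall x, P x.
Proof.
move=> Pp PD x; rewrite [x]tens_sum; apply: (big_ind P) => //.
rewrite (_ : 0 = pure (0 : M) (0 : N)) //.
by apply: (addrI (pure (0 : M) (0 : N))); rewrite -pureDl !addr0.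
Qed.

Lemma sw_add (V : nmodType) x (F G : M -> N -> V) :
  tlift x (fun u v => F u v + G u v) = tlift x F + tlift x G.
Proof. exact: big_split. Qed.

Lemma pure_balanced : balanced ra la (@pure k A M N ra la).
Proof.
split=> *; first by move=> c x y; rewrite pureDl pureZl.
  by move=> c x y; rewrite pureDr pureZr.
exact: pure_bal.
Qed.

End Sweedler.

(** The left side picks a representative of the whole inner tensor and the right side one for each
    [G u v]; balancedness makes the choice immaterial. *)
Lemma sw_sw (k : comPzRingType) (A A' : Type) (M N M' N' V : lmodType k)
    (ra : M -> A -> M) (la : A -> N -> N) (ra' : M' -> A' -> M')
    (la' : A' -> N' -> N') (x : tensor ra la) (G : M -> N -> tensor ra' la')
    (F : M' -> N' -> V) :
  balanced ra' la' F ->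
  tlift (tlift x G) F = tlift x (fun u v => tlift (G u v) F).
Proof. by move=> Fb; apply: (lin_sw x G (tlift_linear Fb)). Qed.

Lemma sw_exch (k : comPzRingType) (A A' : Type) (M N M' N' : lmodType k)
    (V : nmodType)
    (ra : M -> A -> M) (la : A -> N -> N) (ra' : M' -> A' -> M')
    (la' : A' -> N' -> N') (x : tensor ra la) (y : tensor ra' la')
    (F : M -> N -> M' -> N' -> V) :
  tlift x (fun a b => tlift y (F a b))
  = tlift y (fun c d => tlift x (fun a b => F a b c d)).
Proof. exact: exchange_big. Qed.

(** * Equality across degrees and signs *)

Section GradedTheory.
Variables (k : comPzRingType) (V : nat -> lmodType k).

Lemma indeg_id n (x : V n) : indeg n x = x.
Proof. by rewrite /indeg; case: eqP => // e; rewrite eq_axiomK. Qed.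

Lemma indeg_neq l n (x : V n) : n <> l -> indeg l x = 0.
Proof. by rewrite /indeg; case: eqP. Qed.

Lemma indeg_linear l n : linear (@indeg k V l n).
Proof.
rewrite /indeg; case: eqP => [e|_] c x y; last by rewrite scaler0 addr0.
by case: l / e.
Qed.

Lemma lin_indeg (M : lmodType k) l n (f : M -> V n) :
  linear f -> linear (fun x => indeg l (f x)).
Proof. exact: lin_comp (@indeg_linear l n). Qed.

Lemma indegD l n (x y : V n) : indeg l (x + y) = indeg l x + indeg l y.
Proof. exact: linD (indeg_linear l (n:=n)) _ _. Qed.

Lemma indegZ l n c (x : V n) : indeg l (c *: x) = c *: indeg l x.
Proof. exact: linZ _ _ (indeg_linear l (n:=n)). Qed.

Lemma indeg0 l n : indeg l (0 : V n) = 0.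
Proof. exact: lin0 (indeg_linear l (n:=n)). Qed.

Lemma heq_refl n (x : V n) : x =h x. Proof. by []. Qed.

Lemma heq_sym n m (x : V n) (y : V m) : x =h y -> y =h x.
Proof. by move=> e l; rewrite e. Qed.

Lemma heq_trans n m p (x : V n) (y : V m) (z : V p) :
  x =h y -> y =h z -> x =h z.
Proof. by move=> e1 e2 l; rewrite e1. Qed.

Lemma eq_heq n (x y : V n) : x = y -> x =h y. Proof. by move->. Qed.

Lemma heq_eq n (x y : V n) : x =h y -> x = y.
Proof. by move/(_ n); rewrite !indeg_id. Qed.

Lemma heq0 n m : (0 : V n) =h (0 : V m).
Proof. by move=> l; rewrite !indeg0. Qed.

Lemma heqD n m (x x' : V n) (y y' : V m) :
  x =h y -> x' =h y' -> x + x' =h y + y'.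
Proof. by move=> e e' l; rewrite !indegD e e'. Qed.

Lemma heq_indeg n l (x : V n) : n = l -> indeg l x =h x.
Proof. by move=> e; case: l / e; rewrite indeg_id. Qed.

(** Either the degrees coincide and [=h] is equality, or they differ and both elements vanish. *)
Lemma heq_case n m (x : V n) (y : V m) (P : forall m, V m -> Prop) :
  x =h y -> (x = 0 -> P m 0) -> P n x -> P m y.
Proof.
have [e|ne] := @eqP _ n m.
  by case: m / e y => y /heq_eq <-.
move=> e x0 Px; have y0 : y = 0.
  by move: (e m); rewrite indeg_id (indeg_neq _ ne).
rewrite y0; apply: x0.
by move: (e n); rewrite indeg_id (indeg_neq _ (nesym ne)).
Qed.

End GradedTheory.

(** This is how [=h] is rewritten under an operation whose type depends on the degree; preservation
    of 0 handles unequal degrees. *)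
Lemma heq_fun (k : comPzRingType) (V W : nat -> lmodType k) (g : nat -> nat)
    (F : forall n, V n -> W (g n)) n m (x : V n) (y : V m) :
  (forall n, F n 0 = 0) -> x =h y -> F n x =h F m y.
Proof.
move=> F0 e; apply: (heq_case (P := fun m y => F n x =h F m y) e) => // ->.
by rewrite !F0; apply: heq0.
Qed.

Section Signs.
Variable k : comPzRingType.
Local Notation sgi := (@sgi k).

Lemma sgiD a b : sgi (a + b) = sgi a * sgi b.
Proof.
rewrite /sgi -exprD -[LHS]signr_odd -[RHS]signr_odd; congr (_ ^+ nat_of_bool _).
lia.
Qed.

Lemma sgiN a : sgi (- a) = sgi a.
Proof. by rewrite /sgi abszN. Qed.

Lemma sgi0 : sgi 0 = 1.
Proof. by []. Qed.

Lemma sgi1 : sgi 1 = -1.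
Proof. by []. Qed.

Lemma sgi_sqr a : sgi a * sgi a = 1.
Proof. by rewrite -expr2 /sgi sqrr_sign. Qed.

Lemma sgi_or a : sgi a = 1 \/ sgi a = -1.
Proof.
by rewrite /sgi -signr_odd; case: odd; [right | left].
Qed.
End Signs.

(** * Deciding identities between sums in an abelian group *)

Inductive zexpr := ZVar of nat | ZAdd of zexpr & zexpr | ZOpp of zexpr | ZZero.

Section ZmoduleDecision.
Variable V : zmodType.

Fixpoint zeval (env : seq V) (e : zexpr) : V :=
  match e with
  | ZVar n => env`_n
  | ZAdd e1 e2 => zeval env e1 + zeval env e2
  | ZOpp e => - zeval env e
  | ZZero => 0
  end.

(* The multiplicity of a variable is a pair of naturals, standing for their   *)
(* difference.                                                               *)
Fixpoint zcoef (e : zexpr) (n : nat) : nat * nat :=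
  match e with
  | ZVar m => (nat_of_bool (m == n), 0%N)
  | ZAdd e1 e2 => (((zcoef e1 n).1 + (zcoef e2 n).1)%N,
                   ((zcoef e1 n).2 + (zcoef e2 n).2)%N)
  | ZOpp e => ((zcoef e n).2, (zcoef e n).1)
  | ZZero => (0%N, 0%N)
  end.

Lemma zeval_coef env e :
  zeval env e = \sum_(n < size env)
     (env`_n *+ (zcoef e n).1 - env`_n *+ (zcoef e n).2).
Proof.
elim: e => [m|e1 IH1 e2 IH2|e IH|] /=.
- case: (ltnP m (size env)) => hm.
    rewrite (bigD1 (Ordinal hm)) //= eqxx subr0 big1 ?addr0 // => i.
    by rewrite -val_eqE eq_sym /= => /negPf ->; rewrite subr0.
  rewrite nth_default // big1 // => i _.
  by rewrite gtn_eqF ?subr0 // (leq_trans _ hm).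
- rewrite IH1 IH2 -big_split; apply: eq_bigr => i _ /=.
  by rewrite !mulrnDr opprD addrACA.
- by rewrite IH -sumrN; apply: eq_bigr => i _; rewrite opprB.
- by rewrite big1 // => i _; rewrite subrr.
Qed.

Definition zcheck n (e1 e2 : zexpr) : bool :=
  all (fun i => (zcoef e1 i).1 + (zcoef e2 i).2
                == (zcoef e2 i).1 + (zcoef e1 i).2)%N (iota 0 n).

Lemma zcheckP env e1 e2 :
  zcheck (size env) e1 e2 -> zeval env e1 = zeval env e2.
Proof.
move=> /allP h; rewrite !zeval_coef; apply: eq_bigr => i _.
have /h/eqP e : (i : nat) \in iota 0
  (size env) by rewrite mem_iota add0n ltn_ord.
by apply/eqP; rewrite subr_eq addrAC eq_sym subr_eq -!mulrnDr e.
Qed.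

End ZmoduleDecision.

Ltac zfind x l :=
  lazymatch l with
  | x :: _ => constr:(0%N)
  | _ :: ?l' => let n := zfind x l' in constr:(n.+1)
  end.
Ltac zinsert x l :=
  match l with
  | _ => let _ := zfind x l in constr:(l)
  | _ => let rec app l := lazymatch l with
           | ?y :: ?l' => let r := app l' in constr:(y :: r)
           | _ => constr:([:: x])
           end in app l
  end.
Ltac zvars e l :=
  lazymatch e with
  | ?a + ?b => let l := zvars a l in zvars b l
  | - ?a => zvars a l
  | 0 => constr:(l)
  | _ => zinsert e l
  end.
Ltac zreify e l :=
  lazymatch e with
  | ?a + ?b => let a := zreify a l in let b := zreify b l in constr:(ZAdd a b)
  | - ?a => let a := zreify a l in constr:(ZOpp a)
  | 0 => constr:(ZZero)
  | _ => let n := zfind e l in constr:(ZVar n)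
  end.
(** Signs are either replaced by 1 or -1 beforehand, through [sgi_or], or remain inside the
    atoms. *)
Ltac zmod :=
  rewrite ?(scaleNr, scale1r, scaleN1r, scalerN, scalerDr, scale0r, scaler0);
  lazymatch goal with
  | |- @eq ?T ?a ?b =>
    let l := zvars a (@nil T) in let l := zvars b l in
    let ea := zreify a l in let eb := zreify b l in
    exact: (@zcheckP _ l ea eb (erefl true))
  end.

(** * The product of all degrees *)

Section Total.
Variables (k : comPzRingType) (O : nat -> lmodType k).

(* The product of all degrees, in which [=h] becomes equality. *)
Definition tot : Type := forall n, O n.

HB.instance Definition _ := gen_eqMixin tot.
HB.instance Definition _ := gen_choiceMixin tot.

Implicit Types X Y Z : tot.

Lemma totP X Y : (forall n, X n = Y n) -> X = Y.
Proof. exact: functional_extensionality_dep. Qed.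

Definition tot_add X Y : tot := fun n => X n + Y n.
Definition tot_opp X : tot := fun n => - X n.
Definition tot_scale (c : k) X : tot := fun n => c *: X n.

Lemma tot_addA : associative tot_add.
Proof. by move=> X Y Z; apply: totP => n; apply: addrA. Qed.
Lemma tot_addC : commutative tot_add.
Proof. by move=> X Y; apply: totP => n; apply: addrC. Qed.
Lemma tot_add0 : left_id (fun n => 0) tot_add.
Proof. by move=> X; apply: totP => n; apply: add0r. Qed.
Lemma tot_addN : left_inverse (fun n => 0) tot_opp tot_add.
Proof. by move=> X; apply: totP => n; apply: addNr. Qed.

HB.instance Definition _ :=
  GRing.isZmodule.Build tot tot_addA tot_addC tot_add0 tot_addN.

Lemma tot_scaleA a b X : tot_scale a (tot_scale b X) = tot_scale (a * b) X.
Proof. by apply: totP => n; apply: scalerA. Qed.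
Lemma tot_scale1 : left_id 1 tot_scale.
Proof. by move=> X; apply: totP => n; apply: scale1r. Qed.
Lemma tot_scaleDr : right_distributive tot_scale +%R.
Proof. by move=> c X Y; apply: totP => n; apply: scalerDr. Qed.
Lemma tot_scaleDl X : {morph tot_scale^~ X : a b / a + b}.
Proof. by move=> a b; apply: totP => n; apply: scalerDl. Qed.

HB.instance Definition _ := GRing.Zmodule_isLmodule.Build k tot
  tot_scaleA tot_scale1 tot_scaleDr tot_scaleDl.

Definition inj n (x : O n) : tot := fun l => indeg l x.

Lemma inj_linear n : linear (@inj n).
Proof. by move=> c x y; apply: totP => l; apply: indeg_linear. Qed.

Lemma inj_id n (x : O n) : inj x n = x.
Proof. exact: indeg_id. Qed.

Lemma injP n m (x : O n) (y : O m) : x =h y <-> inj x = inj y.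
Proof.
split=> [e|e l]; first exact: totP.
exact: (congr1 (fun X : tot => X l) e).
Qed.

End Total.

(** Counted from 0, the inputs of a composite at position i form three blocks: inputs of the outer
    operation before i, the q inputs of the inner one, and the later outer inputs, shifted by q -
    1. *)
Lemma split_sum (V : zmodType) (F : nat -> V) p q i : (i < p)%N ->
  \sum_(j < p + q - 1) F j
  = \sum_(j < p | (j < i)%N) F j + \sum_(j < q) F (i + j)%N
    + \sum_(j < p | (i < j)%N) F (j + q - 1)%N.
Proof.
move=> hi.
rewrite -(big_mkord xpredT F) (@big_cat_nat _ _ _ i) //=; last by lia.
rewrite [X in _ + X](@big_cat_nat _ _ _ (i + q)) //=; try lia.
rewrite [LHS]addrA; congr (_ + _ + _).
- by rewrite big_mkord (big_ord_widen p) // ltnW.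
- by rewrite -{1}[i]add0n big_addn addKn big_mkord; apply: eq_bigr => j _;
  rewrite addnC.
rewrite -(big_geq_mkord i.+1 p xpredT (fun j => F (j + q - 1)%N)).
(* For [q = 0] the later inputs move down by one, and truncated subtraction calls for a separate
   reindexing. *)
case: q => [|q].
  rewrite big_add1 addn0 addn0 subn1; apply: eq_bigr => j _.
  by rewrite addn0 subn1.
have -> : (i + q.+1 = i.+1 + q)%N by lia.
rewrite big_addn (_ : (p + q.+1 - 1 - q = p)%N); last by lia.
by apply: eq_bigr => j _; rewrite addnS subn1.
Qed.

Lemma split_sum_cond (V : zmodType) (P : pred nat) (F : nat -> V) p q i :
  (i < p)%N ->
  \sum_(j < p + q - 1 | P j) F j
  = \sum_(j < p | (j < i)%N && P j) F j
    + \sum_(j < q | P (i + j)%N) F (i + j)%N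
    + \sum_(j < p | (i < j)%N && P (j + q - 1)%N) F (j + q - 1)%N.
Proof.
move=> hi; rewrite big_mkcond (split_sum
  (fun j => if P j then F j else 0) q hi).
by congr (_ + _ + _); rewrite -big_mkcondr // -big_mkcond.
Qed.

(** * Cohomology classes and their representatives *)

Section Represent.
Variables (k : comPzRingType) (O : nat -> lmodType k).
Variable d : forall n, {linear O n -> O n.+1}.

Definition represented n (a : coh d n) : exists x : O n, represents x a.
Proof.
elim/coh_classW: a => z; by exists (val z), z.
Qed.

Lemma represents_cocycle n (x : O n)
  (a : coh d n) : represents x a -> d _ x = 0.
Proof. by case=> z <- _; apply/eqP; have := cocycleP z; rewrite inE. Qed.

Lemma coh_class_eq n (z z' : cocycle d n) :
  (coh_class z = coh_class z') <-> coboundary_of d (val z - val z').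
Proof.
rewrite (rwP eqP) -Quotient.idealrBE inE /=.
by split=> [/asboolP|h]; last apply/asboolP; rewrite ?raddfB.
Qed.

Lemma represents_eq n (x y : O n) (a b : coh d n) :
  represents x a -> represents y b -> (a = b <-> coboundary_of d (x - y)).
Proof. by move=> [z <- <-] [z' <- <-]; apply: coh_class_eq. Qed.

Lemma represents_lin n c (x y : O n) (a b : coh d n) :
  represents x a -> represents y b -> represents (c *: x + y) (c *: a + b).
Proof.
move=> [z <- <-] [z' <- <-]; exists (c *: z + z'); first by rewrite linearP.
by rewrite coh_classD -coh_scale_class.
Qed.

Lemma represents0 n : represents (0 : O n) (0 : coh d n).
Proof.
exists 0; first by rewrite raddf0.
by apply: (addrI (coh_class (0 : cocycle d n))); rewrite -coh_classD !addr0.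
Qed.

Lemma representsZ n c (x : O n) (a : coh d n) :
  represents x a -> represents (c *: x) (c *: a).
Proof.
move=> xa; rewrite -[c *: x]addr0 -[c *: a]addr0.
exact: represents_lin xa (represents0 n).
Qed.

Lemma represents_indeg n l (x : O n) (a : coh d n) :
  represents x a -> represents (indeg l x) (indeg l a).
Proof.
have [e|ne] := @eqP _ n l; first by case: l / e; rewrite !indeg_id.
by rewrite (indeg_neq x ne) (indeg_neq a ne) => _; apply: represents0.
Qed.

Lemma represents_heq n m (x : O n) (y : O m) (a : coh d n) (b : coh d m) :
  represents x a -> represents y b ->
  (forall l, coboundary_of d (indeg l x - indeg l y)) -> a =h b.
Proof.
move=> xa yb h l; apply/(represents_eq _ _).2; last exact: h.
  exact: represents_indeg.
exact: represents_indeg.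
Qed.

Section Operation.
Variables (p q n : nat) (f : O p -> O q -> O n).

(** The default 0 of [insubd] is never reached once [f_cocycle] below is assumed. *)
Definition coh_op (a : coh d p) (b : coh d q) : coh d n :=
  coh_class (insubd (0 : cocycle d n) (f (val (repr a)) (val (repr b)))).

Hypothesis f_linear_l : forall y, linear (fun x => f x y).
Hypothesis f_linear_r : forall x, linear (f x).
Hypothesis f_cocycle : forall x y, d _ x = 0 -> d _ y = 0 -> d _ (f x y) = 0.
Hypothesis f_coboundary_l : forall x y,
  coboundary_of d x -> d _ y = 0 -> coboundary_of d (f x y).
Hypothesis f_coboundary_r : forall x y,
  d _ x = 0 -> coboundary_of d y -> coboundary_of d (f x y).

(** Independence of the representatives: f x y - f x' y' = f (x - x') y + f x' (y - y'), a sum of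
    two coboundaries. *)
Lemma represents_op x y a b :
  represents x a -> represents y b -> represents (f x y) (coh_op a b).
Proof.
move=> xa yb; have [dx dy] := (represents_cocycle xa, represents_cocycle yb).
have fc : f x y \in @is_cocycle k O d n by rewrite inE f_cocycle.
exists (Cocycle fc) => //; apply/coh_class_eq; rewrite [val (Cocycle _)]/=.
have xa' : represents (val (repr a)) a by exists (repr a) => //; apply: reprK.
have yb' : represents (val (repr b)) b by exists (repr b) => //; apply: reprK.
move: (val (repr a)) (val (repr b)) xa' yb' => x' y' xa' yb'.
rewrite insubdK; last first.
  rewrite inE; apply/eqP/f_cocycle; first exact: represents_cocycle xa'.
  exact: represents_cocycle yb'.
have -> : f x y - f x' y' = f (x - x') y + f x' (y - y').
  rewrite (linD (f_linear_l y)) (linD (f_linear_r x')).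
  by rewrite (linN _ (f_linear_l y)) (linN _ (f_linear_r x')) addrA subrK.
have [_ bD _] := coboundary_of_closed d n; apply: bD.
  by apply: f_coboundary_l => //; apply/(represents_eq xa xa').
apply: f_coboundary_r; first exact: represents_cocycle xa'.
exact/(represents_eq yb yb').
Qed.

Lemma coh_op_linear_l b : linear (fun a => coh_op a b).
Proof.
move=> c a a'; have [[x xa] [x' xa'] [y yb]] := And3 (represented a)
  (represented a') (represented b).
apply/(represents_eq (represents_op (represents_lin c xa xa') yb)
  (represents_lin c (represents_op xa yb) (represents_op xa' yb))).
by rewrite f_linear_l subrr; have [] := coboundary_of_closed d n.
Qed.

Lemma coh_op_linear_r a : linear (coh_op a).
Proof.
move=> c b b'; have [[x xa] [y yb] [y' yb']] := And3 (represented a)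
  (represented b) (represented b').
apply/(represents_eq (represents_op xa (represents_lin c yb yb'))
  (represents_lin c (represents_op xa yb) (represents_op xa yb'))).
by rewrite f_linear_r subrr; have [] := coboundary_of_closed d n.
Qed.

End Operation.
End Represent.

(** * Braces and the Gerstenhaber structure of an operad with multiplication *)

Section SignedOperad.
Variables (k : comPzRingType) (O : nat -> lmodType k).
Variables (circ : circ_ops O) (one : O 1%N).
Hypothesis HO : is_operad circ one.
Local Notation V := (tot O).
Implicit Types X Y Z W : V.

(* Positions are counted from 0.  With this sign, which is also the one in    *)
(* [op_bar], nested compositions associate without sign and disjoint ones    *)
(* commute up to the Koszul sign of the shifted degrees.                     *)
Definition sgcirc p q i X Y : V :=
  sgi (shdeg q * (p%:Z - i.+1%:Z)) *: inj (circ i.+1 (X p) (Y q)).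

Lemma sgcirc_linear_l p q i Y : linear (fun X => sgcirc p q i X Y).
Proof.
apply: lin_scale; apply: (lin_comp (@inj_linear _ _ _)).
by move=> c X X'; rewrite -(circ_linear_l HO).
Qed.

Lemma sgcirc_linear_r p q i X : linear (sgcirc p q i X).
Proof.
apply: lin_scale; apply: (lin_comp (@inj_linear _ _ _)).
by move=> c Y Y'; rewrite -(circ_linear_r HO).
Qed.

Lemma sgcirc_deg p q i X Y d : d = (p + q - 1)%N ->
  sgcirc p q i X Y d
  = sgi (shdeg q * (p%:Z - i.+1%:Z)) *: indeg d (circ i.+1 (X p) (Y q)).
Proof. by []. Qed.

(** The exponent in [sgcirc] is the shifted degree of the inserted operation times the number of
    inputs to the right of its position. These numbers add up under nesting and |q + r - 1| = |q| +
    |r|, so the two signs agree. *)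
Lemma sgcirc_seq p q r d e i j X Y Z : (i < p)%N -> (j < q)%N ->
  d = (p + q - 1)%N -> e = (q + r - 1)%N ->
  sgcirc d r (i + j) (sgcirc p q i X Y) Z = sgcirc p e i X (sgcirc q r j Y Z).
Proof.
move=> hi hj -> ->; rewrite {1 3}/sgcirc !sgcirc_deg // !indeg_id.
rewrite (linZ _ _ (circ_linear_l HO _ _)) // (linZ _ _
  (circ_linear_r HO _ _)) //.
rewrite !(linZ _ _ (@inj_linear _ _ _)) !scalerA -!sgiD; congr (_ *: _).
  congr (sgi _); rewrite /shdeg.
  have -> : (p + q - 1)%N%:Z = p%:Z + q%:Z - 1 by lia.
  have -> : (q + r - 1)%N%:Z = q%:Z + r%:Z - 1 by lia.
  rewrite !intS PoszD; ring.
apply/injP; apply: heq_trans (circ_inside HO _ _ _ _ _ _) _ => //; first by lia.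
by rewrite (_ : (i + j).+1 - i.+1 + 1 = j.+1)%N //; lia.
Qed.

(** Inserting [Y] at the later position first changes the number of inputs to the right of j by |q|,
    whence the exponent |q||r|. *)
Lemma sgcirc_par p q r d d' i j l X Y Z : (j < i < p)%N ->
  d = (p + q - 1)%N -> d' = (p + r - 1)%N -> l = (i + r - 1)%N ->
  sgcirc d r j (sgcirc p q i X Y) Z
  = sgi (shdeg q * shdeg r) *: sgcirc d' q l (sgcirc p r j X Z) Y.
Proof.
move=> /andP[hj hi] -> -> ->; rewrite {1 3}/sgcirc !sgcirc_deg // !indeg_id.
rewrite !(linZ _ _ (circ_linear_l HO _ _)) //.
rewrite !(linZ _ _ (@inj_linear _ _ _)) !scalerA -!sgiD; congr (_ *: _).
  congr (sgi _); rewrite /shdeg.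
  have -> : (p + q - 1)%N%:Z = p%:Z + q%:Z - 1 by lia.
  have -> : (p + r - 1)%N%:Z = p%:Z + r%:Z - 1 by lia.
  have -> : (i + r - 1).+1%N%:Z = i%:Z + r%:Z by lia.
  rewrite !intS; ring.

apply/injP; apply: heq_trans (circ_before HO _ _ _ _ _ _) _ => //.
by rewrite (_ : i.+1 + r - 1 = (i + r - 1).+1)%N //; lia.
Qed.

(** * The pre-Lie product and the braces *)

Definition prelie p q X Y : V := \sum_(i < p) sgcirc p q i X Y.

(* The braces x{y, z} and x{y, z, w}: insert the arguments in this order at   *)
(* increasing positions of x.                                                *)
Definition brace2 p q r X Y Z : V :=
  \sum_(i < p) \sum_(j < p | (i < j)%N)
    sgcirc (p + q - 1) r (j + q - 1) (sgcirc p q i X Y) Z.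

Definition brace3 p q r t X Y Z W : V :=
  \sum_(i < p) \sum_(j < p | (i < j)%N) \sum_(l < p | (j < l)%N)
    sgcirc (p + q + r - 2) t (l + q + r - 2)
       (sgcirc (p + q - 1) r (j + q - 1) (sgcirc p q i X Y) Z) W.

Lemma prelie_linear_l p q Y : linear (fun X => prelie p q X Y).
Proof. by apply: lin_sumF => i _; apply: sgcirc_linear_l. Qed.

Lemma prelie_linear_r p q X : linear (prelie p q X).
Proof. by apply: lin_sumF => i _; apply: sgcirc_linear_r. Qed.

Lemma brace2_linear_1 p q r Y Z : linear (fun X => brace2 p q r X Y Z).
Proof.
apply: lin_sumF => i _; apply: lin_sumF => j _.
exact: (lin_comp (sgcirc_linear_l _ _ _ Z) (sgcirc_linear_l _ _ _ Y)).
Qed.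

Lemma brace2_linear_2 p q r X Z : linear (fun Y => brace2 p q r X Y Z).
Proof.
apply: lin_sumF => i _; apply: lin_sumF => j _.
exact: (lin_comp (sgcirc_linear_l _ _ _ Z) (sgcirc_linear_r _ _ _ X)).
Qed.

Lemma brace2_linear_3 p q r X Y : linear (brace2 p q r X Y).
Proof. by apply: lin_sumF => i _; apply: lin_sumF => j _;
  apply: sgcirc_linear_r. Qed.

Local Notation s p q := (sgi (shdeg p * shdeg q)).

(** The three terms correspond to [Z] landing inside [Y], on an input of [X] after [Y], or on one
    before [Y]. *)
Lemma prelie_prelie p q r d e X Y Z : d = (p + q - 1)%N -> e = (q + r - 1)%N ->
  prelie d r (prelie p q X Y) Z
  = prelie p e X (prelie q r Y Z) + brace2 p q r X Y Z + s q r *: brace2 p r q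
    X Z Y.
Proof.
move=> -> he; rewrite {1}/prelie.
under eq_bigr => m _ do rewrite (lin_sum _ _ _ (sgcirc_linear_l _ _ _ _)).
rewrite exchange_big /=.
under eq_bigr => i _ do rewrite (split_sum (fun m => sgcirc _ r m
  (sgcirc p q i X Y) Z) q (ltn_ord i)).
rewrite !big_split /= [X in X + _ = _]addrC [LHS]addrAC; congr (_ + _ + _).
  apply: eq_bigr => i _; rewrite (lin_sum _ _ _ (sgcirc_linear_r _ _ _ _)).
  by apply: eq_bigr => j _; rewrite (sgcirc_seq _ _ _ _ _ erefl he).
rewrite (exchange_big_dep xpredT) //= scaler_sumr; apply: eq_bigr => j _.
rewrite scaler_sumr; apply: eq_bigr => i hij.
by rewrite (@sgcirc_par p q r _ (p + r - 1) i j (i + r - 1)) // hij /=.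
Qed.

(** There are five places for [W], in this order: after [Z], inside [Z], inside [Y], between [Y] and
    [Z], before [Y]. Passing [Z] costs the sign of |r||t|, passing [Y] that of |q||t|. *)
Lemma prelie_sgcirc_sgcirc p q r t i j X Y Z W : (i < j)%N -> (j < p)%N ->
  prelie (p + q + r - 2) t (sgcirc (p + q - 1) r (j + q - 1)
    (sgcirc p q i X Y) Z) W
  = \sum_(l < p | (j < l)%N) sgcirc (p + q + r - 2) t (l + q + r - 2)
       (sgcirc (p + q - 1) r (j + q - 1) (sgcirc p q i X Y) Z) W
    + sgcirc (p + q - 1) (r + t - 1) (j + q - 1) (sgcirc p q i X Y)
      (prelie r t Z W)
    + s r t *: (sgcirc (p + (q + t - 1) - 1) r (j + (q + t - 1) - 1)
                  (sgcirc p (q + t - 1) i X (prelie q t Y W)) Z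
       + \sum_(m < p | (i < m < j)%N) sgcirc (p + q + t - 2) r (j + q + t - 2)
           (sgcirc (p + q - 1) t (m + q - 1) (sgcirc p q i X Y) W) Z
       + s q t *: \sum_(m < p | (m < i)%N) sgcirc (p + t + q - 2) r
         (j + t + q - 2)
           (sgcirc (p + t - 1) q (i + t - 1) (sgcirc p t m X W) Y) Z).
Proof.
move=> hij hj; have hi : (i < p)%N by lia.
have eqd : (p + q + r - 2 = p + q - 1 + r - 1)%N by lia.
have hJ : (j + q - 1 < p + q - 1)%N by lia.
rewrite {1}/prelie eqd.
rewrite (split_sum (fun m => sgcirc _ t m _ W) r hJ) /= [X in X + _ = _]addrC
  [LHS]addrC [LHS]addrA.
congr (_ + _ + _).
- rewrite (split_sum_cond (fun m => j + q - 1 < m)%N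
    (fun m => sgcirc (p + q - 1 + r - 1) t (m + r - 1) _ W) q hi).
  rewrite [X in X + _ + _ = _]big_pred0 ?add0r; last by move=> m; lia.
  rewrite [X in X + _ = _]big_pred0 ?add0r; last by move=> m;
    have := ltn_ord m; lia.
  apply: eq_big => [m|m hm]; first by lia.
  congr (sgcirc _ _ _ _ _); lia.
- rewrite (lin_sum _ _ _ (sgcirc_linear_r _ _ _ _)); apply: eq_bigr => m _.
  exact: sgcirc_seq.
transitivity (s r t *: \sum_(m < p + q - 1 | (m < j + q - 1)%N)
  sgcirc (p + q + t - 2) r (j + q + t - 2) (sgcirc (p + q - 1) t m
    (sgcirc p q i X Y) W) Z).
  rewrite scaler_sumr; apply: eq_bigr => m hm.
  by apply: sgcirc_par; lia.
congr (_ *: _).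
rewrite (split_sum_cond (fun m => m < j + q - 1)%N
  (fun m => sgcirc (p + q + t - 2) r (j + q + t - 2) (sgcirc
    (p + q - 1) t m _ W) Z) q hi).
rewrite [X in X + _ = _]addrC [LHS]addrAC; congr (_ + _ + _).
- rewrite (lin_sum _ _ _ (sgcirc_linear_r _ _ _ _)) (lin_sum _ _ _
  (sgcirc_linear_l _ _ _ _)).
  apply: eq_big => [m|m hm]; first by have := ltn_ord m; lia.
  rewrite (@sgcirc_seq _ q t _ (q + t - 1)) //.
  by congr (sgcirc _ _ _ _ _); have := ltn_ord m; lia.
- by apply: eq_bigl => m; lia.
rewrite scaler_sumr; apply: eq_big => [m|m hm]; first by lia.
rewrite (@sgcirc_par _ q t _ (p + t - 1) _ _ (i + t - 1)) //; try lia.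
rewrite (linZ _ _ (sgcirc_linear_l _ _ _ _)); congr (_ *: sgcirc _ _ _ _ _);
  lia.
Qed.

Lemma brace2_prelie p q r t X Y Z W :
  prelie (p + q + r - 2) t (brace2 p q r X Y Z) W
  = brace3 p q r t X Y Z W + brace2 p q (r + t - 1) X Y (prelie r t Z W)
    + s r t *: (brace2 p (q + t - 1) r X
      (prelie q t Y W) Z + brace3 p q t r X Y W Z
                + s q t *: brace3 p t q r X W Y Z).
Proof.
rewrite {1}/brace2 (lin_sum _ _ _ (prelie_linear_l _ _ _)).
transitivity (\sum_(i < p) \sum_(j < p | (i < j)%N)
  prelie (p + q + r - 2) t (sgcirc (p + q - 1) r (j + q - 1)
    (sgcirc p q i X Y) Z) W).
  by apply: eq_bigr => i _; rewrite (lin_sum _ _ _ (prelie_linear_l _ _ _)).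
under eq_bigr => i _ do under eq_bigr => j hij do
  rewrite (prelie_sgcirc_sgcirc _ _ _ _ _ _ _ hij (ltn_ord j)).
under eq_bigr => i _ do rewrite !big_split /= -scaler_sumr !big_split /=
  -scaler_sumr.
rewrite !big_split /= -scaler_sumr !big_split /= -scaler_sumr.
congr (_ + _ + _ *: (_ + _ + _ *: _)).
  apply: eq_bigr => i _; rewrite (exchange_big_dep (fun m : 'I_p =>
    (i < m)%N)) /=; last first.
    by move=> j m _ /andP[].
  apply: eq_bigr => m him; apply: eq_bigl => j; lia.
transitivity (\sum_(i < p) \sum_(m < p | (m < i)%N) \sum_(j < p | (i < j)%N)
  sgcirc (p + t + q - 2) r (j + t + q - 2)
           (sgcirc (p + t - 1) q (i + t - 1) (sgcirc p t m X W) Y) Z).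
  by apply: eq_bigr => i _; apply: exchange_big.
by rewrite (exchange_big_dep xpredT).
Qed.

(** With [Z] to the left of [W], the six terms place the pair relative to [Y]: both after, one on
    each side, both before, [Z] inside and [W] after, [Z] before and [W] inside, both inside. *)
Lemma brace2_sgcirc p q r t i X Y Z W : (i < p)%N ->
  brace2 (p + q - 1) r t (sgcirc p q i X Y) Z W
  = \sum_(j < p | (i < j)%N) \sum_(l < p | (j < l)%N)
      sgcirc (p + q + r - 2) t (l + q + r - 2)
        (sgcirc (p + q - 1) r (j + q - 1) (sgcirc p q i X Y) Z) W
    + s q r *: \sum_(m < p | (m < i)%N) \sum_(l < p | (i < l)%N)
      sgcirc (p + r + q - 2) t (l + r + q - 2)
        (sgcirc (p + r - 1) q (i + r - 1) (sgcirc p r m X Z) Y) W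
    + (s q r * s q t) *: \sum_(m < p | (m < i)%N) \sum_(n < p | (m < n < i)%N)
      sgcirc (p + r + t - 2) q (i + r + t - 2)
        (sgcirc (p + r - 1) t (n + r - 1) (sgcirc p r m X Z) W) Y
    + \sum_(l < p | (i < l)%N) sgcirc (p + (q + r - 1) - 1) t (l +
      (q + r - 1) - 1)
        (sgcirc p (q + r - 1) i X (prelie q r Y Z)) W
    + s q r *: \sum_(m < p | (m < i)%N)
        sgcirc (p + r - 1) (q + t - 1) (i + r - 1) (sgcirc p r m X Z)
          (prelie q t Y W)
    + sgcirc p (q + r + t - 2) i X (brace2 q r t Y Z W).
Proof.
move=> hi; set d := (p + q - 1)%N.
pose G m n := sgcirc (d + r - 1) t (n + r - 1) (sgcirc d r m
  (sgcirc p q i X Y) Z) W.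
rewrite {1}/brace2 (split_sum (fun m => \sum_(n < d | (m < n)%N) G m n) q hi).
have before (m : nat) : (m < i)%N -> \sum_(n < d | (m < n)%N) G m n
  = s q r *: \sum_(l < p | (i < l)%N) sgcirc (p + r + q - 2) t (l + r + q - 2)
        (sgcirc (p + r - 1) q (i + r - 1) (sgcirc p r m X Z) Y) W
  + (s q r * s q t) *: \sum_(n < p | (m < n < i)%N)
      sgcirc (p + r + t - 2) q (i + r + t - 2)
        (sgcirc (p + r - 1) t (n + r - 1) (sgcirc p r m X Z) W) Y
  + s q r *: sgcirc (p + r - 1) (q + t - 1) (i + r - 1) (sgcirc p r m X Z)
    (prelie q t Y W).
  move=> hm.
  have GE n : G m n = s q r *: sgcirc (p + r + q - 2) t (n + r - 1)
      (sgcirc (p + r - 1) q (i + r - 1) (sgcirc p r m X Z) Y) W.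
    rewrite /G (@sgcirc_par p q r _ (p + r - 1) i m (i + r - 1)) ?hm //.
    rewrite (linZ _ _ (sgcirc_linear_l _ _ _ _));
      congr (_ *: sgcirc _ _ _ _ _); lia.
  rewrite (split_sum_cond (fun n => m < n)%N (G m) q hi).
  have e1 : \sum_(n < p | (n < i)%N && (m < n)%N) G m n
      = (s q r * s q t) *: \sum_(n < p | (m < n < i)%N)
        sgcirc (p + r + t - 2) q (i + r + t - 2)
          (sgcirc (p + r - 1) t (n + r - 1) (sgcirc p r m X Z) W) Y.
    rewrite scaler_sumr; apply: eq_big => [n|n /andP[hn hmn]];
      first by rewrite andbC.
    rewrite GE -scalerA; congr (_ *: _); apply: sgcirc_par; lia.
  have e2 : \sum_(n < q | (m < i + n)%N) G m (i + n)%N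
      = s q r *: sgcirc (p + r - 1) (q + t - 1) (i + r - 1) (sgcirc p r m X Z)
        (prelie q t Y W).
    rewrite (lin_sum _ _ _ (sgcirc_linear_r _ _ _ _)) scaler_sumr.
    apply: eq_big => [n|n _]; first by lia.
    rewrite GE (_ : i + n + r - 1 = i + r - 1 + n)%N; last by lia.
    by rewrite (@sgcirc_seq (p + r - 1) q t _ (q + t - 1)) //; lia.
  have e3 : \sum_(l < p | (i < l)%N && (m < l + q - 1)%N) G m (l + q - 1)%N
      = s q r *: \sum_(l < p | (i < l)%N) sgcirc (p + r + q - 2) t
        (l + r + q - 2)
        (sgcirc (p + r - 1) q (i + r - 1) (sgcirc p r m X Z) Y) W.
    rewrite scaler_sumr; apply: eq_big => [l|l hl]; first by lia.
    rewrite GE; congr (_ *: sgcirc _ _ _ _ _); lia.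
  rewrite e1 e2 e3; zmod.
have inside (m : nat) : (m < q)%N -> \sum_(n < d | (i + m < n)%N) G (i + m)%N n
  = sgcirc p (q + r + t - 2) i X
      (\sum_(n < q | (m < n)%N) sgcirc (q + r - 1) t (n + r - 1)
        (sgcirc q r m Y Z) W)
  + \sum_(l < p | (i < l)%N) sgcirc (p + (q + r - 1) - 1) t (l +
    (q + r - 1) - 1)
        (sgcirc p (q + r - 1) i X (sgcirc q r m Y Z)) W.
  move=> hm.
  have GE n : G (i + m)%N n
      = sgcirc (d + r - 1) t (n + r - 1) (sgcirc p (q + r - 1) i X
        (sgcirc q r m Y Z)) W.
    by rewrite /G (@sgcirc_seq p q r _ (q + r - 1)).
  rewrite (split_sum_cond (fun n => i + m < n)%N (G (i + m)%N) q hi).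
  rewrite [X in X + _ + _ = _]big_pred0 ?add0r; last by move=> n; lia.
  congr (_ + _).
    rewrite (lin_sum _ _ _ (sgcirc_linear_r _ _ _ _)).
    apply: eq_big => [n|n hn]; first by lia.
    rewrite GE (_ : i + n + r - 1 = i + (n + r - 1))%N; last by lia.
    by apply: sgcirc_seq; have := ltn_ord n; rewrite ?/d; lia.
  apply: eq_big => [l|l hl]; first by lia.
  rewrite GE; congr (sgcirc _ _ _ _ _); lia.
have after (m : nat) : (i < m)%N -> \sum_(n < d | (m + q - 1 < n)%N) G
  (m + q - 1)%N n
  = \sum_(l < p | (m < l)%N) sgcirc (p + q + r - 2) t (l + q + r - 2)
        (sgcirc (p + q - 1) r (m + q - 1) (sgcirc p q i X Y) Z) W.
  move=> hm.
  rewrite (split_sum_cond (fun n => m + q - 1 < n)%N (G (m + q - 1)%N) q hi).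
  rewrite [X in X + _ + _ = _]big_pred0 ?add0r; last by move=> n; lia.
  rewrite [X in X + _ = _]big_pred0 ?add0r; last by move=> n;
    have := ltn_ord n; lia.
  apply: eq_big => [l|l hl]; first by lia.
  by rewrite /G; congr (sgcirc _ _ _ _ _); lia.
under [X in X + _ + _ = _]eq_bigr => m hm do rewrite (before m hm).
under [X in _ + X + _ = _]eq_bigr => m _ do rewrite (inside m (ltn_ord m)).
under [X in _ + X = _]eq_bigr => m hm do rewrite (after m hm).
rewrite !big_split /= -!(scaler_sumr (s q r)) -!(scaler_sumr (s q r * s q t)).
have e' : \sum_(m < q) sgcirc p (q + r + t - 2) i X
      (\sum_(n < q | (m < n)%N) sgcirc (q + r - 1) t (n + r - 1)
        (sgcirc q r m Y Z) W)
  = sgcirc p (q + r + t - 2) i X (brace2 q r t Y Z W).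
  by rewrite [RHS](lin_sum _ _ _ (sgcirc_linear_r _ _ _ _)).
have e : \sum_(m < q) \sum_(l < p | (i < l)%N)
    sgcirc (p + (q + r - 1) - 1) t (l + (q + r - 1) - 1)
      (sgcirc p (q + r - 1) i X (sgcirc q r m Y Z)) W
  = \sum_(l < p | (i < l)%N) sgcirc (p + (q + r - 1) - 1) t (l +
    (q + r - 1) - 1)
      (sgcirc p (q + r - 1) i X (prelie q r Y Z)) W.
  rewrite exchange_big; apply: eq_bigr => l hl.
  rewrite (lin_sum _ _ _ (sgcirc_linear_r _ _ _ _)).
  by rewrite (lin_sum _ _ _ (sgcirc_linear_l _ _ _ _)).
have perm (a b c f g h : V) : a + b + c +
  (f + g) + h = h + a + b + g + c + f by zmod.
rewrite e e'; exact: perm.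
Qed.

Lemma prelie_brace2 p q r t X Y Z W :
  brace2 (p + q - 1) r t (prelie p q X Y) Z W
  = brace3 p q r t X Y Z W + s q r *: brace3 p r q t X Z Y W
    + (s q r * s q t) *: brace3 p r t q X Z W Y
    + brace2 p (q + r - 1) t X (prelie q r Y Z) W
    + s q r *: brace2 p r (q + t - 1) X Z (prelie q t Y W)
    + prelie p (q + r + t - 2) X (brace2 q r t Y Z W).
Proof.
rewrite {1}/prelie (lin_sum _ _ _ (brace2_linear_1 _ _ _ _ _)).
under eq_bigr => i _ do rewrite (brace2_sgcirc _ _ _ _ _ _ _ (ltn_ord i)).
rewrite !big_split /= -!(scaler_sumr (s q r)) -!(scaler_sumr (s q r * s q t)).
congr (_ + _ *: _ + _ *: _ + _ + _ *: _ + _).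
- by rewrite (exchange_big_dep xpredT).
- rewrite (exchange_big_dep xpredT) //=; apply: eq_bigr => m _.
  rewrite (exchange_big_dep (fun n : 'I_p => (m < n)%N)) /=;
    last by move=> i n _ /andP[].
  apply: eq_bigr => n hn; apply: eq_bigl => i; lia.
- by rewrite (exchange_big_dep xpredT).
Qed.

(** * The Lie bracket *)

Lemma lin_subZ (W W' : lmodType k) (f : W -> W') c x y :
  linear f -> f (x - c *: y) = f x - c *: f y.
Proof. by move=> fl; rewrite (linD fl) (linN _ fl) (linZ _ _ fl). Qed.

Definition lie p q X Y : V := prelie p q X Y - s p q *: prelie q p Y X.

(** The equation |p + q - 1| = |p| + |q| fails only for p = q = 0, where subtraction truncates;
    there the hypothesis makes both sides vanish. *)
Lemma sgi_shdegD p q r X : (((p == 0) && (q == 0))%N -> X = 0) ->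
  sgi (shdeg (p + q - 1) * shdeg r) *: X = (s p r * s q r) *: X.
Proof.
move=> X0; have [/X0 ->|h] := boolP ((p == 0) && (q == 0))%N;
  first by rewrite !scaler0.
rewrite -sgiD -mulrDl (_ : shdeg (p + q - 1) = shdeg p + shdeg q) //.
by rewrite /shdeg; lia.
Qed.

Lemma prelie0 q X Y : prelie 0 q X Y = 0.
Proof. exact: big_ord0. Qed.

Lemma sC p q : s p q = s q p :> k.
Proof. by rewrite mulrC. Qed.

Lemma lie_linear_l p q Y : linear (fun X => lie p q X Y).
Proof.
move=> c X X'; rewrite /lie prelie_linear_l prelie_linear_r.
by rewrite !(scalerDr, scalerN, scalerA, opprD) addrACA [s p q * c]mulrC.
Qed.

Lemma lie_linear_r p q X : linear (lie p q X).
Proof.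
move=> c Y Y'; rewrite /lie prelie_linear_l prelie_linear_r.
by rewrite !(scalerDr, scalerN, scalerA, opprD) addrACA [s p q * c]mulrC.
Qed.

Lemma lie_anti p q X Y : lie p q X Y = - (s p q *: lie q p Y X).
Proof.
rewrite /lie (sC q p); case: (sgi_or k (shdeg p * shdeg q)) => ->; zmod.
Qed.

Lemma lie00 X Y : lie 0 0 X Y = 0.
Proof. by rewrite /lie !prelie0 scaler0 subr0. Qed.

Lemma lie_lier p q r X Y Z :
  lie p (q + r - 1) X (lie q r Y Z)
  = prelie p (q + r - 1) X (lie q r Y Z)
    - (s q p * s r p) *: prelie (q + r - 1) p (lie q r Y Z) X.
Proof.
congr (_ - _); rewrite sC; apply: sgi_shdegD => /andP[/eqP -> /eqP ->].
by rewrite lie00 (lin0 (prelie_linear_l _ _ _)).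
Qed.

Lemma lie_liel p q r X Y Z :
  lie (p + q - 1) r (lie p q X Y) Z
  = prelie (p + q - 1) r (lie p q X Y) Z
    - (s p r * s q r) *: prelie r (p + q - 1) Z (lie p q X Y).
Proof.
congr (_ - _); apply: sgi_shdegD => /andP[/eqP -> /eqP ->].
by rewrite lie00 (lin0 (prelie_linear_r _ _ _)).
Qed.

(** By [prelie_prelie] the associator of [prelie] is symmetric in its last two arguments up to the
    Koszul sign, so its graded commutator is a Lie bracket. After expansion only the eight values of
    three signs remain. *)
Lemma jacobi p q r X Y Z :
  lie p (q + r - 1) X (lie q r Y Z)
  = lie (p + q - 1) r (lie p q X Y) Z
    + s p q *: lie q (p + r - 1) Y (lie p r X Z).
Proof.
rewrite !lie_lier lie_liel /lie.
rewrite !(lin_subZ _ _ _ (prelie_linear_l _ _ _)) !(lin_subZ _ _ _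
  (prelie_linear_r _ _ _)).
rewrite (@prelie_prelie p q r _ (q + r - 1) X Y Z) // (@prelie_prelie q p r _
  (p + r - 1) Y X Z);
  try lia.
rewrite (@prelie_prelie p r q _ (q + r - 1) X Z Y) ?(@prelie_prelie r p q _
  (p + q - 1) Z X Y);
  try lia.
rewrite (@prelie_prelie q r p _ (p + r - 1) Y Z X) ?(@prelie_prelie r q p _
  (p + q - 1) Z Y X);
  try lia.
rewrite (sC q p) (sC r p) (sC r q) -!scalerA.
case: (sgi_or k (shdeg p * shdeg q)) => ->;
case: (sgi_or k (shdeg p * shdeg r)) => ->;
case: (sgi_or k (shdeg q * shdeg r)) => ->; zmod.
Qed.

(** * The differential of a multiplication and its homotopies *)

Section Multiplication.
Variables (mu : O 2%N) (e : O 0%N).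
Hypothesis Hmu : is_operad_mult circ one mu e.
Let M : V := inj mu.
Local Notation sg p := (sgi (shdeg p)).

Lemma s2 p : s 2 p = sg p :> k.
Proof. by rewrite mul1r. Qed.

(** Associativity of [mu] as a Maurer-Cartan equation: the two summands carry opposite signs. *)
Lemma prelie_MM : prelie 2 2 M M = 0.
Proof.
rewrite /prelie big_ord_recl big_ord1 /sgcirc /= /M !inj_id /shdeg subrr mulr0
  sgi0 scale1r.
rewrite (opm_assoc Hmu) (_ : _ * _ = 1) // sgi1 scaleN1r; exact: addNr.
Qed.

Lemma brace3_2 q r t X Y Z W : brace3 2 q r t X Y Z W = 0.
Proof.
apply: big1 => i _; apply: big1 => j hij; apply: big1 => l hjl.
by have := ltn_ord l; lia.
Qed.

Definition dmu p X : V := lie 2 p M X.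

Lemma dmu_linear p : linear (dmu p).
Proof. exact: lie_linear_r. Qed.

Lemma dmuE p X : dmu p X = prelie 2 p M X - sg p *: prelie p 2 X M.
Proof. by rewrite /dmu /lie s2. Qed.

(** The Jacobi identity would only give twice this equation. Expanding with [prelie_prelie] in all
    three orders of [M], [M], [X] gives it over every ring [k]. *)
Lemma dmu_dmu p X : dmu p.+1 (dmu p X) = 0.
Proof.
have := @prelie_prelie 2 2 p 3 p.+1 M M X erefl erefl.
rewrite prelie_MM (lin0 (prelie_linear_l _ _ _)) s2 => /esym/eqP.
rewrite -addrA addr_eq0 => /eqP e1.
have hp : p.+1 = (p + 2 - 1)%N by lia.
rewrite !dmuE !(lin_subZ _ _ _ (prelie_linear_l _ _ _)) !(lin_subZ _ _ _
  (prelie_linear_r _ _ _)).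
rewrite e1 (@prelie_prelie 2 p 2 _ p.+1 M X M) //
  (@prelie_prelie p 2 2 _ 3 X M M) //.
rewrite prelie_MM (lin0 (prelie_linear_r _ _ _)) (sC p 2) !s2 sgi1.
rewrite (_ : sg p.+1 = - sg p); last first.
  by rewrite -mulrN1 -[-1]/(sgi 1) -sgiD; congr (sgi _); rewrite /shdeg; lia.
case: (sgi_or k (shdeg p)) => ->; rewrite ?opprK; zmod.
Qed.

Lemma sgS p : sg p.+1 = - sg p :> k.
Proof.
by rewrite -mulrN1 -[-1]/(sgi 1) -sgiD; congr (sgi _); rewrite /shdeg; lia.
Qed.

Lemma sgD p q : sg (p + q) = - (sg p * sg q) :> k.
Proof.
rewrite -mulrN1 -[-1]/(sgi 1) -!sgiD; congr (sgi _); rewrite /shdeg; lia.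
Qed.

Lemma sDr p q r : s p (q + r) = sg p * s p q * s p r :> k.
Proof.
by rewrite -!sgiD -[X in X + _ + _]mulr1 -!mulrDr; congr (sgi (_ * _));
  rewrite /shdeg; lia.
Qed.

Lemma brace2_small p q r X Y Z : (p < 2)%N -> brace2 p q r X Y Z = 0.
Proof.
move=> hp; apply: big1 => i _; apply: big1 => j hij.
by have := ltn_ord j; lia.
Qed.

(* On cocycles this is the homotopy behind the commutativity of the cup       *)
(* product, because mu{x, y} is the cup product up to sign.                  *)
Lemma dmu_prelie p q X Y :
  dmu (p + q - 1) (prelie p q X Y)
  = prelie p.+1 q (dmu p X) Y + sg p *: prelie p q.+1 X (dmu q Y)
    - brace2 2 p q M X Y - s p q *: brace2 2 q p M Y X.
Proof.
have -> : dmu (p + q - 1) (prelie p q X Y) = prelie 2 (p + q - 1) M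
  (prelie p q X Y)
   - (sg p * sg q) *: prelie (p + q - 1) 2 (prelie p q X Y) M.
  rewrite /dmu /lie sC -(s2 p) -(s2 q) (sC 2 p) (sC 2 q); congr (_ - _).
  by apply: sgi_shdegD => /andP[/eqP -> _];
    rewrite prelie0 (lin0 (prelie_linear_l _ _ _)).
rewrite !dmuE !(lin_subZ _ _ _ (prelie_linear_l _ _ _)) !(lin_subZ _ _ _
  (prelie_linear_r _ _ _)).
have hp : p.+1 = (p + 2 - 1)%N by lia.
have hq : q.+1 = (q + 2 - 1)%N by lia.
rewrite (@prelie_prelie 2 p q _ (p + q - 1) M X Y) //
  (@prelie_prelie p 2 q _ q.+1 X M Y) //.
rewrite (@prelie_prelie p q 2 _ q.+1 X Y M) // -scalerA s2 (sC q) s2.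
case: (sgi_or k (shdeg p)) => ->; case: (sgi_or k (shdeg q)) => ->;
case: (sgi_or k (shdeg p * shdeg q)) => ->; zmod.
Qed.

Lemma brace2_prelie_mu q r t X Y Z :
  prelie (q + r) t (brace2 2 q r M X Y) Z
  = brace2 2 q (r + t - 1) M X (prelie r t Y Z)
    + s r t *: brace2 2 (q + t - 1) r M (prelie q t X Z) Y.
Proof.
have := brace2_prelie 2 q r t M X Y Z; rewrite !brace3_2 scaler0 !addr0 add0r.
by rewrite (_ : 2 + q + r - 2 = q + r)%N //; lia.
Qed.

Lemma prelie_mu_brace2 p q r X Y Z :
  brace2 p.+1 q r (prelie 2 p M X) Y Z
  = brace2 2 (p + q - 1) r M (prelie p q X Y) Z
    + s p q *: brace2 2 q (p + r - 1) M Y (prelie p r X Z)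
    + prelie 2 (p + q + r - 2) M (brace2 p q r X Y Z).
Proof.
by have := prelie_brace2 2 p q r M X Y Z; rewrite !brace3_2 !scaler0 !add0r.
Qed.

(* On cocycles this is the homotopy behind the Leibniz rule. *)
Lemma dmu_brace2 p q r X Y Z :
  dmu (p + q + r - 2) (brace2 p q r X Y Z)
  = brace2 p.+1 q r (dmu p X) Y Z + sg p *: brace2 p q.+1 r X (dmu q Y) Z
    + (sg p * sg q) *: brace2 p q r.+1 X Y (dmu r Z)
    - brace2 2 (p + q - 1) r M (prelie p q X Y) Z
    - s p q *: brace2 2 q (p + r - 1) M Y (prelie p r X Z)
    + sg p *: prelie p (q + r) X (brace2 2 q r M Y Z).
Proof.
have -> : dmu (p + q + r - 2) (brace2 p q r X Y Z)
  = prelie 2 (p + q + r - 2) M (brace2 p q r X Y Z)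
    - (sg p * sg q * sg r) *: prelie (p + q + r - 2) 2 (brace2 p q r X Y Z) M.
  rewrite dmuE; congr (_ - _); case: (ltnP p 2) => hp.
    by rewrite brace2_small // (lin0 (prelie_linear_l _ _ _)) !scaler0.
  by congr (_ *: _); rewrite -!sgiD; congr (sgi _); rewrite /shdeg; lia.
rewrite !dmuE !(lin_subZ _ _ _ (brace2_linear_1 _ _ _ _ _)).
rewrite !(lin_subZ _ _ _ (brace2_linear_2 _ _ _ _ _)) !(lin_subZ _ _ _
  (brace2_linear_3 _ _ _ _ _)).
rewrite prelie_mu_brace2 brace2_prelie.
have := prelie_brace2 p 2 q r X M Y Z.
rewrite (_ : p + 2 - 1 = p.+1)%N; last by lia.
rewrite (_ : 2 + q + r - 2 = q + r)%N; last by lia.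
rewrite (_ : 2 + q - 1 = q.+1)%N // (_ : 2 + r - 1 = r.+1)%N // => ->.
rewrite (_ : q + 2 - 1 = q.+1)%N; last by lia.
rewrite (_ : r + 2 - 1 = r.+1)%N; last by lia.
rewrite -!scalerA !(sC _ 2) !s2.
case: (sgi_or k (shdeg p)) => ->; case: (sgi_or k (shdeg q)) => ->;
case: (sgi_or k (shdeg r)) => ->; case: (sgi_or k (shdeg p * shdeg q)) => ->;
  zmod.
Qed.

(** Inserting [X] and [Y] into [prelie 2 2 M M], which is 0, expresses the product of [M] with M{X,
    Y} through M{MX, Y} and M{X, MY}. *)
Lemma dmu_cup q r X Y :
  dmu (q + r) (brace2 2 q r M X Y)
  = - brace2 2 q.+1 r M (dmu q X) Y - sg q *: brace2 2 q r.+1 M X (dmu r Y).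
Proof.
have := prelie_mu_brace2 2 q r M X Y.
rewrite prelie_MM (lin0 (brace2_linear_1 _ _ _ _ _)) s2.
rewrite (_ : 2 + q + r - 2 = q + r)%N; last by lia.
move/esym/eqP; rewrite addrC addr_eq0 => /eqP e1.
rewrite !dmuE e1 brace2_prelie_mu.
rewrite !(lin_subZ _ _ _ (brace2_linear_2 _ _ _ _ _)) !(lin_subZ _ _ _
  (brace2_linear_3 _ _ _ _ _)).
rewrite (_ : q + 2 - 1 = q.+1)%N; last by lia.
rewrite (_ : r + 2 - 1 = r.+1)%N; last by lia.
rewrite (_ : 2 + q - 1 = q.+1)%N // (_ : 2 + r - 1 = r.+1)%N // sgD
  (sC r) s2 scaleNr -scalerA.
case: (sgi_or k (shdeg q)) => ->; case: (sgi_or k (shdeg r)) => ->;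
rewrite ?mulN1r ?mul1r ?opprK; zmod.
Qed.

Lemma dmu_lie q r X Y :
  dmu (q + r - 1) (lie q r X Y)
  = lie q.+1 r (dmu q X) Y + sg q *: lie q r.+1 X (dmu r Y).
Proof. by rewrite /dmu jacobi s2. Qed.

(** Inserting [X] into the cup product of [Y] and [Z] is a derivation on the nose
    ([brace2_prelie_mu]); inserting the cup product into [X] is one up to the differential of the
    brace X{Y, Z} ([dmu_brace2]). *)
Lemma leibniz p q r X Y Z : dmu p X = 0 -> dmu q Y = 0 -> dmu r Z = 0 ->
  lie p (q + r) X (brace2 2 q r M Y Z)
  = sg p *: (brace2 2 (p + q - 1) r M (lie p q X Y) Z
             + s p q *: brace2 2 q (p + r - 1) M Y (lie p r X Z)
             + dmu (p + q + r - 2) (brace2 p q r X Y Z)).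
Proof.
move=> dX dY dZ; rewrite dmu_brace2 dX dY dZ (lin0 (brace2_linear_1 _ _ _ _ _)).
rewrite (lin0 (brace2_linear_2 _ _ _ _ _)) (lin0 (brace2_linear_3 _ _ _ _ _)).
rewrite /lie brace2_prelie_mu sDr (sC r p) (addnC q p) (addnC r p).
rewrite !(lin_subZ _ _ _ (brace2_linear_2 _ _ _ _ _)) !(lin_subZ _ _ _
  (brace2_linear_3 _ _ _ _ _)).
rewrite -!scalerA !scaler0 !add0r.
case: (sgi_or k (shdeg p)) => ->; case: (sgi_or k (shdeg p * shdeg q)) => ->;
case: (sgi_or k (shdeg p * shdeg r)) => ->; zmod.
Qed.

(** With i counted from 1, |p||q| + |q||i| is congruent to |q|(p - i) modulo 2, the exponent in
    [sgcirc]. *)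
Lemma inj_bar p q X Y : inj (op_bar circ (X p) (Y q)) = prelie p q X Y.
Proof.
rewrite /op_bar (linZ _ _ (@inj_linear _ _ _)) (lin_sum _ _ _
  (@inj_linear _ _ _)).
rewrite big_add1 big_mkord scaler_sumr; apply: eq_bigr => i _.
rewrite (linZ _ _ (@inj_linear _ _ _)) scalerA; congr (_ *: _).
rewrite -[RHS]mulr1 -(sgi_sqr k (shdeg q * shdeg i.+1)) mulrA -!sgiD.
congr (sgi _); rewrite /shdeg !intS; ring.
Qed.

Lemma inj_lie p q X Y : inj (op_bracket circ (X p) (Y q)) = lie p q X Y.
Proof.
rewrite /op_bracket (linD (@inj_linear _ _ _)) (linN _ (@inj_linear _ _ _)).
rewrite (inj_bar p q X Y) (linZ _ _ (@inj_linear _ _ _)); congr (_ - _ *: _).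
rewrite -(inj_bar q p Y X); apply/injP/heq_indeg; lia.
Qed.

Lemma op_bracketE p q (x : O p) (y : O q) :
  inj (op_bracket circ x y) = lie p q (inj x) (inj y).
Proof. by rewrite -inj_lie !inj_id. Qed.

(** A binary operation has a single pair of increasing positions; the sign comes from the first
    input, the second contributing none. *)
Lemma op_cupE p q (x : O p) (y : O q) :
  inj (op_cup circ mu x y) = sg p *: brace2 2 p q M (inj x) (inj y).
Proof.
rewrite /brace2 big_ord_recl big_ord1 big_mkcond /= big_ord_recl big_ord1 /=.
rewrite [X in _ + X]big_mkcond /= big_ord_recl big_ord1 /= !addr0 add0r.
rewrite {1}/sgcirc (@sgcirc_deg 2 p 0 M (inj x) (2 + p - 1)%N erefl) !inj_id.
rewrite (linZ _ _ (circ_linear_l HO _ _)) // (linZ _ _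
  (@inj_linear _ _ _)) !scalerA.
rewrite indeg_id [M 2%N]inj_id (_ : bump 0 0 + p - 1 = p)%N;
  last by rewrite /bump /=; lia.
rewrite /op_cup -[LHS]scale1r; congr (_ *: _).
  rewrite -!sgiD (_ : _ + _ + _ = shdeg p + shdeg p).
    by rewrite sgiD sgi_sqr.
  rewrite /shdeg; have -> : (2 + p - 1)%N%:Z = p%:Z + 1 by lia.
  rewrite !intS; ring.
apply/injP; apply: heq_indeg; lia.
Qed.

(** * Descent to cohomology *)

Section Cohomology.
Variable d : forall n, {linear O n -> O n.+1}.
Hypothesis Hd : forall n (x : O n), op_bracket circ mu x =h d n x.

Lemma dE n (x : O n) : inj (d n x) = dmu n (inj x).
Proof. by rewrite /dmu -op_bracketE; apply/injP/heq_sym/Hd. Qed.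

Lemma dmu_proj n X : dmu n X = inj (d n (X n)).
Proof. by rewrite dE /dmu -!inj_lie inj_id. Qed.

Lemma inj_inj n (x y : O n) : inj x = inj y -> x = y.
Proof. by move/injP/heq_eq. Qed.

Lemma inj0 n : inj (0 : O n) = 0.
Proof. exact: lin0 (@inj_linear _ _ _). Qed.

Lemma d_d n (x : O n) : d n.+1 (d n x) = 0.
Proof. by apply: inj_inj; rewrite !dE dmu_dmu inj0. Qed.

Lemma dmu_cocycle n (x : O n) : d n x = 0 -> dmu n (inj x) = 0.
Proof. by rewrite -dE => ->; apply: inj0. Qed.

Lemma cocycle_dmu n (x : O n) : dmu n (inj x) = 0 -> d n x = 0.
Proof. by rewrite -dE => e'; apply: inj_inj; rewrite e' inj0. Qed.

Lemma coboundary_dmu n l X : coboundary_of d (dmu n X l).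
Proof.
rewrite dmu_proj /inj; have [e'|ne] := @eqP _ n.+1 l.
  by case: l / e'; rewrite indeg_id; exists (X n).
rewrite (indeg_neq _ ne); by have [] := coboundary_of_closed d l.
Qed.

Lemma coboundary0 n : coboundary_of d (0 : O n).
Proof. by have [] := coboundary_of_closed d n. Qed.

Lemma coboundary_of_dmu n m (x : O n) W : inj x = dmu m W -> coboundary_of d x.
Proof. by move=> e'; rewrite -[x]inj_id e'; apply: coboundary_dmu. Qed.

Lemma op_cup_linear_l p q (y : O q) : linear
  (fun x : O p => op_cup circ mu x y).
Proof.
move=> c x x'; apply: inj_inj;
  rewrite inj_linear !op_cupE inj_linear brace2_linear_2.
by rewrite scalerDr !scalerA mulrC.
Qed.

Lemma op_cup_linear_r p q (x : O p) : linear
  (fun y : O q => op_cup circ mu x y).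
Proof.
move=> c y y'; apply: inj_inj;
  rewrite inj_linear !op_cupE inj_linear brace2_linear_3.
by rewrite scalerDr !scalerA mulrC.
Qed.

Lemma op_bracket_linear_l p q (y : O q) : linear
  (fun x : O p => op_bracket circ x y).
Proof.
move=> c x x'; apply: inj_inj.
by rewrite op_bracketE inj_linear lie_linear_l [RHS]inj_linear !op_bracketE.
Qed.

Lemma op_bracket_linear_r p q (x : O p) : linear
  (fun y : O q => op_bracket circ x y).
Proof.
move=> c y y'; apply: inj_inj.
by rewrite op_bracketE inj_linear lie_linear_r [RHS]inj_linear !op_bracketE.
Qed.

Lemma dmu_op_cup p q (x : O p) (y : O q) :
  dmu (p + q) (inj (op_cup circ mu x y))
  = inj (op_cup circ mu (d p x) y) + (-1) ^+ p *: inj (op_cup circ mu x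
    (d q y)).
Proof.
rewrite !op_cupE !dE (linZ _ _ (dmu_linear _)) dmu_cup sgS.
have -> : (-1) ^+ p = - sg p :> k.
  rewrite /shdeg sgiD sgiN sgi1 mulrN1 opprK //.
by case: (sgi_or k (shdeg p)) => ->; rewrite ?opprK; zmod.
Qed.

Lemma op_cup_cocycle p q (x : O p) (y : O q) :
  d _ x = 0 -> d _ y = 0 -> d _ (op_cup circ mu x y) = 0.
Proof.
move=> dx dy; apply: cocycle_dmu; rewrite dmu_op_cup dx dy.
by rewrite (lin0 (op_cup_linear_l y)) (lin0
  (op_cup_linear_r x)) !inj0 scaler0 addr0.
Qed.

Lemma op_cup_coboundary_l p q (x : O p) (y : O q) :
  coboundary_of d x -> d _ y = 0 -> coboundary_of d (op_cup circ mu x y).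
Proof.
case: p x => [|p] x; [move=> x0 dy | case=> z -> dy].
  by rewrite (x0 : x = 0) (lin0 (op_cup_linear_l y)); apply: coboundary0.
apply: (@coboundary_of_dmu _ (p + q) _ (inj (op_cup circ mu z y))).
by rewrite dmu_op_cup dy (lin0 (op_cup_linear_r _)) inj0 scaler0 addr0.
Qed.

Lemma op_cup_coboundary_r p q (x : O p) (y : O q) :
  d _ x = 0 -> coboundary_of d y -> coboundary_of d (op_cup circ mu x y).
Proof.
case: q y => [|q] y dx; [move=> y0 | case=> z ->].
  by rewrite (y0 : y = 0) (lin0 (op_cup_linear_r x)); apply: coboundary0.
apply: (@coboundary_of_dmu _ (p + q) _ ((-1) ^+ p *: inj (op_cup circ mu x z))).
rewrite (linZ _ _ (dmu_linear _)) dmu_op_cup dx (lin0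
  (op_cup_linear_l _)) inj0 add0r.
by rewrite scalerA -expr2 sqrr_sign scale1r.
Qed.

Lemma dmu_op_bracket p q (x : O p) (y : O q) :
  dmu (p + q - 1) (inj (op_bracket circ x y))
  = inj (op_bracket circ (d p x) y) + sg p *: inj (op_bracket circ x (d q y)).
Proof. by rewrite !op_bracketE !dE dmu_lie. Qed.

Lemma op_bracket_cocycle p q (x : O p) (y : O q) :
  d _ x = 0 -> d _ y = 0 -> d _ (op_bracket circ x y) = 0.
Proof.
move=> dx dy; apply: cocycle_dmu; rewrite dmu_op_bracket dx dy.
by rewrite (lin0 (op_bracket_linear_l y)) (lin0
  (op_bracket_linear_r x)) !inj0 scaler0 addr0.
Qed.

Lemma op_bracket_coboundary_l p q (x : O p) (y : O q) :
  coboundary_of d x -> d _ y = 0 -> coboundary_of d (op_bracket circ x y).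
Proof.
case: p x => [|p] x; [move=> x0 dy | case=> z -> dy].
  by rewrite (x0 : x = 0) (lin0 (op_bracket_linear_l y)); apply: coboundary0.
apply: (@coboundary_of_dmu _ (p + q - 1) _ (inj (op_bracket circ z y))).
by rewrite dmu_op_bracket dy (lin0 (op_bracket_linear_r _)) inj0 scaler0 addr0.
Qed.

Lemma op_bracket_coboundary_r p q (x : O p) (y : O q) :
  d _ x = 0 -> coboundary_of d y -> coboundary_of d (op_bracket circ x y).
Proof.
case: q y => [|q] y dx; [move=> y0 | case=> z ->].
  by rewrite (y0 : y = 0) (lin0 (op_bracket_linear_r x)); apply: coboundary0.
apply: (@coboundary_of_dmu _ (p + q - 1) _ (sg p *: inj (op_bracket circ x z))).
rewrite (linZ _ _ (dmu_linear _)) dmu_op_bracket dx (lin0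
  (op_bracket_linear_l _)) inj0 add0r.
by rewrite scalerA sgi_sqr scale1r.
Qed.

Lemma circ_heq p p' q q' i (x : O p) (x' : O p') (y : O q) (y' : O q') :
  x =h x' -> y =h y' -> circ i.+1 x y =h circ i.+1 x' y'.
Proof.
move=> ex ey; apply: (heq_trans (y := circ i.+1 x' y)).
  apply: (heq_fun (F := fun p (x : O p) => circ i.+1 x y)) ex => n.
  exact: lin0 (circ_linear_l HO y (ltn0Sn i)).
apply: (heq_fun (F := fun q (y : O q) => circ i.+1 x' y)) ey => n.
exact: lin0 (circ_linear_r HO x' (ltn0Sn i)).
Qed.

Lemma circ_seq p q r i j (x : O p) (y : O q) (z : O r) : (j < q)%N ->
  circ (i + j).+1 (circ i.+1 x y) z =h circ i.+1 x (circ j.+1 y z).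
Proof.
move=> hj; apply: heq_trans (circ_inside HO _ _ _ _ _ _) _ => //; first by lia.
by rewrite (_ : (i + j).+1 - i.+1 + 1 = j.+1)%N //; lia.
Qed.

Lemma circ_cup p q (x : O p) (y : O q) :
  op_cup circ mu x y =h circ p.+1 (circ 1 mu x) y.
Proof. apply: heq_indeg; lia. Qed.

Lemma circ_mu_mu p q (x : O p) (y : O q) :
  circ p.+1 (circ 1 mu x) y =h circ 1 (circ 2 mu y) x.
Proof.
apply: heq_trans (circ_after HO _ _ _ _ _ _) _ => //; first by lia.
by rewrite (_ : p.+1 - p + 1 = 2)%N //; lia.
Qed.

(** No signs enter the cup product, so the unsigned operad axioms are used directly rather than
    [op_cupE]. *)
Lemma op_cupA p q r (x : O p) (y : O q) (z : O r) :
  op_cup circ mu x (op_cup circ mu y z) =h op_cup circ mu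
    (op_cup circ mu x y) z.
Proof.
apply: heq_trans (circ_cup _ _) _; apply: heq_trans (heq_sym (circ_cup _ _)).
apply: heq_trans (circ_heq _ (heq_refl _) (circ_cup y z)) _.
apply: heq_trans (heq_sym (circ_seq _ _ _ _ _)) _; first by lia.
apply: circ_heq; last exact: heq_refl.
apply: heq_trans (heq_sym (circ_heq _ (heq_refl mu) (circ_cup x y))).
apply: heq_trans (heq_sym (circ_seq p _ mu y (ltn0Sn 1))) _; rewrite addn0.
apply: heq_trans (circ_heq _ (circ_mu_mu x mu) (heq_refl y)) _.
rewrite -(opm_assoc Hmu).
apply: heq_trans (circ_seq 0 mu (circ 1 mu x) y _); last by lia.
exact: circ_heq (circ_seq 0 mu mu x (ltn0Sn 1)) (heq_refl y).
Qed.

Lemma op_cup1l p (x : O p) : op_cup circ mu e x =h x.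
Proof.
apply: heq_trans (circ_cup _ _) _.
apply: heq_trans (circ_heq _ (opm_unit1 Hmu) (heq_refl x)) _.
exact: circ_one_l HO _ x.
Qed.

Lemma op_cup1r p (x : O p) : op_cup circ mu x e =h x.
Proof.
apply: heq_trans (circ_cup _ _) _; apply: heq_trans (circ_mu_mu _ _) _.
apply: heq_trans (circ_heq _ (opm_unit2 Hmu) (heq_refl x)) _.
exact: circ_one_l HO _ x.
Qed.

Lemma unit_cocycle : d _ e = 0.
Proof.
apply: cocycle_dmu; rewrite dmuE prelie0 scaler0 subr0 /prelie big_ord_recl
  big_ord1.
rewrite /sgcirc /M !inj_id /bump /= (_ : shdeg 0 * (2%:Z - 2%:Z) = 0) //.
rewrite (_ : shdeg 0 * (2%:Z - 1%:Z) = -1) // sgiN sgi0 sgi1 scale1r scaleN1r.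
have /injP -> := opm_unit1 Hmu; have /injP -> := opm_unit2 Hmu.
exact: addNr.
Qed.

(** This is [dmu_prelie] solved for the cup product: up to sign, [op_bar] is the homotopy between
    the two orders. *)
Lemma op_cupC p q (x : O p) (y : O q) : d _ x = 0 -> d _ y = 0 ->
  inj (op_cup circ mu x y)
  = sgi (p%:Z * q%:Z) *: inj (op_cup circ mu y x)
    + dmu (p + q - 1) (- sg p *: inj (op_bar circ x y)).
Proof.
move=> dx dy; rewrite (linZ _ _ (dmu_linear _)).
rewrite -[X in op_bar circ X]inj_id -[X in op_bar circ _ X]inj_id inj_bar
  dmu_prelie.
rewrite !dmu_cocycle // (lin0 (prelie_linear_l _ _ _)) (lin0
  (prelie_linear_r _ _ _)).
rewrite !op_cupE.
have -> : sgi (p%:Z * q%:Z) = - (s p q * sg p * sg q) :> k.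
  by rewrite -!sgiD -mulN1r -[-1]/(sgi 1) -sgiD; congr (sgi _);
    rewrite /shdeg; ring.
case: (sgi_or k (shdeg p)) => ->; case: (sgi_or k (shdeg q)) => ->;
case: (sgi_or k (shdeg p * shdeg q)) => ->;
rewrite ?(mulN1r, mul1r, opprK) ?scalerA ?(mulN1r, mul1r, opprK); zmod.
Qed.

Lemma op_leibniz p q r (x : O p) (y : O q) (z : O r) :
  d _ x = 0 -> d _ y = 0 -> d _ z = 0 ->
  inj (op_bracket circ x (op_cup circ mu y z))
  = inj (op_cup circ mu (op_bracket circ x y) z)
    + sgi (shdeg p * q%:Z) *: inj (op_cup circ mu y (op_bracket circ x z))
    + dmu (p + q + r - 2) ((sg q * sg p) *: brace2 p q r (inj x) (inj y)
      (inj z)).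
Proof.
move=> dx dy dz; rewrite (linZ _ _ (dmu_linear _)) op_bracketE op_cupE.
rewrite (linZ _ _ (lie_linear_r _ _ _)) leibniz ?dmu_cocycle //.
rewrite !op_cupE !op_bracketE.
have -> : sg (p + q - 1) *: brace2 2 (p + q - 1) r M (lie p q (inj x) (inj y))
  (inj z)
    = (sg p * sg q) *: brace2 2 (p + q - 1) r M (lie p q (inj x) (inj y))
      (inj z).
  rewrite -(s2 (p + q - 1)) -(s2 p) -(s2 q) !(sC 2); apply: sgi_shdegD.
  move=> /andP[/eqP p0 /eqP q0]; move: x y dx dy; rewrite p0 q0 => x y _ _.
  by rewrite lie00 (lin0 (brace2_linear_2 _ _ _ _ _)).
have -> : sgi (shdeg p * q%:Z) = sg p * s p q :> k.
  by rewrite -sgiD; congr (sgi _); rewrite /shdeg; ring.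
rewrite -!scalerA.
case: (sgi_or k (shdeg p)) => ->; case: (sgi_or k (shdeg q)) => ->;
case: (sgi_or k (shdeg p * shdeg q)) => ->; zmod.
Qed.

Lemma gerstenhaber_cohomology :
  exists (cup : forall p q, coh d p -> coh d q -> coh d (p + q)%N)
         (u : coh d 0%N)
         (br : forall p q, coh d p -> coh d q -> coh d (p + q - 1)%N),
    induced_by circ mu e cup u br /\ is_gerstenhaber cup u br.
Proof.
pose cup p q := coh_op (d := d) (fun (x : O p) (y : O q) => op_cup circ mu x y).
pose br p q := coh_op (d := d) (fun (x : O p) (y : O q) => op_bracket circ x y).
have cupR p q (x : O p) (y : O q) (a : coh d p) (b : coh d q) :
    represents x a -> represents y b -> represents (op_cup circ mu x y)
      (cup _ _ a b).
  apply: (represents_op (f := fun x y => op_cup circ mu x y)).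
  - exact: op_cup_linear_l.
  - exact: op_cup_linear_r.
  - exact: op_cup_cocycle.
  - exact: op_cup_coboundary_l.
  - exact: op_cup_coboundary_r.
have brR p q (x : O p) (y : O q) (a : coh d p) (b : coh d q) :
    represents x a -> represents y b -> represents (op_bracket circ x y)
      (br _ _ a b).
  apply: (represents_op (f := fun x y => op_bracket circ x y)).
  - exact: op_bracket_linear_l.
  - exact: op_bracket_linear_r.
  - exact: op_bracket_cocycle.
  - exact: op_bracket_coboundary_l.
  - exact: op_bracket_coboundary_r.
have ec : e \in @is_cocycle k O d 0 by rewrite inE unit_cocycle.
have uR : represents (d := d) e (coh_class (Cocycle ec)) by exists (Cocycle ec).
move: (coh_class (Cocycle ec)) uR => u uR.
(* Identities of representatives pass to classes: [heqI] allows an error term [dmu l W], [heqH] is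
   the case without error, and [heqS] treats a sum of two terms. *)
have heqI n m (x : O n) (y : O m) (a : coh d n) (b : coh d m) l W :
    represents x a -> represents y b -> inj x = inj y + dmu l W -> a =h b.
  move=> xa yb e'; apply: (represents_heq xa yb) => l'.
  have /(congr1 (fun X : V => X l')) e2 : inj x - inj y = dmu l W by rewrite e'
    [inj y + _]addrC addrK.
  by rewrite [indeg _ _ - _]e2; apply: coboundary_dmu.
have heqH n m (x : O n) (y : O m) (a : coh d n) (b : coh d m) :
    represents x a -> represents y b -> x =h y -> a =h b.
  move=> xa yb /injP e'; apply: (heqI _ _ _ _ _ _ 0%N 0 xa yb).
  by rewrite e' (lin0 (dmu_linear _)) addr0.
have heqS n m m' (x : O n) (y : O m) (z : O m') (a : coh d n) (b : coh d m)
    (c : coh d m') v l W t : represents x a -> represents y b -> represents z c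
      ->
    inj x = inj y + v *: inj z + dmu l W ->
    indeg t a = indeg t b + v *: indeg t c.
  move=> xa yb zc e'; rewrite addrC.
  apply/(represents_eq (represents_indeg t xa)
    (represents_lin v (represents_indeg t zc) (represents_indeg t yb))).
  have /(congr1 (fun X : V => X t)) e2 :
      inj x - (v *: inj z + inj y) = dmu l W by rewrite e' [_ + inj y]addrC [_
        + dmu _ _]addrC addrK.
  by rewrite [indeg _ _ - _]e2; apply: coboundary_dmu.
exists cup, u, br; split; first by split.
split.
- move=> p q b; apply: coh_op_linear_l.
  + exact: op_cup_linear_l.
  + exact: op_cup_linear_r.
  + exact: op_cup_cocycle.
  + exact: op_cup_coboundary_l.
  + exact: op_cup_coboundary_r.
- move=> p q b; apply: coh_op_linear_r.
  + exact: op_cup_linear_l.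
  + exact: op_cup_linear_r.
  + exact: op_cup_cocycle.
  + exact: op_cup_coboundary_l.
  + exact: op_cup_coboundary_r.
- move=> p q r a b c; have [x xa] := represented a.
  have [y yb] := represented b; have [z zc] := represented c.
  exact: (heqH _ _ _ _ _ _ (cupR _ _ _ _ _ _ xa (cupR _ _ _ _ _ _ yb zc))
    (cupR _ _ _ _ _ _ (cupR _ _ _ _ _ _ xa yb) zc) (op_cupA x y z)).
- move=> p a; have [x xa] := represented a.
  exact: (heqH _ _ _ _ _ _ (cupR _ _ _ _ _ _ uR xa) xa (op_cup1l x)).
- move=> p a; have [x xa] := represented a.
  exact: (heqH _ _ _ _ _ _ (cupR _ _ _ _ _ _ xa uR) xa (op_cup1r x)).
- move=> p q a b; have [x xa] := represented a; have [y yb] := represented b.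
  have yx := representsZ (sgi (p%:Z * q%:Z)) (cupR _ _ _ _ _ _ yb xa).
  have e' := op_cupC (represents_cocycle xa) (represents_cocycle yb).
  apply: (heqI _ _ _ _ _ _ _ _ (cupR _ _ _ _ _ _ xa yb) yx).
  by rewrite (linZ _ _ (@inj_linear _ _ _)); apply: e'.
- move=> p q b; apply: coh_op_linear_l.
  + exact: op_bracket_linear_l.
  + exact: op_bracket_linear_r.
  + exact: op_bracket_cocycle.
  + exact: op_bracket_coboundary_l.
  + exact: op_bracket_coboundary_r.
- move=> p q b; apply: coh_op_linear_r.
  + exact: op_bracket_linear_l.
  + exact: op_bracket_linear_r.
  + exact: op_bracket_cocycle.
  + exact: op_bracket_coboundary_l.
  + exact: op_bracket_coboundary_r.
- move=> a b; have [x xa] := represented a; have [y yb] := represented b.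
  apply/(represents_eq (brR _ _ _ _ _ _ xa yb) (represents0 d _)).
  by apply: (@coboundary_of_dmu _ 0 _ 0);
    rewrite subr0 op_bracketE lie00 (lin0 (dmu_linear _)).
- move=> p q a b; have [x xa] := represented a; have [y yb] := represented b.
  have yx := representsZ (- sgi (shdeg p * shdeg q)) (brR _ _ _ _ _ _ yb xa).
  rewrite -scaleNr; apply: (heqH _ _ _ _ _ _ (brR _ _ _ _ _ _ xa yb) yx).
  by apply/injP; rewrite (linZ _ _
    (@inj_linear _ _ _)) !op_bracketE lie_anti scaleNr.
- move=> p q r a b c t; have [x xa] := represented a.
  have [y yb] := represented b; have [z zc] := represented c.
  apply: (heqS _ _ _ _ _ _ _ _ _ _ 0%N 0 t (brR _ _ _ _ _ _ xa
    (brR _ _ _ _ _ _ yb zc))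
    (brR _ _ _ _ _ _ (brR _ _ _ _ _ _ xa yb) zc)
    (brR _ _ _ _ _ _ yb (brR _ _ _ _ _ _ xa zc))).
  by rewrite !op_bracketE jacobi (lin0 (dmu_linear _)) addr0.
- move=> p q r c a b t; have [x xa] := represented c.
  have [y yb] := represented a; have [z zc] := represented b.
  apply: (heqS _ _ _ _ _ _ _ _ _ _ _ _ t (brR _ _ _ _ _ _ xa
    (cupR _ _ _ _ _ _ yb zc))
    (cupR _ _ _ _ _ _ (brR _ _ _ _ _ _ xa yb) zc)
    (cupR _ _ _ _ _ _ yb (brR _ _ _ _ _ _ xa zc))).
  by apply: op_leibniz; [exact: represents_cocycle xa | exact:
    represents_cocycle yb
    | exact: represents_cocycle zc].
Qed.

End Cohomology.
End Multiplication.
End SignedOperad.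

(** * Diagonal actions on iterated tensor products *)

Section Bialgebroid.
Variables (k : comPzRingType) (A U : pzAlgType k) (B : left_bialgebroid A U).
Local Notation s := (src B).
Local Notation t := (tgt B).

Lemma mul_linear_l (v : U) : linear (fun u : U => u * v).
Proof. by move=> c x y; rewrite mulrDl -pz_scalerAl. Qed.

Lemma mul_linear_r (u : U) : linear (fun v : U => u * v).
Proof. by move=> c x y; rewrite mulrDr -pz_scalerAr. Qed.

Lemma src1 : s 1 = 1. Proof. exact: eta1. Qed.
Lemma tgt1 : t 1 = 1. Proof. exact: eta1. Qed.

Lemma cop_src a : cop B (s a) = s a \oxU 1.
Proof.
have := cop_bimod B a 1 1; rewrite tgt1 !mulr1 => ->; rewrite cop1.
rewrite [LHS]tlift_pure ?mulr1 ?mul1r //; split=> *.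
- by move=> c x y; rewrite mul1r mulrDr -pz_scalerAr [LHS]pureDl pureZl.
- by move=> c x y; rewrite !mul1r [LHS]pureDr pureZr.
- by rewrite !mul1r /= -[RHS]pure_bal !mulrA src_tgtC.
Qed.

Lemma cop_tgt a : cop B (t a) = 1 \oxU t a.
Proof.
have := cop_bimod B 1 a 1; rewrite src1 mul1r !mulr1 => ->; rewrite cop1.
rewrite [LHS]tlift_pure ?mulr1 ?mul1r //; split=> *.
- by move=> c x y; rewrite !mul1r [LHS]pureDl pureZl.
- by move=> c x y; rewrite !mul1r mulrDr -pz_scalerAr [LHS]pureDr pureZr.
- by rewrite /= !mul1r mulrA -src_tgtC -mulrA; exact: pure_bal.
Qed.

Section Utens.
Variables (M : actmod k A).

Lemma ox_balanced : balanced (fun u a => t a * u) act (@ox k A U B M).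
Proof. exact: pure_balanced. Qed.

Lemma ox_linear_l (m : M) : linear (fun u => u \ox m : Utens B M).
Proof. exact: balanced_l ox_balanced m. Qed.

Lemma ox_linear_r (u : U) : linear (fun m : M => u \ox m : Utens B M).
Proof. exact: balanced_r ox_balanced u. Qed.

Lemma ox_bal (u : U) a (m : M) : (t a * u) \ox m = u \ox (act a m) :> Utens B M.
Proof. exact: pure_bal. Qed.

Lemma sw_oxE (V : lmodType k) (F : U -> M -> V) u m :
  balanced (fun u a => t a * u) act F ->
  tlift (u \ox m : Utens B M) F = F u m.
Proof. exact: tlift_pure. Qed.

Lemma Utens_act_linear a : linear (act a : Utens B M -> Utens B M).
Proof.
apply: sw_linear_arg; last exact: lin_id.
split=> *.
- by apply: (lin_comp (ox_linear_l _)); apply: mul_linear_r.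
- exact: ox_linear_r.
- by rewrite -[RHS]pure_bal !mulrA src_tgtC.
Qed.

Lemma Utens_ind (P : Utens B M -> Prop) :
  (forall u m, P (u \ox m)) -> (forall x y, P x -> P y -> P (x + y)) ->
  forall x, P x.
Proof. exact: tens_ind. Qed.

Lemma Utens_ext (V : lmodType k) (f g : Utens B M -> V) :
  linear f -> linear g -> (forall u m, f (u \ox m) = g (u \ox m)) -> f =1 g.
Proof. exact: tens_lin_ext. Qed.

Lemma sw_ox (x : Utens B M) : tlift x (@ox k A U B M) = x.
Proof. exact: sw_pure. Qed.
End Utens.

(* The conditions under which F factors through a threefold tensor product. *)
Record tribalanced (M : actmod k A) (V : lmodType k) (F : U -> U -> M -> V) :
    Prop := Tribalanced {
  tribalanced_r : forall u, balanced (fun u a => t a * u) act (F u);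
  tribalanced_l : forall v m, linear (fun u => F u v m);
  tribalancedA : forall a u v m, F (t a * u) v m = F u (s a * v) m
}.

(** Coassociativity inside an arbitrary expression [F], for the coproduct and for coactions alike:
    the identity of threefold tensors is pushed through the map [G], which evaluates [F] on the
    inner tensor. *)
Lemma sw_coassoc (M : actmod k A) (V : lmodType k) (x : Utens B M)
    (d : M -> Utens B M) (F : U -> U -> M -> V) :
  \sw_(u, m <- x) \sw_(u1, u2 <- cop B u) u1 \ox (u2 \ox m)
    = \sw_(u, m <- x) u \ox d m :> Utens B (Utens B M) ->
  tribalanced F ->
  \sw_(u, m <- x) \sw_(u1, u2 <- cop B u) F u1 u2 m
  = \sw_(u, m <- x) \sw_(v, m' <- d m) F u v m'.
Proof.
move=> dA [Fb Fl Fa].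
pose G (u1 : U) (z : Utens B M) := \sw_(u2, u3 <- z) F u1 u2 u3.
have Gb : balanced (fun u a => t a * u) act G.
  split=> *.
  - by apply: sw_linear => *; apply: Fl.
  - exact: tlift_linear.
  - rewrite /G [in RHS]/act /= sw_sw //; apply: eq_sw => v w.
    by rewrite Fa tlift_pure.
have /(congr1 (fun x => tlift x G)) := dA.
rewrite !sw_sw // => e.
transitivity (\sw_(u1, u2 <- x) G u1 (d u2)) => //.
rewrite -[RHS](eq_sw _ (fun v w => sw_oxE v (d w) Gb)) -e.
apply: eq_sw => v w; rewrite sw_sw //; apply: eq_sw => v1 v2.
by rewrite sw_oxE // /G sw_oxE.
Qed.

Lemma sw_cop_coassoc (V : lmodType k) u (F : U -> U -> UA B -> V) :
  tribalanced F ->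
  \sw_(u1, u2 <- cop B u) \sw_(u11, u12 <- cop B u1) F u11 u12 u2
  = \sw_(u1, u2 <- cop B u) \sw_(u21, u22 <- cop B u2) F u1 u21 u22.
Proof. exact/sw_coassoc/cop_coassoc. Qed.

Lemma sw_takeuchi (V : lmodType k) u a (F : U -> U -> V) :
  balanced (fun u a => t a * u) (@act k A (UA B)) F ->
  \sw_(u1, u2 <- cop B u) F (u1 * t a) u2
  = \sw_(u1, u2 <- cop B u) F u1 (u2 * s a).
Proof.
move=> Fb; have /(congr1 (fun x => tlift x F)) := cop_takeuchi B u a.
rewrite !sw_sw // => e.
rewrite -[LHS](eq_sw _ (fun v w => tlift_pure _ _ Fb)) e.
by apply: eq_sw => v w; rewrite tlift_pure.
Qed.

Lemma sw_copM (V : lmodType k) u v (F : U -> U -> V) :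
  balanced (fun u a => t a * u) (@act k A (UA B)) F ->
  \sw_(w1, w2 <- cop B (u * v)) F w1 w2
  = \sw_(u1, u2 <- cop B u) \sw_(v1, v2 <- cop B v) F (u1 * v1) (u2 * v2).
Proof.
move=> Fb; rewrite copM sw_sw //; apply: eq_sw => u1 u2.
by rewrite sw_sw //; apply: eq_sw => v1 v2; rewrite tlift_pure.
Qed.

Section Action.
Variables (N : pzAlgType k) (Y : yd_algebra B N).

(* The structure carried by all the U (x)_A ... (x)_A U (x)_A N. *)
Record unmod (M : actmod k A) := UNMod {
  ua : U -> M -> M;
  rm : M -> N -> M;
  ua_linear_l : forall m, linear (ua^~ m);
  ua_linear_r : forall u, linear (ua u);
  ua1 : forall m, ua 1 m = m;
  uaM : forall u v m, ua (u * v) m = ua u (ua v m);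
  ua_src : forall a m, ua (s a) m = act a m;
  rm_linear_l : forall n, linear (rm^~ n);
  rm_linear_r : forall m, linear (rm m);
  rm1 : forall m, rm m 1 = m;
  rmM : forall m n n', rm m (n * n') = rm (rm m n) n';
  rm_bal : forall a m n, rm (ua (t a) m) n = rm m (uact Y (s a) n);
  ua_rm : forall u m n,
    ua u (rm m n) = \sw_(u1, u2 <- cop B u) rm (ua u1 m) (uact Y u2 n)
}.
End Action.

Section Basic.
Variables (N : pzAlgType k) (Y : yd_algebra B N).

Lemma uact_linear_r u : linear (uact Y u).
Proof. exact: act_linear_r (uact_mod Y) u. Qed.

Lemma uact_linear_l n : linear (uact Y ^~ n).
Proof. exact: act_linear_l (uact_mod Y) n. Qed.

Lemma uact1 n : uact Y 1 n = n.
Proof. exact: act1 (uact_mod Y) n. Qed.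

Lemma uactM u v n : uact Y (u * v) n = uact Y u (uact Y v n).
Proof. exact: actM (uact_mod Y) u v n. Qed.

(** Kept transparent, like [unmodS], because later proofs unfold [ua] and [rm] by conversion. *)
Definition unmod0 : unmod Y (yd_amod Y).
Proof.
exists (uact Y) (fun x y => (x : N) * y).
- exact: uact_linear_l.
- exact: uact_linear_r.
- exact: uact1.
- exact: uactM.
- by move=> a m; rewrite -yd_left.
- by move=> n c x y; rewrite mulrDl -pz_scalerAl.
- by move=> n c x y; rewrite mulrDr -pz_scalerAr.
- exact: mulr1.
- by move=> *; rewrite mulrA.
- by move=> *; rewrite yda_mul_bal.
- by move=> *; rewrite yda_uactM.
Defined.

Section Step.
Variables (M : actmod k A) (X : unmod Y M).

Lemma rm_act a m n : act a (rm X m n) = rm X (act a m) n.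
Proof.
rewrite -!(ua_src X) ua_rm cop_src sw_oxE ?uact1 //; split=> *.
- by apply: (lin_comp (rm_linear_l _ _)); apply: ua_linear_l.
- by apply: (lin_comp (rm_linear_r _ _)) => c x y; apply: uact_linear_l.
- by rewrite uaM rm_bal /= -uactM.
Qed.

Lemma ua_balanced u m :
  balanced (fun u a => t a * u) (@act k A (UA B))
    (fun u1 u2 => (u1 * u) \ox ua X u2 m : Utens B M).
Proof.
split=> *.
- by apply: (lin_comp (ox_linear_l _)); apply: mul_linear_l.
- by apply: (lin_comp (ox_linear_r _)); apply: ua_linear_l.
- by rewrite -mulrA ox_bal uaM ua_src.
Qed.

Definition ua_ox u (x : Utens B M) : Utens B M :=
  \sw_(v, m <- x) \sw_(u1, u2 <- cop B u) (u1 * v) \ox ua X u2 m.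

Definition rm_ox (x : Utens B M) n : Utens B M := \sw_(v, m <- x) v \ox rm X m
  n.

(** The diagonal action is well defined over A because the coproduct takes values in the Takeuchi
    product. *)
Lemma ua_ox_balanced u :
  balanced (fun u a => t a * u) act
    (fun v m => \sw_(u1, u2 <- cop B u) (u1 * v) \ox ua X u2 m : Utens B M).
Proof.
split=> *.
- apply: sw_linear => *.
  by apply: (lin_comp (ox_linear_l _)); apply: mul_linear_r.
- apply: sw_linear => *.
  by apply: (lin_comp (ox_linear_r _)); apply: ua_linear_r.
- under eq_sw => u1 u2 do rewrite mulrA.
  rewrite (sw_takeuchi u _ (ua_balanced _ _)).
  by apply: eq_sw => u1 u2; rewrite uaM ua_src.
Qed.

Lemma ua_oxE u v m :
  ua_ox u (v \ox m) = \sw_(u1, u2 <- cop B u) (u1 * v) \ox ua X u2 m.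
Proof. exact: (sw_oxE _ _ (ua_ox_balanced u)). Qed.

Lemma rm_ox_balanced n :
  balanced (fun u a => t a * u) act (fun v m => v \ox rm X m n : Utens B M).
Proof.
split=> *; first exact: ox_linear_l.
  by apply: (lin_comp (ox_linear_r _)); apply: rm_linear_l.
by rewrite ox_bal rm_act.
Qed.

Lemma rm_oxE v m n : rm_ox (v \ox m) n = v \ox rm X m n.
Proof. exact: (sw_oxE _ _ (rm_ox_balanced n)). Qed.

Lemma ua_ox_linear_r u : linear (ua_ox u).
Proof. exact: tlift_linear (ua_ox_balanced u). Qed.

Lemma rm_ox_linear_l n : linear (rm_ox^~ n).
Proof. exact: tlift_linear (rm_ox_balanced n). Qed.

Lemma ua_ox_linear_l x : linear (ua_ox^~ x).
Proof.
apply: sw_linear => v m c u u' /=; rewrite linearP.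
exact: (tlift_linear (ua_balanced v m)).
Qed.

Lemma rm_ox_linear_r x : linear (rm_ox x).
Proof.
apply: sw_linear => v m.
by apply: (lin_comp (ox_linear_r _)); apply: rm_linear_r.
Qed.

Definition unmodS : unmod Y (Utens B M).
Proof.
exists ua_ox rm_ox.
- exact: ua_ox_linear_l.
- exact: ua_ox_linear_r.
- apply: Utens_ext; [exact: ua_ox_linear_r | exact: lin_id |] => v m.
  by rewrite ua_oxE cop1 (sw_oxE _ _ (ua_balanced _ _)) ua1 mul1r.
- move=> u u'; apply: Utens_ext.
  + exact: ua_ox_linear_r.
  + exact: lin_comp (ua_ox_linear_r u) (ua_ox_linear_r u').
  + move=> v m; rewrite !ua_oxE (sw_copM _ _ (ua_balanced _ _)).
    rewrite (lin_sw _ _ (ua_ox_linear_r u)) sw_exch; apply: eq_sw => u1 u2.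
    by rewrite ua_oxE; apply: eq_sw => u1' u2'; rewrite uaM mulrA.
- move=> a; apply: Utens_ext.
  + exact: ua_ox_linear_r.
  + exact: Utens_act_linear.
  + by move=> v m; rewrite ua_oxE cop_src (sw_oxE _ _
    (ua_balanced _ _)) ua1 act_ox.
- exact: rm_ox_linear_l.
- exact: rm_ox_linear_r.
- apply: Utens_ext; [exact: rm_ox_linear_l | exact: lin_id |] => v m.
  by rewrite rm_oxE rm1.
- move=> x n n'; elim/Utens_ind: x => [v m|x y ex ey].
    by rewrite !rm_oxE rmM.
  by rewrite !(linD (rm_ox_linear_l _)) ex ey.
- move=> a x n; elim/Utens_ind: x => [v m|x y ex ey].
    rewrite ua_oxE cop_tgt (sw_oxE _ _ (ua_balanced _ _)) !rm_oxE rm_bal.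
    by rewrite mul1r.
  by rewrite (linD (ua_ox_linear_r _)) !(linD (rm_ox_linear_l _)) ex ey.
- move=> u x n; elim/Utens_ind: x => [v m|x y ex ey]; last first.
    rewrite (linD (rm_ox_linear_l _)) (linD (ua_ox_linear_r _)) ex ey.
    rewrite -sw_add; apply: eq_sw => u1 u2.
    by rewrite (linD (ua_ox_linear_r _)) (linD (rm_ox_linear_l _)).
  rewrite rm_oxE ua_oxE.
  (* Compatibility with the right N-action compares two bracketings of a threefold coproduct, u_(1)
     on [v], u_(2) on [m] and u_(3) on [n]. *)
  pose F (u1 u2 u3 : U) : Utens B M := (u1 * v) \ox rm X (ua X u2 m)
    (uact Y u3 n).
  have Fb : @tribalanced (UA B) _ F.
    split=> *.
    - split=> *.
      + apply: (lin_comp (ox_linear_r _)); apply: (lin_comp (rm_linear_l _ _)).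
        exact: ua_linear_l.
      + apply: (lin_comp (ox_linear_r _)); apply: (lin_comp (rm_linear_r _ _)).
        exact: uact_linear_l.
      + by rewrite /F uaM rm_bal uactM.
    - by apply: (lin_comp (ox_linear_l _)); apply: mul_linear_l.
    - by rewrite /F -mulrA ox_bal rm_act uaM ua_src.
  transitivity (\sw_(u1, u2 <- cop B u) \sw_(u21, u22 <- cop B u2) F u1 u21
    u22).
    apply: eq_sw => u1 u2; rewrite ua_rm.
    by rewrite (lin_sw _ _ (ox_linear_r _)).
  rewrite -(sw_cop_coassoc u Fb); apply: eq_sw => u1 u2.
  rewrite ua_oxE (lin_sw _ _ (rm_ox_linear_l _)).
  by apply: eq_sw => *; rewrite rm_oxE.
Defined.

End Step.
End Basic.
End Bialgebroid.

(** * The product on the tensor powers *)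

Section Cup.
Variables (k : comPzRingType) (A U : pzAlgType k) (B : left_bialgebroid A U).
Variables (N : pzAlgType k) (Y : yd_algebra B N).
Local Notation s := (src B).
Local Notation t := (tgt B).
Local Notation NA := (yd_amod Y).
Local Notation delta := (coact (yd_comod Y)).

Section LeftMultiplication.
Variables (M : actmod k A) (X : unmod Y M).

(* The product n y of n in N and y in M: y jumps over n by the braiding. *)
Definition nmul (n : N) (y : M) : M := \sw_(w, m <- delta n) rm X (ua X w y) m.

Lemma nmul_balanced y :
  balanced (fun u a => t a * u) (@act k A NA) (fun w m => rm X (ua X w y) m).
Proof.
split=> *.
- by apply: (lin_comp (rm_linear_l _ _)); apply: ua_linear_l.
- exact: rm_linear_r.
- by rewrite uaM rm_bal -yd_left.
Qed.

Lemma nmul_linear_l y : linear (nmul^~ y).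
Proof.
move=> c x x'; rewrite /nmul linearP.
exact: (tlift_linear (nmul_balanced y)).
Qed.

Lemma nmul_linear_r n : linear (nmul n).
Proof.
apply: sw_linear => w m.
by apply: (lin_comp (rm_linear_l _ _)); apply: ua_linear_r.
Qed.

Lemma nmul_act a n y : nmul (act a (n : NA)) y = act a (nmul n y).
Proof.
rewrite /nmul coact_act sw_sw; last exact: nmul_balanced.
rewrite -(ua_src X) (lin_sw _ _ (ua_linear_r _ _)); apply: eq_sw => w m.
by rewrite (sw_oxE _ _ (nmul_balanced y)) uaM !ua_src rm_act.
Qed.

Lemma nmul1 y : nmul 1 y = y.
Proof. by rewrite /nmul yda_coact1 (sw_oxE _ _ (nmul_balanced y)) ua1 rm1. Qed.

(** Apply the map taking w (x) m to (w y) m to both sides of the Yetter-Drinfel'd condition. *)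
Lemma ua_nmul u n y :
  ua X u (nmul n y) = \sw_(u1, u2 <- cop B u) nmul (uact Y u1 n) (ua X u2 y).
Proof.
have /(congr1 (fun x => tlift x (fun w m => rm X (ua X w y) m))) :=
  yd_compat Y u n.
rewrite !sw_sw; try exact: nmul_balanced.
move=> e; transitivity (\sw_(w, m <- delta n) \sw_(u1, u2 <- cop B u)
   rm X (ua X (u1 * w) y) (uact Y u2 m)).
  rewrite (lin_sw _ _ (ua_linear_r _ _)); apply: eq_sw => w m.
  by rewrite ua_rm; apply: eq_sw => *; rewrite uaM.
transitivity (\sw_(w, m <- delta n) tlift (\sw_(u1, u2 <- cop B u)
   (u1 * w) \ox (uact Y u2 m : NA) : Utens B NA) (fun w m => rm X
     (ua X w y) m)).
  apply: eq_sw => w m; rewrite sw_sw; last exact: nmul_balanced.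
  by apply: eq_sw => *; rewrite (sw_oxE _ _ (nmul_balanced y)).
rewrite -e; apply: eq_sw => u1 u2.
rewrite sw_sw; last exact: nmul_balanced.
by apply: eq_sw => *; rewrite (sw_oxE _ _ (nmul_balanced y)) uaM.
Qed.

Section BraidedCommutative.
Hypothesis hY : braided_commutative Y.

(** By coassociativity n (y m) = (n_(-2) y) ((n_(-1) m) n_(0)), and braided commutativity in N turns
    the last factor into n_(0) m. *)
Lemma nmul_rm n y m : nmul n (rm X y m) = rm X (nmul n y) m.
Proof.
pose F (w1 w2 : U) (m' : NA) := rm X (ua X w1 y) (uact Y w2 m * m').
have Fb : tribalanced B F.
  split=> *.
  - split=> *.
    + apply: (lin_comp (rm_linear_r _ _)) => c x x'.
      by rewrite uact_linear_l mulrDl -pz_scalerAl.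
    + apply: (lin_comp (rm_linear_r _ _)) => c x x'.
      by rewrite mulrDr -pz_scalerAr.
    + by rewrite /F uactM yda_mul_bal -yd_left.
  - by apply: (lin_comp (rm_linear_l _ _)); apply: ua_linear_l.
  - by rewrite /F uaM rm_bal yda_mul_l uactM.
transitivity (\sw_(w, m' <- delta n) \sw_(w1, w2 <- cop B w) F w1 w2 m').
  apply: eq_sw => w m'; rewrite ua_rm (lin_sw _ _ (rm_linear_l _ _)).
  by apply: eq_sw => *; rewrite -rmM.
rewrite (sw_coassoc (coact_coassoc _ _) Fb) (lin_sw _ _ (rm_linear_l _ _)).
by apply: eq_sw => w m'; rewrite -rmM hY (lin_sw _ _ (rm_linear_r _ _)).
Qed.

(** Multiplicativity of the coaction gives (n_(-1) n'_(-1) y) n_(0) n'_(0); then [nmul_rm] pulls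
    n'_(0) out of the product with n. *)
Lemma nmulM n n' y : nmul (n * n') y = nmul n (nmul n' y).
Proof.
rewrite {1}/nmul yda_coactM sw_sw; last exact: nmul_balanced.
rewrite {2}/nmul (lin_sw _ _ (nmul_linear_r n)).
transitivity (\sw_(w', m' <- delta n') \sw_(w, m <- delta n)
  rm X (rm X (ua X w (ua X w' y)) m) m').
  rewrite sw_exch; apply: eq_sw => w m.
  rewrite sw_sw; last exact: nmul_balanced.
  by apply: eq_sw => w' m'; rewrite (sw_oxE _ _ (nmul_balanced y)) uaM rmM.
by apply: eq_sw => w' m'; rewrite nmul_rm (lin_sw _ _ (rm_linear_l _ _)).
Qed.

End BraidedCommutative.
End LeftMultiplication.

Lemma nmul0 n n' : braided_commutative Y -> nmul (unmod0 Y) n n' = (n : N) * n'.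
Proof. by move=> ->. Qed.

(** The recursion in the number of factors that produces the iterated coaction of the composition
    formula. *)
Lemma nmul_ox (M : actmod k A) (X : unmod Y M) n v y :
  nmul (unmodS X) n (v \ox y) = \sw_(w, m <- delta n) (w * v) \ox nmul X m y.
Proof.
pose F (w1 w2 : U) (m : NA) : Utens B M := (w1 * v) \ox rm X (ua X w2 y) m.
have Fb : tribalanced B F.
  split=> *.
  - split=> *.
    + apply: (lin_comp (ox_linear_r _ _)).
      by apply: (lin_comp (rm_linear_l _ _)); apply: ua_linear_l.
    + by apply: (lin_comp (ox_linear_r B _)); apply: rm_linear_r.
    + by rewrite /F uaM rm_bal -yd_left.
  - by apply: (lin_comp (ox_linear_l B _)); apply: mul_linear_l.
  - by rewrite /F -mulrA ox_bal rm_act uaM ua_src.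
transitivity (\sw_(w, m <- delta n) \sw_(w1, w2 <- cop B w) F w1 w2 m).
  apply: eq_sw => w m; rewrite [ua _ _ _]ua_oxE.
  rewrite (lin_sw _ _ (rm_linear_l _ _)).
  by apply: eq_sw => *; rewrite [LHS]rm_oxE.
rewrite (sw_coassoc (coact_coassoc _ _) Fb); apply: eq_sw => w m.
by rewrite (lin_sw _ _ (ox_linear_r B _)).
Qed.

End Cup.

(** * The associative product on all tensor powers *)

Section Operad.
Variables (k : comPzRingType) (A U : pzAlgType k) (B : left_bialgebroid A U).
Variables (N : pzAlgType k) (Y : yd_algebra B N).
Local Notation s := (src B).
Local Notation t := (tgt B).
Local Notation NA := (yd_amod Y).
Local Notation delta := (coact (yd_comod Y)).
Local Notation T := (tpow B NA).
Hypothesis hY : braided_commutative Y.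

Fixpoint tum p : unmod Y (T p) :=
  if p is p'.+1 then unmodS (tum p') else unmod0 Y.

Local Notation "u \lact x" := (ua (tum _) u x)
  (at level 40, left associativity).
Local Notation "x \ract n" := (rm (tum _) x n)
  (at level 40, left associativity).

(* (u^1, ..., u^p, n) times y is (u^1, ..., u^p, n y). *)
Fixpoint cup p q : T p -> T q -> T (p + q) :=
  match p return T p -> T q -> T (p + q) with
  | 0 => fun n y => nmul (tum q) n y
  | p'.+1 => fun x y => \sw_(u, x' <- x) u \ox cup x' y
  end.
Arguments cup : simpl never.

(** Both parts go through one induction: A-linearity in degree p makes the integrand in degree p + 1
    balanced, hence [cup] linear there. *)
Lemma cup_facts p q (y : T q) :
  linear (fun x : T p => cup x y) /\
  forall a (x : T p), cup (act a x) y = act a (cup x y).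
Proof.
elim: p => [|p [IHl IHa]].
  by split=> [|a x]; [exact: nmul_linear_l | exact: nmul_act].
have Fb : balanced (fun u a => t a * u) (@act k A (T p))
    (fun u x' => u \ox cup x' y : T (p + q).+1).
  split=> *; first exact: ox_linear_l.
    exact: (lin_comp (ox_linear_r B _) IHl).
  by rewrite IHa ox_bal.
have Sl : linear (fun x : T p.+1 => cup x y) by exact: (tlift_linear Fb).
split=> // a; apply: Utens_ext.
- exact: (lin_comp Sl (@Utens_act_linear _ _ _ B _ a)).
- exact: (lin_comp (@Utens_act_linear _ _ _ B _ a) Sl).
- move=> u x; rewrite act_ox.
  by rewrite /cup /= !(sw_oxE _ _ Fb) [RHS]act_ox.
Qed.

Lemma cup_linear_l p q (y : T q) : linear (fun x : T p => cup x y).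
Proof. by have [] := cup_facts p y. Qed.

Lemma cup_act p q a (x : T p) (y : T q) : cup (act a x) y = act a (cup x y).
Proof. by have [] := cup_facts p y. Qed.

Lemma cup_ox p q u (x : T p) (y : T q) :
  cup (u \ox x : T p.+1) y = u \ox cup x y.
Proof.
apply: (sw_oxE (F := fun u x => u \ox cup x y)).
split=> *; first exact: ox_linear_l.
  exact: (lin_comp (ox_linear_r B _) (cup_linear_l _)).
by rewrite cup_act ox_bal.
Qed.

Lemma cup_linear_r p q (x : T p) : linear (@cup p q x).
Proof.
elim: p x => [|p IH] x; first exact: nmul_linear_r.
by apply: sw_linear => *; apply: (lin_comp (ox_linear_r B _)).
Qed.

Lemma ua_tum_ox p u v (x : T p) :
  u \lact (v \ox x : T p.+1) = \sw_(u1, u2 <- cop B u) (u1 * v) \ox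
    (u2 \lact x).
Proof. exact: ua_oxE. Qed.

Lemma rm_tum_ox p v (x : T p) n :
  (v \ox x : T p.+1) \ract n = v \ox (x \ract n).
Proof. exact: rm_oxE. Qed.

Lemma rm_cup p q (x : T p) (y : T q) n :
  cup x y \ract n = cup x (y \ract n).
Proof.
elim: p x => [|p IH] x; first by rewrite /cup nmul_rm.
elim/Utens_ind: x => [u x|x x' ex ex'].
  by rewrite !cup_ox [LHS]rm_tum_ox IH.
by rewrite !(linD (cup_linear_l _)) -ex -ex' (linD (rm_linear_l _ _)).
Qed.

Lemma cup_rm p q (x : T p) n (y : T q) :
  cup (x \ract n) y = cup x (cup (n : T 0) y).
Proof.
elim: p x => [|p IH] x; first by rewrite /cup -nmulM.
elim/Utens_ind: x => [u x|x x' ex ex'].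
  by rewrite rm_tum_ox !cup_ox IH.
by rewrite (linD (rm_linear_l _ _)) !(linD (cup_linear_l _)) ex ex'.
Qed.

Lemma ua_tum_tgt p a v (x : T p) :
  t a \lact (v \ox x : T p.+1) = v \ox (t a \lact x).
Proof.
by rewrite ua_tum_ox cop_tgt (sw_oxE _ _ (ua_balanced _ _ _)) mul1r.
Qed.

(* t(a) n = n (a 1_N), hence the base case follows from associativity. *)
Lemma cup_bal p q a (x : T p) (y : T q) :
  cup (t a \lact x) y = cup x (act a y).
Proof.
elim: p x => [|p IH] x.
  have -> : t a \lact x = (x : N) * uact Y (s a) 1.
    by rewrite -yda_mul_bal mulr1.
  by rewrite /cup /= nmulM // -yd_left nmul_act nmul1.
elim/Utens_ind: x => [v x|x x' ex ex'].
  by rewrite ua_tum_tgt !cup_ox IH.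
by rewrite (linD (ua_linear_r _ _)) !(linD (cup_linear_l _)) ex ex'.
Qed.

Lemma cup_ua_balanced p q (x : T p) (y : T q) :
  balanced (fun u a => t a * u) (@act k A (UA B))
    (fun u1 u2 => cup (u1 \lact x) (u2 \lact y)).
Proof.
split=> *.
- by apply: (lin_comp (cup_linear_l _)); apply: ua_linear_l.
- by apply: (lin_comp (cup_linear_r _)); apply: ua_linear_l.
- by rewrite uaM cup_bal /= -(ua_src (tum q)) uaM.
Qed.

(** The base case is the Yetter-Drinfel'd condition in the form [ua_nmul]; each further factor costs
    one use of coassociativity. *)
Lemma ua_cup p q u (x : T p) (y : T q) :
  u \lact cup x y = \sw_(u1, u2 <- cop B u) cup (u1 \lact x) (u2 \lact y).
Proof.
elim: p x u => [|p IH] x u; first exact: ua_nmul.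
elim/Utens_ind: x => [v x|x x' ex ex']; last first.
  rewrite (linD (cup_linear_l _)) (linD (ua_linear_r _ _)) ex ex' -sw_add.
  by apply: eq_sw => *; rewrite (linD (ua_linear_r _ _)) (linD
    (cup_linear_l _)).
rewrite cup_ox [LHS]ua_tum_ox.
transitivity (\sw_(u1, u2 <- cop B u) \sw_(u21, u22 <- cop B u2)
  (u1 * v) \ox cup (u21 \lact x) (u22 \lact y) : T (p.+1 + q)).
  by apply: eq_sw => *; rewrite IH (lin_sw _ _ (ox_linear_r B _)).
pose F (u1 u2 : U) (u3 : UA B) : T (p.+1 + q) :=
  (u1 * v) \ox cup (u2 \lact x) (u3 \lact y).
have Fb : tribalanced B F.
  split=> [u1|u2 u3|a u1 u2 u3].
  - have [Fl Fr FA] := cup_ua_balanced x y; split=> *.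
    + exact: (lin_comp (ox_linear_r B _)).
    + exact: (lin_comp (ox_linear_r B _)).
    + by rewrite /F FA.
  - by apply: (lin_comp (ox_linear_l B _)); apply: mul_linear_l.
  - by rewrite /F -mulrA ox_bal -cup_act -(ua_src (tum _)) -uaM.
rewrite -(sw_cop_coassoc u Fb); apply: eq_sw => u1 u2.
rewrite ua_tum_ox (lin_sw _ _ (cup_linear_l _)).
by apply: eq_sw => *; rewrite cup_ox.
Qed.

Notation C := (Cco Y).

Lemma heq_ox p q u (x : C p) (y : C q) :
  x =h y -> (u \ox x : C p.+1) =h (u \ox y : C q.+1).
Proof.
apply: (heq_fun (F := fun p (x : C p) => u \ox x : C p.+1)) => n.
exact: lin0 (ox_linear_r B u).
Qed.

(** The essential case of associativity. Both sides equal (n_(-2) y) ((n_(-1) z) n_(0)): on the left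
    n_(0) crosses to [z] by [cup_rm], on the right [ua_cup] distributes the action over the
    product. *)
Lemma cup_nmul q r (n : N) (y : T q) (z : T r) :
  cup (cup (n : T 0) y) z = cup (n : T 0) (cup y z) :> T (q + r).
Proof.
rewrite {2}/cup /= {1}/nmul (lin_sw _ _ (cup_linear_l _)).
transitivity (\sw_(w, m <- delta n) \sw_(w', m' <- delta m)
  cup (w \lact y) ((w' \lact z) \ract m') : T (q + r)).
  by apply: eq_sw => w m; rewrite cup_rm (lin_sw _ _ (cup_linear_r _)).
pose F (u1 u2 : U) (m : NA) := cup (u1 \lact y) ((u2 \lact z) \ract m).
have Fb : tribalanced B F.
  split=> [u|u m|a u v m].
  - split=> *.
    + apply: (lin_comp (cup_linear_r _)); apply: (lin_comp (rm_linear_l _ _)).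
      exact: ua_linear_l.
    + by apply: (lin_comp (cup_linear_r _)); apply: rm_linear_r.
    + by rewrite /F uaM rm_bal -yd_left.
  - by apply: (lin_comp (cup_linear_l _)); apply: ua_linear_l.
  - by rewrite /F uaM cup_bal rm_act uaM ua_src.
rewrite -(sw_coassoc (coact_coassoc _ _) Fb); apply: eq_sw => w m.
rewrite ua_cup (lin_sw _ _ (rm_linear_l _ _)); apply: eq_sw => *.
by rewrite rm_cup.
Qed.

Lemma cupA p q r (x : C p) (y : C q) (z : C r) :
  (cup (cup x y) z : C (p + q + r)) =h (cup x (cup y z) : C (p + (q + r))).
Proof.
elim: p x => [|p IH] x; first by rewrite cup_nmul.
elim/Utens_ind: x => [u x|x x' ex ex'].
  by rewrite !cup_ox; apply/heq_ox/IH.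
rewrite !(linD (cup_linear_l _)); exact: heqD.
Qed.

Lemma cup_heq p p' q q' (x : C p) (x' : C p') (y : C q) (y' : C q') :
  x =h x' -> y =h y' -> (cup x y : C (p + q)) =h (cup x' y' : C (p' + q')).
Proof.
move=> ex ey; apply: (heq_trans (y := cup x' y : C (p' + q))).
  apply: (heq_fun (F := fun p (x : C p) => cup x y : C (p + q))) ex => n.
  exact: lin0 (cup_linear_l y).
apply: (heq_fun (F := fun q (y : C q) => cup x' y : C (p' + q))) ey => n.
exact: lin0 (cup_linear_r x').
Qed.

Lemma indeg_ua l p u (x : C p) :
  indeg l (u \lact x : C p) = u \lact (indeg l x : C l) :> C l.
Proof.
rewrite /indeg; case: eqP => [e|_]; first by case: l / e.
by rewrite (lin0 (ua_linear_r (tum l) u)).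
Qed.

Lemma indeg_rm l p (x : C p) n :
  indeg l (x \ract n : C p) = (indeg l x : C l) \ract n :> C l.
Proof.
rewrite /indeg; case: eqP => [e|_]; first by case: l / e.
by rewrite (lin0 (rm_linear_l (tum l) n)).
Qed.

(** * The operad structure on the cochains *)

(** At position 1 the first factor acts on [y] and the result multiplies the rest; later positions
    skip the first factor. [indeg] adjusts the degree, and the value 0 at index 0 is a filler, as
    positions start at 1. *)
Fixpoint ocirc p q i : C p -> C q -> C (p + q - 1) :=
  match p return C p -> C q -> C (p + q - 1) with
  | 0 => fun _ _ => 0
  | p'.+1 => fun x y => match i with
    | 0 => 0
    | 1 => \sw_(u, x' <- x) indeg (p'.+1 + q - 1) (cup (u \lact y) x' : C _)
    | j.+1 => \sw_(u, x' <- x) indeg (p'.+1 + q - 1)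
      (u \ox ocirc j x' y : C _.+1)
    end
  end.

Lemma ocirc_balanced1 p q l (y : C q) :
  balanced (fun u a => t a * u) (@act k A (T p))
    (fun u (x : T p) => indeg l (cup (u \lact y) x : C _)).
Proof.
split=> *.
- apply: (lin_indeg (V := C)).
  by apply: (lin_comp (cup_linear_l _)); apply: ua_linear_l.
- apply: (lin_indeg (V := C)); exact: cup_linear_r.
- by rewrite uaM cup_bal.
Qed.

Lemma ocirc_ox1 p q u (x : C p) (y : C q) :
  ocirc 1 (u \ox x : C p.+1) y = indeg (p.+1 + q - 1) (cup (u \lact y) x : C _).
Proof. exact: (sw_oxE u x (ocirc_balanced1 p (p.+1 + q - 1) y)). Qed.

Lemma ocirc_facts p q i (y : C q) :
  linear (fun x : T p => ocirc i.+1 x y) /\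
  forall a (x : T p), ocirc i.+1 (act a x) y = act a (ocirc i.+1 x y : T _).
Proof.
have a0 p' a : act a (0 : T p') = 0.
  by rewrite -(ua_src (tum p')) (lin0 (ua_linear_r _ _)).
elim: p i => [|p IH] i.
  by split=> [|a x] /=; [exact: lin_cst0 | rewrite a0].
have aI l m a (x : C m) : indeg l (act a (x : T m) : C m) = act a
  (indeg l x : T l).
  by rewrite -!(ua_src (tum _)) indeg_ua.
case: i => [|i].
  have Sl := tlift_linear (ocirc_balanced1 p (p.+1 + q - 1) y).
  split=> // a; apply: Utens_ext.
  - exact: (lin_comp Sl (@Utens_act_linear _ _ _ B _ a)).
  - apply: (lin_comp (f := fun x : T p.+1 => ocirc 1 x y : T _) _ Sl).
    by move=> c x y'; rewrite -!(ua_src (tum _)) ua_linear_r.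
  - move=> u x; rewrite act_ox !ocirc_ox1.
    by rewrite -aI -(ua_src (tum _)) uaM !ua_src cup_act.
have [IHl IHa] := IH i.
have Fb : balanced (fun u a => t a * u) (@act k A (T p))
    (fun u x => indeg (p.+1 + q - 1) (u \ox ocirc i.+1 x y : C _.+1)).
  split=> *.
  - apply: (lin_indeg (V := C)); exact: (ox_linear_l B).
  - apply: (lin_indeg (V := C)).
    exact: (lin_comp (ox_linear_r B _) IHl).
  - by rewrite IHa ox_bal.
have Sl := tlift_linear Fb.
split=> // a; apply: Utens_ext.
- exact: (lin_comp Sl (@Utens_act_linear _ _ _ B _ a)).
- apply: (lin_comp (f := fun x : T p.+1 => ocirc i.+2 x y : T _) _ Sl).
  by move=> c x y'; rewrite -!(ua_src (tum _)) ua_linear_r.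
- move=> u x; rewrite act_ox.
  rewrite (_ : ocirc _ _ _ = indeg (p.+1 + q - 1)
    ((s a * u) \ox ocirc i.+1 x y : C _.+1)).
    rewrite (_ : ocirc _ _ _ = indeg (p.+1 + q - 1)
      (u \ox ocirc i.+1 x y : C _.+1)).
      by rewrite -aI act_ox.
    exact: (sw_oxE _ _ Fb).
  exact: (sw_oxE _ _ Fb).
Qed.

Lemma ocirc_linear_l p q i (y : C q) : linear (fun x : C p => ocirc i.+1 x y).
Proof. by have [] := ocirc_facts p i y. Qed.

Lemma ocirc_act p q i a (x : T p) (y : C q) :
  ocirc i.+1 (act a x) y = act a (ocirc i.+1 x y : T _).
Proof. by have [] := ocirc_facts p i y. Qed.

Lemma ocirc_oxS p q i u (x : C p) (y : C q) :
  ocirc i.+2 (u \ox x : C p.+1) y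
  = indeg (p.+1 + q - 1) (u \ox ocirc i.+1 x y : C _.+1).
Proof.
apply: (sw_oxE (F := fun u x => indeg _ (u \ox ocirc i.+1 x y : C _.+1))).
split=> *.
- apply: (lin_indeg (V := C)); exact: (ox_linear_l B).
- apply: (lin_indeg (V := C)).
  exact: (lin_comp (ox_linear_r B _) (ocirc_linear_l _ _)).
- by rewrite ocirc_act ox_bal.
Qed.

Lemma ocirc_linear_r p q i (x : C p) : linear (fun y : C q => ocirc i x y).
Proof.
elim: p i x => [|p IH] [|[|i]] x; try exact: lin_cst0.
  apply: sw_linear => *; apply: (lin_indeg (V := C)).
  by apply: (lin_comp (cup_linear_l _)); apply: ua_linear_r.
apply: sw_linear => *; apply: (lin_indeg (V := C)).
by apply: (lin_comp (ox_linear_r B _)).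
Qed.

Lemma ocirc_heq1 p q u (x : C p) (y : C q) :
  ocirc 1 (u \ox x : C p.+1) y =h (cup (u \lact y) x : C _).
Proof. by rewrite ocirc_ox1; apply: heq_indeg; lia. Qed.

(** For p = q = 0 truncation makes the two degrees differ, but both sides are then 0. *)
Lemma ocirc_heqS p q i u (x : C p) (y : C q) :
  ocirc i.+2 (u \ox x : C p.+1) y =h (u \ox ocirc i.+1 x y : C _.+1).
Proof.
rewrite ocirc_oxS; case: p x => [|p] x; last by apply: heq_indeg; lia.
by rewrite /= (lin0 (ox_linear_r B u)) indeg0; apply: heq0.
Qed.

Lemma ocirc_heq p p' q q' i (x : C p) (x' : C p') (y : C q) (y' : C q') :
  x =h x' -> y =h y' -> ocirc i.+1 x y =h ocirc i.+1 x' y'.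
Proof.
move=> ex ey; apply: (heq_trans (y := ocirc i.+1 x' y)).
  apply: (heq_fun (F := fun p (x : C p) => ocirc i.+1 x y)) ex => n.
  exact: lin0 (ocirc_linear_l i y).
apply: (heq_fun (F := fun q (y : C q) => ocirc i.+1 x' y)) ey => n.
exact: lin0 (ocirc_linear_r i.+1 x').
Qed.

Lemma ocirc_out p q i (x : C p) (y : C q) : (p < i.+1)%N -> ocirc i.+1 x y = 0.
Proof.
elim: p i x => [//|p IH] [//|i] x hi; elim/Utens_ind: x => [u x|x x' ex ex'].
  by rewrite ocirc_oxS IH // (lin0 (ox_linear_r B u)) indeg0.
by rewrite (linD (ocirc_linear_l _ _)) ex ex' addr0.
Qed.

Lemma ocirc_ua p q i u (x : C p) (y : C q) :
  ocirc i.+1 (u \lact x : C p) y = u \lact (ocirc i.+1 x y) :> C _.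
Proof.
elim: p i x u => [|p IH] i x u; first by rewrite /= (lin0 (ua_linear_r _ _)).
elim/Utens_ind: x => [v x|x x' ex ex']; last first.
  by rewrite (linD (ua_linear_r _ _)) !(linD (ocirc_linear_l _ _)) ex ex'
    -(linD (ua_linear_r _ _)).
rewrite ua_tum_ox (lin_sw _ _ (ocirc_linear_l _ _)); case: i => [|i].
  rewrite ocirc_ox1 -indeg_ua ua_cup (lin_sw _ _ (@indeg_linear _ C _ _)).
  by apply: eq_sw => u1 u2; rewrite ocirc_ox1 uaM.
rewrite ocirc_oxS -indeg_ua ua_tum_ox (lin_sw _ _ (@indeg_linear _ C _ _)).
by apply: eq_sw => u1 u2; rewrite ocirc_oxS IH.
Qed.

Lemma ocirc_rm p q i (x : C p) n (y : C q) :
  ocirc i.+1 (x \ract n : C p) y = ocirc i.+1 x y \ract n :> C _.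
Proof.
elim: p i x => [|p IH] i x; first by rewrite /= (lin0 (rm_linear_l _ _)).
elim/Utens_ind: x => [v x|x x' ex ex']; last first.
  by rewrite (linD (rm_linear_l _ _)) !(linD (ocirc_linear_l _ _)) ex ex'
    -(linD (rm_linear_l _ _)).
rewrite rm_tum_ox; case: i => [|i].
  by rewrite !ocirc_ox1 -indeg_rm rm_cup.
by rewrite !ocirc_oxS -indeg_rm rm_tum_ox IH.
Qed.

(** At the first input this is associativity: ((u z) x') y = (u z) (x' y). *)
Lemma ocirc_cup_l p q r i (x : C p) (y : C q) (z : C r) : (i < p)%N ->
  ocirc i.+1 (cup x y : C (p + q)) z =h (cup (ocirc i.+1 x z) y : C _).
Proof.
elim: p i x => [//|p IH] i x hi; elim/Utens_ind: x => [u x|x x' ex ex'].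
  rewrite cup_ox; case: i hi => [|i] hi.
    apply: heq_trans (ocirc_heq1 _ _ _) _.
    apply: heq_trans (heq_sym (cupA _ _ _)) _.
    exact: cup_heq (heq_sym (ocirc_heq1 _ _ _)) (heq_refl y).
  apply: heq_trans (ocirc_heqS _ _ _ _) _.
  apply: heq_trans (cup_heq (heq_sym (ocirc_heqS _ _ _ _)) (heq_refl y)).
  by rewrite cup_ox; apply/heq_ox/IH.
rewrite (linD (cup_linear_l _)) !(linD (ocirc_linear_l _ _)).
by rewrite (linD (cup_linear_l _)); apply: heqD.
Qed.

(** The base case holds because n y is a sum of terms (w y) m, and composition commutes with both
    actions ([ocirc_ua], [ocirc_rm]). *)
Lemma ocirc_cup_r p q r i (x : C p) (y : C q) (z : C r) :
  ocirc (p + i).+1 (cup x y : C (p + q)) z =h (cup x (ocirc i.+1 y z) : C _).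
Proof.
elim: p x => [|p IH] x.
  apply: eq_heq; rewrite /cup /= /nmul (lin_sw _ _ (ocirc_linear_l _ _)).
  by apply: eq_sw => w m; rewrite ocirc_rm ocirc_ua.
elim/Utens_ind: x => [u x|x x' ex ex'].
  rewrite !cup_ox; apply: heq_trans (ocirc_heqS _ _ _ _) _.
  exact/heq_ox/IH.
rewrite !(linD (cup_linear_l _)) (linD (ocirc_linear_l _ _)); exact: heqD.
Qed.

(** At the first input, ((u y) x') o z = ((u y) o z) x' = (u (y o z)) x'. *)
Lemma ocirc_inside p q r i j (x : C p) (y : C q) (z : C r) : (j < q)%N ->
  ocirc (i + j).+1 (ocirc i.+1 x y) z =h ocirc i.+1 x (ocirc j.+1 y z).
Proof.
move=> hj; elim: p i x => [|p IH] i x.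
  by rewrite /= (lin0 (ocirc_linear_l _ _)); apply: heq0.
elim/Utens_ind: x => [u x|x x' ex ex'].
  case: i => [|i].
    apply: heq_trans (ocirc_heq _ (ocirc_heq1 _ _ _) (heq_refl z)) _.
    apply: heq_trans (ocirc_cup_l _ _ _ hj) _.
    by rewrite ocirc_ua; apply: heq_sym; apply: ocirc_heq1.
  apply: heq_trans (ocirc_heq _ (ocirc_heqS _ _ _ _) (heq_refl z)) _.
  apply: heq_trans (ocirc_heqS _ _ _ _) _.
  apply: heq_trans (heq_sym (ocirc_heqS _ _ _ _)).
  exact/heq_ox/IH.
rewrite !(linD (ocirc_linear_l _ _)); exact: heqD.
Qed.

(** At the first input, (u z) (x' o y) = ((u z) x') o y, the index being shifted by the r factors of
    u z. *)
Lemma ocirc_before p q r i j (x : C p) (y : C q) (z : C r) : (j <= i)%N ->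
  ocirc j.+1 (ocirc i.+2 x y) z =h ocirc (i + r).+1 (ocirc j.+1 x z) y.
Proof.
elim: p i j x => [|p IH] i j x hj.
  by rewrite /= !(lin0 (ocirc_linear_l _ _)); apply: heq0.
elim/Utens_ind: x => [u x|x x' ex ex'].
  case: j hj => [|j] hj.
    apply: heq_trans (ocirc_heq _ (ocirc_heqS _ _ _ _) (heq_refl z)) _.
    apply: heq_trans (ocirc_heq1 _ _ _) _.
    apply: heq_trans (heq_sym (ocirc_heq _ (ocirc_heq1 _ _ _) (heq_refl y))).
    by rewrite [(i + r)%N]addnC; apply: heq_sym; apply: ocirc_cup_r.
  case: i hj => [//|i] hj.
  apply: heq_trans (ocirc_heq _ (ocirc_heqS _ _ _ _) (heq_refl z)) _.
  apply: heq_trans (ocirc_heqS _ _ _ _) _.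
  apply: heq_trans (heq_sym (ocirc_heq _ (ocirc_heqS _ _ _ _) (heq_refl y))).
  apply: heq_trans (heq_sym (ocirc_heqS _ _ _ _)).
  exact/heq_ox/IH.
rewrite !(linD (ocirc_linear_l _ _)); exact: heqD.
Qed.

(** Since u_(2) 1_N = eps(u_(2)) 1_N, the right counit axiom collapses the coproduct. *)
Lemma ua_one u : u \lact (Cco_one Y : T 1) = u \ox (1 : NA) :> T 1.
Proof.
rewrite /Cco_one /elem /= [LHS](ua_tum_ox (p := 0)).
rewrite -[in RHS](cop_counitr B u) (lin_sw _ _ (ox_linear_l B _)).
by apply: eq_sw => u1 u2; rewrite mulr1 ox_bal /= yda_uact1_src yd_left.
Qed.

Lemma cup_one p u (x : T p) :
  cup (u \ox (1 : T 0) : T 1) x = u \ox x :> T p.+1.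
Proof. by rewrite cup_ox /cup /= nmul1. Qed.

Lemma cup_unit p (x : C p) : (cup x (1 : T 0) : C (p + 0)) =h x.
Proof.
elim: p x => [|p IH] x.
  by apply: eq_heq; rewrite /cup /= nmul0 // mulr1.
elim/Utens_ind: x => [u x|x x' ex ex']; first by rewrite cup_ox;
  apply/heq_ox/IH.
by rewrite (linD (cup_linear_l _)); apply: heqD.
Qed.

Lemma ocirc_is_operad : is_operad (@ocirc) (Cco_one Y).
Proof.
split.
- move=> p q [//|i] y _; exact: ocirc_linear_l.
- move=> p q i x _; exact: ocirc_linear_r.
- by move=> [|p] q [|i] x y // _; rewrite orbF => /ocirc_out ->.
- move=> p q r [//|i] [//|j] x y z _ _; case: i => [//|i] hj.
  rewrite (_ : i.+2 + r - 1 = (i + r).+1)%N; last by lia.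
  exact: ocirc_before.
- move=> p q r [//|i] [//|j] x y z _ _ /andP[hi hj].
  rewrite (_ : j.+1 - i.+1 + 1 = (j - i).+1)%N; last by lia.
  have {1}-> : (j = i + (j - i))%N by lia.
  apply: ocirc_inside; lia.
(* Composition at a later input is [ocirc_before] read from right to left. *)
- move=> p q r [//|i] [//|j] x y z _ _ hj.
  rewrite (_ : j.+1 - q + 1 = (j - q - i + i).+2)%N; last by lia.
  apply: heq_sym; apply: heq_trans (ocirc_before _ _ _ _) _; first lia.
  by rewrite (_ : (_ + q).+1 = j.+1)%N; last by lia.
- move=> p [//|i] x /= hi; elim: p i x hi => [//|p IH] i x hi.
  elim/Utens_ind: x => [u x|x x' ex ex'].
    case: i hi => [|i] hi.
      by apply: heq_trans (ocirc_heq1 _ _ _) _; rewrite ua_one cup_one.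
    apply: heq_trans (ocirc_heqS _ _ _ _) _; exact/heq_ox/IH.
  by rewrite (linD (ocirc_linear_l _ _)); apply: heqD.
- move=> p x; apply: heq_trans (ocirc_heq1 _ _ _) _.
  by rewrite ua1; apply: cup_unit.
Qed.

Lemma ocirc_mu1 p (x : C p) :
  ocirc 1 (Cco_mu Y) x =h (cup x (Cco_one Y : T 1) : C (p + 1)).
Proof. by apply: heq_trans (ocirc_heq1 _ _ _) _; rewrite ua1. Qed.

Lemma ocirc_mu2 p (x : C p) : ocirc 2 (Cco_mu Y) x =h (1 \ox x : C p.+1).
Proof.
apply: heq_trans (ocirc_heqS _ _ _ _) _; apply: heq_ox.
apply: heq_trans (ocirc_heq1 _ _ _) _; rewrite ua1; exact: cup_unit.
Qed.

Lemma ocirc_is_operad_mult : is_operad_mult (@ocirc) (Cco_one Y) (Cco_mu Y)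
  (Cco_e Y).
Proof.
split; first exact: ocirc_is_operad.
- apply: heq_eq; apply: heq_trans (ocirc_mu1 _) _.
  apply: heq_trans (heq_sym (ocirc_mu2 _)).
  by rewrite [cup _ _]cup_ox cup_one; apply: heq_refl.
- apply: heq_trans (ocirc_mu1 _) _.
  by rewrite /cup /= nmul1; apply: heq_refl.
- by apply: heq_trans (ocirc_mu2 _) _; apply: heq_refl.
Qed.

(** * The explicit formula for the compositions *)

Section MultiSweedler.
Variables (M : actmod k A) (V : lmodType k).

Lemma lin_mlift (W : lmodType k) (f : V -> W) p (x : tpow B M p) F :
  linear f -> f (mlift x F) = mlift x (fun us n => f (F us n)).
Proof.
move=> fl; elim: p x F => [//|p IH] x F /=; rewrite (lin_sw _ _ fl).
by apply: eq_sw => u y; rewrite IH.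
Qed.

(* [mlift] chooses representatives, so it agrees with a linear map as soon as *)
(* the integrand does on elementary tensors; balancedness is never checked.  *)
Lemma mliftE p (x : tpow B M p) (F : seq U -> M -> V) (f : tpow B M p -> V) :
  linear f ->
  (forall us n, size us = p -> f (etens B p us n) = F us n) -> mlift x F = f x.
Proof.
elim: p x F f => [|p IH] x F f fl fF /=; first by rewrite -fF.
rewrite -[x in RHS](sw_ox x) (lin_sw _ _ fl); apply: eq_sw => u y.
apply: (IH y _ (fun y => f (u \ox y))) => [|us n hus].
  exact: (lin_comp fl (ox_linear_r B u)).
by rewrite -fF /= ?hus.
Qed.

Lemma eq_mlift p (x : tpow B M p) (F G : seq U -> M -> V) :
  (forall us n, size us = p -> F us n = G us n) -> mlift x F = mlift x G.
Proof.
elim: p x F G => [|p IH] x F G FG /=; first exact: FG.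
by apply: eq_sw => u y; apply: IH => us n hus; apply: FG; rewrite /= hus.
Qed.

End MultiSweedler.

Section Multiply.
Variables (M : actmod k A) (f : M -> NA).
Hypothesis fl : linear f.
Hypothesis fa : forall a m, f (act a m) = act a (f m).

(** A linear map with the shape of the integrand in [circ_formula], serving iterated coproducts ([M]
    is U) and iterated coactions ([M] is N) alike. *)
Fixpoint mulT (q : nat) (vs : seq U) : tpow B M q -> T q :=
  match q return tpow B M q -> T q with
  | 0 => f
  | q'.+1 => fun x => \sw_(w, y <- x) (w * head 0 vs) \ox mulT (behead vs) y
  end.

Lemma mulT_facts q vs :
  linear (@mulT q vs) /\ forall a x, mulT vs (act a x) = act a (mulT
    (q := q) vs x).
Proof.
elim: q vs => [//|q IH] vs; have [IHl IHa] := IH (behead vs).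
have Fb : balanced (fun u a => t a * u) (@act k A (tpow B M q))
    (fun w y => (w * head 0 vs) \ox mulT (behead vs) y : T q.+1).
  split=> *.
  - by apply: (lin_comp (ox_linear_l B _)); apply: mul_linear_l.
  - exact: (lin_comp (ox_linear_r B _)).
  - by rewrite IHa -mulrA ox_bal.
have Sl : linear (@mulT q.+1 vs) by exact: tlift_linear Fb.
split=> // a; apply: Utens_ext.
- exact: (lin_comp Sl (@Utens_act_linear _ _ _ B _ a)).
- exact: (lin_comp (@Utens_act_linear _ _ _ B _ a) Sl).
- move=> u x; rewrite act_ox /= !(sw_oxE _ _ Fb).
  by rewrite -mulrA -act_ox.
Qed.

Lemma mulT_linear q vs : linear (@mulT q vs).
Proof. by have [] := mulT_facts q vs. Qed.

Lemma mulT_ox q v vs w (y : tpow B M q) :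
  mulT (q := q.+1) (v :: vs) (w \ox y) = (w * v) \ox mulT vs y.
Proof.
apply: (sw_oxE (F := fun w y => (w * v) \ox mulT vs y)); split=> *.
- by apply: (lin_comp (ox_linear_l B _)); apply: mul_linear_l.
- exact: (lin_comp (ox_linear_r B _) (@mulT_linear _ _)).
- by rewrite (proj2 (mulT_facts _ _)) -mulrA ox_bal.
Qed.

Lemma mulT_etens q vs ws m : size vs = q -> size ws = q ->
  mulT vs (etens B q ws m) = etens B q (mulseq ws vs) (f m).
Proof.
elim: q vs ws => [//|q IH] [//|v vs] [//|w ws] [hvs] [hws].
by rewrite /= [LHS]mulT_ox IH.
Qed.

End Multiply.

Lemma ua_elem q vs n' u : size vs = q ->
  u \lact elem Y q vs n' = mulT (M := UA B) (uact Y ^~ n') vs (iter_cop B q u).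
Proof.
elim: q vs u => [//|q IH] [//|v vs] u [hvs]; rewrite [LHS]ua_tum_ox.
have Fl : linear (uact Y ^~ n' : UA B -> NA) by exact: uact_linear_l.
have Fa a (w : UA B) : uact Y (act a w) n' = act a (uact Y w n' : NA).
  by rewrite /= uactM -yd_left.
rewrite [iter_cop _ _ _]/= (lin_sw _ _ (mulT_linear Fl Fa _)).
by apply: eq_sw => u1 u2; rewrite mulT_ox // [_ \lact _]IH.
Qed.

Lemma cup_elem q r ws m us n : size ws = q -> size us = r ->
  cup (elem Y q ws m : T q) (elem Y r us n : T r)
  = \swn_(xs, m0 <- iter_co Y r m) elem Y (q + r) (ws ++ mulseq xs us)
    ((m0 : N) * n).
Proof.
have Fl : linear (fun m0 : NA => (m0 : N) * n : NA) by exact: mul_linear_l.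
have Fa a (m0 : NA) : (act a m0 : N) * n = act a ((m0 : N) * n : NA).
  by rewrite /= !yd_left yda_mul_l.
elim: q ws => [|q IH] [|w ws] // hws hus.
  rewrite (mliftE _ (mulT_linear Fl Fa us)); last first.
    by move=> xs m0 hxs; rewrite mulT_etens.
  rewrite /cup /= {hws}; elim: r us m hus => [|r IHr] [|u us] // m hus.
    exact: nmul0.
  rewrite [LHS]nmul_ox [iter_co _ _ _]/= (lin_sw _ _ (mulT_linear Fl Fa _)).
  case: hus => hus.
  by apply: eq_sw => w m0; rewrite mulT_ox // -IHr.
case: hws => hws; rewrite [LHS]cup_ox IH // (lin_mlift _ _ (ox_linear_r B w)).
exact: eq_mlift.
Qed.

Fixpoint prepend (us : seq U) m (x : C m) : C (size us + m) :=
  match us return C (size us + m) with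
  | [::] => x
  | u :: us' => u \ox prepend us' x
  end.

Lemma prepend_linear us m : linear (@prepend us m).
Proof.
elim: us => [//|u us IH]; exact: (lin_comp (ox_linear_r B u) IH).
Qed.

Lemma prepend_elem us m vs n :
  prepend us (elem Y m vs n) = elem Y (size us + m) (us ++ vs) n.
Proof. by elim: us => [//|u us IH] /=; rewrite IH. Qed.

Lemma elem_heq p q us n : p = q -> elem Y p us n =h elem Y q us n.
Proof. by move->. Qed.

Lemma ocirc_elem p q j us n (y : C q) : size us = p -> (j < p)%N ->
  ocirc j.+1 (elem Y p us n) y
  =h prepend (take j us)
       (cup (nth 0 us j \lact y) (elem Y (p - j.+1) (drop j.+1 us) n) : C _).
Proof.
elim: p us j => [//|p IH] [//|u us] [|j] [hus] hj.
  by apply: heq_trans (ocirc_heq1 _ _ _) _; rewrite subSS subn0 /= drop0.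
apply: heq_trans (ocirc_heqS _ _ _ _) _; exact/heq_ox/IH.
Qed.

Lemma ocirc_circ_formula : circ_formula (@ocirc).
Proof.
move=> p q [//|i] us n vs n' hi; set u := nth 0 us i.+1.-1.
set drp := drop _ _; set tk := take _ _.
have hd : size drp = (p - i.+1)%N by rewrite size_drop size_tuple.
have ht : size tk = i.
  by rewrite size_takel // size_tuple; apply: ltnW; case/andP: hi.
have Fl : linear (uact Y ^~ n' : UA B -> NA) by exact: uact_linear_l.
have Fa a (w : UA B) : uact Y (act a w) n' = act a (uact Y w n' : NA).
  by rewrite /= uactM -yd_left.
(* The linear map demanded by [mliftE]: on elementary tensors of the iterated coproduct it yields
   the inner sum over the coaction. *)
pose f x : C (p + q - 1) := indeg (p + q - 1)
  (prepend tk (cup (mulT (M := UA B) (uact Y ^~ n') vs x : T q)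
     (elem Y (p - i.+1) drp n) : C _)).
rewrite (@mliftE (UA B) (Cco Y _) q _ _ f).
- have := ocirc_elem n (elem Y q vs n') (size_tuple us) (proj2 (andP hi)).
  move/(_ (p + q - 1)%N); rewrite indeg_id => ->.
  by rewrite ua_elem // size_tuple.
- apply: (lin_indeg (V := C)); apply: (lin_comp (@prepend_linear tk _)).
  by apply: (lin_comp (cup_linear_l _)); apply: mulT_linear.
move=> ws w hws; rewrite /f mulT_etens ?size_tuple // [cup _ _]cup_elem //;
  last first.
  by rewrite size_map size_zip hws size_tuple minnn.
rewrite (lin_mlift _ _ (@prepend_linear tk _)).
rewrite (lin_mlift _ _ (@indeg_linear _ C _ _)).
apply: eq_mlift => xs m hxs; rewrite prepend_elem.
rewrite (elem_heq (q := p + q - 1) _ _ _) ?indeg_id //.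
by rewrite ht; case/andP: hi; lia.
Qed.

(** * The cofaces and the differential *)

Lemma ua_mu u :
  u \lact (Cco_mu Y : T 2)
  = \sw_(u1, u2 <- cop B u) u1 \ox (u2 \ox (1 : NA)) :> T 2.
Proof.
rewrite [LHS](ua_tum_ox (p := 1)); apply: eq_sw => u1 u2.
by rewrite mulr1 [_ \lact _]ua_one.
Qed.

Lemma ocirc_coface n j (us : n.-tuple U) m : (j < n)%N ->
  ocirc j.+1 (elem Y n us m) (Cco_mu Y) =h coface Y j.+1 us m.
Proof.
move=> hj; apply: heq_trans (ocirc_elem _ _ (size_tuple us) hj) _.
rewrite (ua_mu (nth 0 us j)) /coface /= hj.
have ht : size (take j us) = j by rewrite size_takel // size_tuple ltnW.
rewrite (lin_sw _ _ (cup_linear_l _)) (lin_sw _ _ (@prepend_linear _ _)).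
move=> l; rewrite !(lin_sw _ _ (@indeg_linear _ C _ _)); apply: eq_sw => u1 u2.
rewrite cup_ox cup_one.
rewrite -[_ \ox (_ \ox _)]/(elem Y (n - j.+1).+2 [:: u1, u2 & drop j.+1 us] m).
rewrite prepend_elem; apply: elem_heq; rewrite ht; lia.
Qed.

Lemma cup_coface n (us : n.-tuple U) m :
  (cup (elem Y n us m : T n) (Cco_one Y : T 1) : C (n + 1))
  =h coface Y n.+1 us m.
Proof.
rewrite /coface [_ == _]/= ltnn [cup _ _]cup_elem ?size_tuple //.
have -> : iter_co Y 1 m = delta m by exact: sw_ox.
move=> l; rewrite [mlift _ _]/= !(lin_sw _ _ (@indeg_linear _ C _ _)).
apply: eq_sw => w m0; rewrite mulr1 (_ : mulseq _ _ = [:: w]) ?cats1;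
  last by rewrite /mulseq /= mulr1.
by apply: elem_heq; rewrite addn1.
Qed.

(** For x = (u^1, ..., u^n, m) the terms match one by one: mu o_2 x is the coface of index 0, mu o_1
    x the last one, and x o_i mu the one of index i, because u acts on [mu] by its coproduct. *)
Lemma op_bracket_coface n (us : n.-tuple U) m :
  indeg n.+1 (op_bracket (@ocirc) (Cco_mu Y) (elem Y n us m))
  = \sum_(0 <= i < n.+2) (-1) ^+ i *: coface Y i us m.
Proof.
have s_n : sgi (shdeg n) = - (-1) ^+ n :> k.
  by rewrite /shdeg sgiD sgiN sgi1 mulrN1.
rewrite [op_bracket _ _ _](_ : _ = ocirc 2 (Cco_mu Y) (elem Y n us m)
  + sgi (shdeg n) *: ocirc 1 (Cco_mu Y) (elem Y n us m)
  - indeg (2 + n - 1) (\sum_(0 <= i < n) (-1) ^+ i *: ocirc i.+1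
    (elem Y n us m) (Cco_mu Y)));
  last first.
  rewrite /op_bracket; congr (_ - _).
    rewrite /op_bar big_ltn // big_nat1 /shdeg subrr mulr0 sgi0 !mul1r !mulr1
      scale1r.
    by rewrite scalerDr scalerA sgi_sqr scale1r addrC.
  rewrite /op_bar !indegZ scalerA [shdeg n * _]mulrC sgi_sqr scale1r.
  rewrite big_add1 /=; congr indeg; apply: eq_bigr => i _.
  by rewrite /shdeg !intS mul1r [1 + _]addrC !addrK.
rewrite !indegD indegZ (linN _
  (@indeg_linear _ C _ _)) ocirc_mu2 ocirc_mu1 cup_coface.
rewrite indeg_id (lin_sum _ _ _ (@indeg_linear _ C _ _)).
rewrite (lin_sum _ _ _ (@indeg_linear _ C _ _)).
rewrite [RHS]big_nat_recl // expr0 scale1r [coface _ 0 _ _]/= indeg_id -addrA.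
congr (_ + _); rewrite [RHS]big_nat_recr //= addrC s_n exprSr mulrN1.
congr (_ + _); rewrite -sumrN; apply: eq_big_nat => i /andP[_ hi].
rewrite !indegZ heq_indeg; last by lia.
by rewrite ocirc_coface // indeg_id exprSr mulrN1 scaleNr.
Qed.

Definition beta n (x : C n) : C n.+1 :=
  indeg n.+1 (op_bracket (@ocirc) (Cco_mu Y) x).

Lemma beta_linear n : linear (@beta n).
Proof.
apply: (lin_indeg (V := C)); exact: op_bracket_linear_r ocirc_is_operad _ _ _.
Qed.

HB.instance Definition _ n :=
  GRing.isLinear.Build k (C n) (C n.+1) _ (@beta n) (@beta_linear n).

Definition differential n : {linear C n -> C n.+1} := @beta n.

Lemma op_bracket_beta n (x : C n) : op_bracket (@ocirc) (Cco_mu Y) x =h beta x.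
Proof. by apply/heq_sym/heq_indeg; lia. Qed.

End Operad.

Unset Implicit Arguments.

Theorem theorem1p4 (k : comPzRingType) (A U : pzAlgType k)
    (B : left_bialgebroid A U) (N : pzAlgType k) (Y : yd_algebra B N)
    (hY : braided_commutative Y) :
  exists (circ : circ_ops (Cco Y))
         (beta : forall n : nat, {linear Cco Y n -> Cco Y n.+1}),
    [/\ circ_formula circ,
        is_operad_mult circ (Cco_one Y) (Cco_mu Y) (Cco_e Y),
        diff_formula beta,
        (forall (n : nat) (x : Cco Y n), beta n.+1 (beta n x) = 0) /\
        (forall (n : nat) (x : Cco Y n),
           op_bracket circ (Cco_mu Y) x =h beta n x)
      & exists (cup : forall p q, coh beta p -> coh beta q -> coh beta
        (p + q)%N)
               (one : coh beta 0%N)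
               (br : forall p q, coh beta p -> coh beta q ->
                       coh beta (p + q - 1)%N),
          induced_by circ (Cco_mu Y) (Cco_e Y) cup one br
          /\ is_gerstenhaber cup one br].
Proof.
have HO := ocirc_is_operad hY; have Hmu := ocirc_is_operad_mult hY.
pose d n : {linear Cco Y n -> Cco Y n.+1} := differential hY n.
have Hd n (x : Cco Y n) : op_bracket (@ocirc k A U B N Y) (Cco_mu Y) x =h d n x.
  exact: op_bracket_beta.
exists (@ocirc k A U B N Y), d; split=> //.
- exact: ocirc_circ_formula.
- by move=> n us m; apply: op_bracket_coface.
- by split=> // n x; apply: (d_d HO Hmu Hd).
exact: (gerstenhaber_cohomology HO Hmu Hd).
Qed.
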